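(* Let $l,d,m\in\mathbb N$ with $l\ge 2$, $d\geq 1$, $m>d$, and let $\rho>0$. There is a constant $\kappa>0$, depending only on $l,d,m,\rho$, such that the following holds. Let $\omega\in\mathbb R^d$ satisfy $k\cdot\omega\neq 0$ for all $k\in\mathbb Z^d\setminus\{0\}$. Let $B\subset\mathbb C$ be an open ball around the origin and let $f,h$ be analytic in $\mathbb T^d_\rho\times B$ and real for real arguments, with $h$ vanishing to order $l+1$ at $x=0$, and $\widetilde f(\cdot,0)\in H^{\rho,m}(\mathbb T^d,\mathbb C)$. Assume $\overline f(0)\neq 0$ and $$\|\widetilde f(\cdot,0)\|_{H^{\rho,m}}\le \kappa\,|\overline f(0)|.$$ Then there exists $\varepsilon_0>0$ such that, with $$\mathcal I=\begin{cases}(-\varepsilon_0,\varepsilon_0) & l \text{ odd},\\ (-\varepsilon_0,0)& l\text{ even and }\overline f(0)>0,\\ (0,\varepsilon_0)& l\text{ even and }\overline f(0)<0,\end{cases}$$ for every $\varepsilon\in\mathcal I$ the equation $$\dot x=x^l+h(\omega t,x)+\varepsilon f(\omega t,x),\qquad x\in\mathbb R,$$ has a solution of the form $x(t)=a+V(\omega t)$ with $a\in\mathbb R$ and $V\in H^{\rho,m}$ (real-valued for real arguments). Moreover, this solution is locally unique.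
   Context: $\mathbb T^d=\mathbb R^d/(2\pi\mathbb Z)^d$, and $\mathbb T^d_\rho=\{\theta\in\mathbb C^d/(2\pi\mathbb Z)^d:\ |\mathrm{Im}\,\theta_j|\le\rho,\ j=1,\dots,d\}$. For a function $V(\theta)=\sum_{k\in\mathbb Z^d}\widehat V_k e^{\mathrm i k\cdot\theta}$, set $\|V\|_{H^{\rho,m}}^2=\sum_{k}|\widehat V_k|^2e^{2\rho|k|}(|k|^2+1)^m$ with $|k|=|k_1|+\dots+|k_d|$; $H^{\rho,m}$ is the space of (analytic) functions on $\mathbb T^d_\rho$ with finite norm. For a function $f(\theta,x)$, $\overline f(x)=\int_{\mathbb T^d}f(\theta,x)\,d\theta$ (normalized measure, so this is the average in $\theta$) and $\widetilde f(\theta,x)=f(\theta,x)-\overline f(x)$. ''$h$ vanishes to order $l+1$'' means $h(\theta,x)=x^{l+1}H(\theta,x)$ with $H$ analytic. ''Locally unique'' means: the number $a$ in the solution is a real root of $a^l+\varepsilon\overline f(0)=0$, and, this $a$ being fixed, there is a constant $A>0$ independent of $\varepsilon$ such that $V$ is the only function in the closed ball of radius $A|\varepsilon|^{1/l}$ around $0$ in the space of functions of $H^{\rho,m}$ that are real for real arguments for which $a+V(\omega t)$ solves the equation. *)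

(* Defs.v *)
From HB Require Import structures.
From mathcomp Require Import all_boot all_order all_algebra finmap complex.
From mathcomp Require Import all_classical all_reals all_analysis.
From mathcomp Require Import summability.
Set Implicit Arguments.
Unset Strict Implicit.
Unset Printing Implicit Defensive.
Import Order.TTheory GRing.Theory Num.Theory.
Import numFieldNormedType.Exports.
Local Open Scope classical_set_scope.
Local Open Scope ring_scope.
Local Open Scope complex_scope.

Section Defs.
Variable R : realType.
Local Notation C := R[i].
Local Notation Re := (@complex.Re R).
Local Notation Im := (@complex.Im R).
Local Notation normc := (@Normc.normc R).

(* Unconditional convergence: the limit is along the finite subsets of I. *)
Definition has_sum (I : choiceType) (u : I -> C) (s : C) : Prop :=
  (@partial_sum I C^o u) @ totally --> (s : C^o).

Definition expC (z : C) : C :=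
  (expR (Re z))%:C * (cos (Im z) +i* sin (Im z)).

Section Torus.
Variable d : nat.

Definition toC (theta : 'rV[R]_d) : 'rV[C]_d := map_mx (real_complex R) theta.

Definition basis_vec (j : 'I_d) : 'rV[C]_d := delta_mx 0 j.

(* The preimage in C^d of the complex torus T^d_rho; functions on the torus are
   the 2 pi-periodic functions on this strip. *)
Definition strip (rho : R) : set 'rV[C]_d :=
  [set theta : 'rV[C]_d | forall j, `|Im (theta 0 j)| <= rho].

Definition disc (r : R) : set C := [set x | normc x < r].

Definition monomial (p : 'rV[C]_d) (q : C) (theta : 'rV[C]_d) (x : C)
    (alpha : 'rV[nat]_d * nat) : C :=
  (\prod_(j < d) (theta 0 j - p 0 j) ^+ alpha.1 0 j) * (x - q) ^+ alpha.2.

(* g is the sum of a power series in d + 1 variables on a polydisc. *)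
Definition analytic_at (g : 'rV[C]_d -> C -> C) (p : 'rV[C]_d) (q : C) : Prop :=
  exists2 s : R, 0 < s &
  exists c : 'rV[nat]_d * nat -> C,
  forall (theta : 'rV[C]_d) (x : C), (forall j, normc (theta 0 j - p 0 j) < s) ->
    normc (x - q) < s ->
    has_sum (fun alpha => c alpha * monomial p q theta x alpha) (g theta x).

(* The strip is closed, so analyticity at all of its points is analyticity on
   an open neighbourhood of it: the values of g outside the strip are those of
   the continuation. *)
Definition torus_analytic (rho r : R) (g : 'rV[C]_d -> C -> C) : Prop :=
  (forall (theta : 'rV[C]_d) (x : C) (j : 'I_d), strip rho theta -> disc r x ->
     g (theta + (2 * pi)%:C *: basis_vec j) x = g theta x) /\
  (forall (theta : 'rV[C]_d) (x : C), strip rho theta -> disc r x -> analytic_at g theta x).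

Definition real_on_reals (r : R) (g : 'rV[C]_d -> C -> C) : Prop :=
  forall (theta : 'rV[R]_d) (x : R), `|x| < r -> g (toC theta) x%:C \is Num.real.

Definition torus_real (V : 'rV[C]_d -> C) : Prop :=
  forall theta : 'rV[R]_d, V (toC theta) \is Num.real.

Definition vanishes_to_order (n : nat) (rho r : R) (g : 'rV[C]_d -> C -> C) :
    Prop :=
  exists2 H : 'rV[C]_d -> C -> C, torus_analytic rho r H &
    forall (theta : 'rV[C]_d) (x : C), strip rho theta -> disc r x -> g theta x = x ^+ n * H theta x.

End Torus.

(* The integral over [0, 2 pi]^n divided by (2 pi)^n, as an iterated integral. *)
Fixpoint torus_mean (n : nat) : ('rV[R]_n -> R) -> R :=
  match n with
  | 0 => fun g => g 0
  | n'.+1 => fun g =>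
      (2 * pi)^-1 * Rintegral lebesgue_measure `[0, 2 * pi]
        (fun t => torus_mean (fun theta : 'rV[R]_n' =>
                                g (row_mx (const_mx t : 'rV[R]_1) theta)))
  end.

Section Sobolev.
Variable d : nat.

Definition meanC (g : 'rV[R]_d -> C) : C :=
  torus_mean (fun theta => Re (g theta)) +i* torus_mean (fun theta => Im (g theta)).

Definition character (k : 'rV[int]_d) (theta : 'rV[C]_d) : C :=
  expC ('i%C * \sum_(j < d) (k 0 j)%:~R * theta 0 j).

Definition fourier (V : 'rV[C]_d -> C) (k : 'rV[int]_d) : C :=
  meanC (fun theta => V (toC theta) * character (- k) (toC theta)).

Definition norm1 (k : 'rV[int]_d) : nat := (\sum_(j < d) `|k 0%R j|)%N.

Definition Hnorm (rho : R) (m : nat) (V : 'rV[C]_d -> C) : \bar R :=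
  sqrte (\esum_(k in [set: 'rV[int]_d])
    (normc (fourier V k) ^+ 2 * expR (2 * rho * (norm1 k)%:R)
      * ((norm1 k)%:R ^+ 2 + 1) ^+ m)%:E).

(* V is the sum of its Fourier series on the closed strip (hence analytic in its
   interior) and has finite norm; only the values of V on the strip matter. *)
Definition in_H (rho : R) (m : nat) (V : 'rV[C]_d -> C) : Prop :=
  (forall theta : 'rV[C]_d, strip rho theta ->
     has_sum (fun k => fourier V k * character k theta) (V theta)) /\
  (Hnorm rho m V < +oo)%E.

Definition average (g : 'rV[C]_d -> C -> C) (x : C) : C :=
  meanC (fun theta => g (toC theta) x).

(* The average itself when g is real at real arguments. *)
Definition average0 (g : 'rV[C]_d -> C -> C) : R := Re (average g 0).

Definition oscillating (g : 'rV[C]_d -> C -> C) (theta : 'rV[C]_d) (x : C) : C :=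
  g theta x - average g x.

(* For f and h real at real arguments with |x| < r, and (in response) V real at
   real arguments, taking real parts loses nothing. *)
Definition solves (l : nat) (r : R) (omega : 'rV[R]_d)
    (f h : 'rV[C]_d -> C -> C) (eps : R) (x : R -> R) : Prop :=
  forall t : R, `|x t| < r /\
    is_derive t 1 x
      (x t ^+ l + Re (h (toC (t *: omega)) (x t)%:C)
        + eps * Re (f (toC (t *: omega)) (x t)%:C)).

Definition response (omega : 'rV[R]_d) (a : R) (V : 'rV[C]_d -> C) (t : R) : R :=
  a + Re (V (toC (t *: omega))).

End Sobolev.

(* f0 stands for the average of f at x = 0; the last case is meant for f0 < 0. *)
Definition eps_range (l : nat) (f0 eps0 : R) : set R :=
  if odd l then `]- eps0, eps0[%classic
  else if 0 < f0 then `]- eps0, 0[%classic else `]0, eps0[%classic.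

End Defs.

(* Main.v *)
Require Import Defs.
From HB Require Import structures.
From mathcomp Require Import all_boot all_order all_algebra finmap complex.
From mathcomp Require Import all_classical all_reals all_analysis.
From mathcomp Require Import summability.
From mathcomp Require Import ring lra zify.
Set Implicit Arguments.
Unset Strict Implicit.
Unset Printing Implicit Defensive.
Import Order.TTheory GRing.Theory Num.Theory.
Import numFieldNormedType.Exports.
Local Open Scope classical_set_scope.
Local Open Scope ring_scope.
Local Open Scope complex_scope.

(** Write x(t) = a + phi(omega t) with a^l + eps f0 = 0, where f0 is the average
    of f(., 0), and put lam = l a^(l-1). The equation becomes
      d/dt phi(omega t) = lam phi(omega t) + N(phi)(omega t),
    where N(phi) collects the terms of degree at least 2 of (a + phi)^l, the
    term h(., a + phi) and eps (f(., a + phi) - f0). On the Fourier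
    coefficient of index k the linear part acts as multiplication by
    i k.omega - lam, and since lam is real and k.omega is real this number has
    modulus at least |lam|, however small k.omega is: there are no small
    divisors, and the linear equation is solved in every weighted space with
    loss 1/|lam| ([linear_solve], [linear_bound]).

    Put alpha = |a| = (|eps| |f0|)^(1/l), so that |lam| = l alpha^(l-1), and
    look for phi in a ball of radius proportional to alpha. There the
    Lipschitz constant of the binomial remainder is a small multiple of |lam|
    if the factor of proportionality ([ratio]) is small enough; those of the
    terms with h and f are O(alpha^l), hence small compared with |lam| when
    eps is small. At phi = 0 the only part of N that is not of order
    alpha^(l+1) is eps times the oscillating part of f(., 0), of norm at most
    |eps| kappa |f0| = kappa alpha^l: the smallness of kappa, independent of
    alpha, makes it admissible ([nonlin_contracts]). So N, followed by the
    solution of the linear equation, is a contraction of the ball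
    ([contraction]). Its fixed point is the response. Any other response in
    the ball is also a fixed point: the coefficients of a solution of the
    linear equation are determined, because an absolutely convergent
    trigonometric series that vanishes along a nonresonant flow has vanishing
    coefficients ([almost_periodic_unique]). For eps = 0, which occurs for odd
    l only, a = 0 and the ball is reduced to 0.

    Two facts support this argument. First, the norm is, up to the constant
    [Kc], submultiplicative, because m > d makes the weight
    (1 + |k|^2)^(-m) summable ([normH_conv]). Secondly, phi |-> g(., phi) maps
    a small ball into the space and is Lipschitz there ([composition]). For
    this g is expanded in powers of x; the Taylor coefficients are analytic in
    a neighbourhood of the closed strip, and one needs that they belong to
    H^{rho,m} with geometric bounds ([analytic_expansion]). This follows from
    the decay of the Fourier coefficients of a function G that is 2 pi
    periodic and locally a power series, with uniform bounds, at every point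
    of the closed strip ([torus_fourier]), which is obtained without contour
    integrals. The discrete Fourier transform of G(theta + .) over the grid of
    mesh h decays like the product of the (1 + k_j^2)^(-q), by summation by
    parts, since the finite differences of G are bounded by powers of h. Its
    limits E k theta satisfy E k (theta + zeta e_j) = (1 + i k_j zeta) E k theta
    up to O(zeta^2), because three values of G on the points theta,
    theta + zeta e_j and theta + h e_j are related up to second order by the
    Cauchy-Riemann equations. Hence E k theta is a constant multiple of
    exp(i k.theta), and taking theta on the edge of the strip puts the factor
    exp(-rho |k|) into the bound. *)

(** * The modulus of a complex number *)
Section ComplexNorm.
Variable R : realType.
Local Notation C := R[i].
Local Notation Re := (@complex.Re R).
Local Notation Im := (@complex.Im R).
Local Notation nc := (@Normc.normc R).
Implicit Types z w : C.

Lemma nc_ge0 z : 0 <= nc z.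
Proof. by case: z => a b; rewrite /= sqrtr_ge0. Qed.

Lemma ncM z w : nc (z * w) = nc z * nc w. Proof. exact: Normc.normcM. Qed.

Lemma ncD z w : nc (z + w) <= nc z + nc w. Proof. exact: le_normcD. Qed.

Lemma ncN z : nc (- z) = nc z. Proof. exact: normcN. Qed.

Lemma nc0 : nc 0 = 0. Proof. exact: Normc.normc0. Qed.

Lemma nc1 : nc 1 = 1. Proof. exact: Normc.normc1. Qed.

Lemma ncB z w : nc (z - w) <= nc z + nc w.
Proof. by rewrite -(ncN w) ncD. Qed.

Lemma nc_distC z w : nc (z - w) = nc (w - z).
Proof. by rewrite -ncN opprB. Qed.

Lemma nc_eq0 z : nc z <= 0 -> z = 0.
Proof.
by move=> h; apply: Normc.eq0_normc; apply/eqP; rewrite eq_le h nc_ge0.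
Qed.

Lemma ncR (x : R) : nc x%:C = `|x|.
Proof. by rewrite /= expr0n /= addr0 sqrtr_sqr. Qed.

Lemma nci : nc 'i%C = 1.
Proof. by rewrite /= expr0n /= add0r expr1n sqrtr1. Qed.

Lemma ncX z n : nc (z ^+ n) = nc z ^+ n.
Proof. by elim: n => [|n IH]; rewrite ?expr0 ?nc1// !exprS ncM IH. Qed.

Lemma nc_prod (I : Type) (r : seq I) (P : pred I) (F : I -> C) :
  nc (\prod_(i <- r | P i) F i) = \prod_(i <- r | P i) nc (F i).
Proof. exact: (big_morph _ ncM nc1). Qed.

Lemma nc_sum (I : Type) (r : seq I) (P : pred I) (F : I -> C) :
  nc (\sum_(i <- r | P i) F i) <= \sum_(i <- r | P i) nc (F i).
Proof.
elim/big_ind2: _ => [|x y z w h1 h2|//]; first by rewrite nc0.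
by apply: le_trans (ncD _ _) _; apply: lerD.
Qed.

Lemma ncV z : nc z^-1 = (nc z)^-1. Proof. exact: Normc.normcV. Qed.

Lemma nc_conj z : nc (conjc z) = nc z.
Proof. by case: z => a b /=; rewrite sqrrN. Qed.

Lemma Re_le_nc z : `|Re z| <= nc z.
Proof.
case: z => a b /=; rewrite -sqrtr_sqr ler_wsqrtr// lerDl; exact: sqr_ge0.
Qed.

Lemma Im_le_nc z : `|Im z| <= nc z.
Proof.
case: z => a b /=; rewrite -sqrtr_sqr ler_wsqrtr// lerDr; exact: sqr_ge0.
Qed.

Lemma complexRI z : z = (Re z)%:C + 'i%C * (Im z)%:C.
Proof. exact: complexE. Qed.

Lemma nc_le_ReIm z : nc z <= `|Re z| + `|Im z|.
Proof. by rewrite {1}[z]complexRI (le_trans (ncD _ _))// ncM nci mul1r !ncR. Qed.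

Lemma ReD z w : Re (z + w) = Re z + Re w. Proof. by case: z w => ? ? []. Qed.
Lemma ImD z w : Im (z + w) = Im z + Im w. Proof. by case: z w => ? ? []. Qed.
Lemma ReN z : Re (- z) = - Re z. Proof. by case: z. Qed.
Lemma ImN z : Im (- z) = - Im z. Proof. by case: z. Qed.
Lemma ReB z w : Re (z - w) = Re z - Re w. Proof. by rewrite ReD ReN. Qed.
Lemma ImB z w : Im (z - w) = Im z - Im w. Proof. by rewrite ImD ImN. Qed.
Lemma ReM z w : Re (z * w) = Re z * Re w - Im z * Im w.
Proof. by case: z w => ? ? []. Qed.
Lemma ImM z w : Im (z * w) = Re z * Im w + Im z * Re w.
Proof. by case: z w => ? ? []. Qed.
Lemma ReMl (x : R) z : Re (x%:C * z) = x * Re z.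
Proof. by rewrite ReM /= mul0r subr0. Qed.
Lemma complex_ext z w : Re z = Re w -> Im z = Im w -> z = w.
Proof. by case: z w => ? ? [? ?] /= -> ->. Qed.
Lemma realCM (x y : R) : (x * y)%:C = x%:C * y%:C. Proof. by rewrite rmorphM. Qed.
Lemma realCD (x y : R) : (x + y)%:C = x%:C + y%:C. Proof. by rewrite rmorphD. Qed.
Lemma realCX (x : R) n : (x ^+ n)%:C = x%:C ^+ n. Proof. by rewrite rmorphXn. Qed.

Lemma real_CP z : z \is Num.real -> z = (Re z)%:C.
Proof. by move/RRe_real->. Qed.

Lemma ncR_ge0 (x : R) : 0 <= x -> nc x%:C = x.
Proof. by move=> h; rewrite ncR ger0_norm. Qed.

End ComplexNorm.

(** * Unconditional sums of complex families *)
Section Sums.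
Variable R : realType.
Local Notation C := R[i].
Local Notation Re := (@complex.Re R).
Local Notation Im := (@complex.Im R).
Local Notation nc := (@Normc.normc R).

(** For nonnegative families this says that the family is summable with sum at most M;
    in this form bounds are transferred without ever naming the infinite sum. *)
Definition sum_le (I : choiceType) (v : I -> R) (M : R) :=
  forall F : {fset I}, \sum_(i <- F) v i <= M.

Definition abs_le (I : choiceType) (u : I -> C) (M : R) :=
  sum_le (fun i => nc (u i)) M.

Local Existing Instance totally_filter.

Section OneIndex.
Variable I : choiceType.
Implicit Types (u w : I -> C) (v : I -> R) (F : {fset I}).

Lemma has_sumP u s : has_sum u s <->
  forall e : R, 0 < e -> exists F0, forall F, (F0 `<=` F)%fset ->
    nc (s - \sum_(i <- F) u i) < e.
Proof.
have pE F : @partial_sum I C^o u F = \sum_(i <- F) u i.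
  by rewrite /partial_sum big_seq_fsetE.
split=> [/cvgrPdist_lt h e e0|h].
  have e0' : 0 < e%:C by rewrite ltcR.
  have [F0 _ hF] : filter_from setT (fun A => [set B | A `<=` B]%fset)
      (fun F => `|s - @partial_sum I C^o u F| < e%:C) by exact: (h _ e0').
  by exists F0 => F /hF /=; rewrite pE -ltcR.
apply/cvgrPdist_lt => e e0.
have e0' : 0 < Re e by move: e0; rewrite ltcE => /andP[].
have eE : e = (Re e)%:C by apply: real_CP; exact: gtr0_real.
have [F0 hF] := h _ e0'.
exists F0 => // F FF; rewrite pE eE.
by have := hF _ FF; rewrite -ltcR.
Qed.

Lemma has_sum_unique u s t : has_sum u s -> has_sum u t -> s = t.
Proof.
move=> /has_sumP hs /has_sumP ht; apply/eqP; rewrite -subr_eq0; apply/eqP.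
apply: nc_eq0; apply/ler_addgt0Pl => e e0; rewrite addr0.
have e2 : 0 < e / 2 by rewrite divr_gt0.
have [F1 h1] := hs _ e2; have [F2 h2] := ht _ e2.
have := h1 _ (fsubsetUl F1 F2); have := h2 _ (fsubsetUr F1 F2).
set S := \sum_(i <- _) _ => a b.
have -> : s - t = (s - S) - (t - S) by ring.
by apply: le_trans (ncB _ _) _; lra.
Qed.

Lemma has_sumD u w s t : has_sum u s -> has_sum w t ->
  has_sum (fun i => u i + w i) (s + t).
Proof.
move=> /has_sumP hs /has_sumP ht; apply/has_sumP => e e0.
have e2 : 0 < e / 2 by rewrite divr_gt0.
have [F1 h1] := hs _ e2; have [F2 h2] := ht _ e2.
exists (F1 `|` F2)%fset => F; rewrite fsubUset => /andP[/h1 a /h2 b].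
rewrite big_split /= opprD addrACA.
by apply: le_lt_trans (ncD _ _) _; lra.
Qed.

Lemma has_sumZ u s (c : C) : has_sum u s -> has_sum (fun i => c * u i) (c * s).
Proof.
move=> /has_sumP hs; apply/has_sumP => e e0.
have c0 : 0 < nc c + 1 by rewrite ltr_wpDl// nc_ge0.
have [F1 h1] := hs (e / (nc c + 1)) (divr_gt0 e0 c0).
exists F1 => F /h1; rewrite -mulr_sumr -mulrBr ncM ltr_pdivlMr// => h.
apply: le_lt_trans h; rewrite mulrC ler_wpM2l ?nc_ge0// lerDl//.
Qed.

Arguments has_sumZ {u s} c _.

Lemma has_sumN u s : has_sum u s -> has_sum (fun i => - u i) (- s).
Proof.
by move=> /(has_sumZ (-1)); rewrite mulN1r; under eq_fun do rewrite mulN1r.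
Qed.

Lemma has_sumB u w s t : has_sum u s -> has_sum w t ->
  has_sum (fun i => u i - w i) (s - t).
Proof. by move=> hu hw; exact: (has_sumD hu (has_sumN hw)). Qed.

Lemma has_sum_conj u s : has_sum u s -> has_sum (fun i => conjc (u i)) (conjc s).
Proof.
move=> /has_sumP hs; apply/has_sumP => e e0.
have [F1 h1] := hs _ e0.
by exists F1 => F /h1; rewrite -rmorph_sum -rmorphB nc_conj.
Qed.

Lemma has_sum_eq u w s : u =1 w -> has_sum u s -> has_sum w s.
Proof. by move=> /funext ->. Qed.

Lemma has_sum_nc_le u s M :
  (forall F, nc (\sum_(i <- F) u i) <= M) -> has_sum u s -> nc s <= M.
Proof.
move=> hM /has_sumP hs; apply/ler_addgt0Pl => e e0.
have [F1 /(_ _ (fsubset_refl _)) h1] := hs _ e0.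
rewrite -(subrK (\sum_(i <- F1) u i) s) (le_trans (ncD _ _))//.
by apply: lerD; [exact: ltW | exact: hM].
Qed.

Lemma abs_le_nc u s M : abs_le u M -> has_sum u s -> nc s <= M.
Proof. by move=> h; apply: has_sum_nc_le => F; apply: le_trans (nc_sum _ _ _) _; exact: h. Qed.

Lemma sum_le_ge0 v M : sum_le v M -> 0 <= M.
Proof. by move/(_ fset0); rewrite big_seq_fset0. Qed.

Lemma sum_le_pt v M i : sum_le v M -> v i <= M.
Proof. by move/(_ [fset i]%fset); rewrite big_seq_fset1. Qed.

Lemma sum_leW v v' M M' : (forall i, v i <= v' i) -> M' <= M -> sum_le v' M' -> sum_le v M.
Proof. by move=> h hM hs F; apply: le_trans (le_trans (hs F) hM); apply: ler_sum. Qed.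

Lemma sum_leZ v M c : 0 <= c -> sum_le v M -> sum_le (fun i => c * v i) (c * M).
Proof. by move=> c0 h F; rewrite -mulr_sumr ler_wpM2l. Qed.

Lemma sum_leD v v' M M' : sum_le v M -> sum_le v' M' ->
  sum_le (fun i => v i + v' i) (M + M').
Proof. by move=> h h' F; rewrite big_split lerD. Qed.

Lemma sum_fset_le v F G : (forall i, 0 <= v i) -> (F `<=` G)%fset ->
  \sum_(i <- F) v i <= \sum_(i <- G) v i.
Proof.
move=> v0 FG; rewrite [leRHS](big_fsetID _ (mem F))/= -[leLHS]addr0 lerD//; last first.
  by apply: sumr_ge0.
rewrite le_eqVlt; apply/orP; left; apply/eqP; apply: congr_big => //.
congr enum_fset; apply/fsetP => x; rewrite !inE/=.
by case: (boolP (x \in F)) => [/(fsubsetP FG) ->|]; rewrite ?andbF.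
Qed.

Lemma sum_fsetU v F G : [disjoint F & G]%fset ->
  \sum_(i <- (F `|` G)%fset) v i = \sum_(i <- F) v i + \sum_(i <- G) v i.
Proof.
move=> dFG; rewrite (big_fsetID _ (mem F))/=; congr (_ + _); apply: congr_big => //;
  congr enum_fset; apply/fsetP => x; rewrite !inE/=.
  by case: (x \in F); rewrite ?andbF.
move/fdisjointP: dFG => /(_ x).
by case: (x \in F) => [/(_ isT) /negbTE ->|]; rewrite ?andbF ?andbT.
Qed.

Lemma sum_le_sup v M : (forall i, 0 <= v i) -> sum_le v M ->
  exists2 S, sum_le v S & forall e, 0 < e -> exists F, S - e < \sum_(i <- F) v i.
Proof.
move=> v0 hM; pose A := [set \sum_(i <- F) v i | F in [set: {fset I}]].
have hA : has_sup A.
  split; first by exists 0, fset0 => //; rewrite big_seq_fset0.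
  by exists M => _ [F _ <-].
exists (sup A) => [F|e e0]; first by apply: ub_le_sup; [exact: hA.2 | exists F].
by have [_ [F _ <-] h] := sup_adherent e0 hA; exists F.
Qed.

Lemma sum_le_tail v M : (forall i, 0 <= v i) -> sum_le v M ->
  forall e, 0 < e -> exists F0, forall F, [disjoint F & F0]%fset ->
    \sum_(i <- F) v i < e.
Proof.
move=> v0 hM e e0; have [S hS /(_ _ e0)[F0 h0]] := sum_le_sup v0 hM.
exists F0 => F dF; have := hS (F `|` F0)%fset; rewrite sum_fsetU//; lra.
Qed.

Lemma has_sum_ge0 v M : (forall i, 0 <= v i) -> sum_le v M ->
  exists s : R, has_sum (fun i => (v i)%:C) s%:C.
Proof.
move=> v0 hM; have [S hS hS'] := sum_le_sup v0 hM.
exists S; apply/has_sumP => e e0; have [F0 h0] := hS' _ e0.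
exists F0 => F FF; rewrite -rmorph_sum -rmorphB ncR.
have := hS F; have := sum_fset_le v0 FF => a b.
by rewrite ger0_norm; lra.
Qed.

(** x is the difference of the nonnegative families |x| + x and |x|. *)
Lemma has_sum_real (x : I -> R) M : sum_le (fun i => `|x i|) M ->
  exists s : R, has_sum (fun i => (x i)%:C) s%:C.
Proof.
move=> hM; have [s hs] := has_sum_ge0 (fun i => normr_ge0 (x i)) hM.
have [t ht] : exists t : R, has_sum (fun i => (`|x i| + x i)%:C) t%:C.
  apply: (@has_sum_ge0 _ (2 * M)) => [i|].
    by rewrite -lerBlDl sub0r lerNl -normrN ler_norm.
  apply: sum_leW (lexx _) (sum_leZ _ hM) => //= i.
  by rewrite mulr2n mulrDl mul1r lerD2l ler_norm.
exists (t - s); rewrite rmorphB.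
apply: has_sum_eq (has_sumB ht hs) => i.
by rewrite rmorphD addrAC subrr add0r.
Qed.

Lemma abs_le_has_sum u M : abs_le u M -> exists s, has_sum u s.
Proof.
move=> hM.
have [s hs] : exists s : R, has_sum (fun i => (Re (u i))%:C) s%:C.
  by apply: (@has_sum_real _ M); apply: sum_leW (lexx _) hM => i; exact: Re_le_nc.
have [t ht] : exists s : R, has_sum (fun i => (Im (u i))%:C) s%:C.
  by apply: (@has_sum_real _ M); apply: sum_leW (lexx _) hM => i; exact: Im_le_nc.
exists (s%:C + 'i%C * t%:C).
by apply: has_sum_eq (has_sumD hs (has_sumZ 'i%C ht)) => i; rewrite -complexRI.
Qed.

Lemma has_sum_supp u F : (forall i, i \notin F -> u i = 0) ->
  has_sum u (\sum_(i <- F) u i).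
Proof.
move=> u0; apply/has_sumP => e e0; exists F => G FG.
by rewrite (big_fset_incl _ FG) ?subrr ?nc0// => i _; exact: u0.
Qed.

Lemma has_sum_bounded u s : has_sum u s -> exists M, forall i, nc (u i) <= M.
Proof.
move=> /has_sumP hs; have [F0 h0] := hs 1 ltr01.
exists (2 + \sum_(i <- F0) nc (u i)) => i.
have S0 : 0 <= \sum_(i <- F0) nc (u i) by apply: sumr_ge0 => ? _; exact: nc_ge0.
have [iF|iF] := boolP (i \in F0).
  rewrite (big_fsetD1 i)//= addrCA lerDl addr_ge0//.
  by apply: sumr_ge0 => ? _; exact: nc_ge0.
have := h0 _ (fsubset_refl _); have := h0 _ (fsubsetUr [fset i]%fset F0).
rewrite big_fsetU1//=; set S := \sum_(i <- F0) u i => a b.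
have -> : u i = (s - S) - (s - (u i + S)) by ring.
by apply: le_trans (ncB _ _) _; lra.
Qed.

(** Dominated convergence. Outside a finite set the terms of A and of all a n are
    uniformly negligible, being dominated by B; on that finite set convergence is
    termwise. The a n have the same sum g for all large n, and A inherits it. *)
Lemma Tannery (T : Type) (U : set_system T) (PU : ProperFilter U) (a : T -> I -> C)
   (A : I -> C) (B : I -> R) (M : R) (g : C) :
  sum_le B M ->
  (\forall n \near U, (forall k, nc (a n k) <= B k) /\ has_sum (a n) g) ->
  (forall k e, 0 < e -> \forall n \near U, nc (A k - a n k) < e) ->
  has_sum A g.
Proof.
move=> hB hU hA; apply/has_sumP => e e0.
have e2 : 0 < e / 2 by rewrite divr_gt0.
have B0 k : 0 <= B k.
  by have [n [h _]] := filter_ex hU; apply: le_trans (nc_ge0 _) (h k).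
have [F0 h0] := sum_le_tail B0 hB e2; exists F0 => F FF.
have near1 : \forall n \near U, nc (\sum_(i <- F) A i - \sum_(i <- F) a n i) < e / 2.
  have : \forall n \near U, forall i, i \in F -> nc (A i - a n i) < e / 2 / (#|` F|.+1)%:R.
    have : \forall n \near U, all (fun i => nc (A i - a n i) < e / 2 / (#|` F|.+1)%:R) (enum_fset F).
      have c0 : 0 < e / 2 / (#|` F|.+1)%:R by rewrite divr_gt0.
      elim: (enum_fset F) (_ / _) c0 => [|x r IH] c c0; first by apply: filterE.
      have /= := IH c c0; have := hA x c c0.
      by apply: filterS2 => n /= -> ->.
    by apply: filterS => n /allP.
  apply: filterS => n hn; rewrite -sumrB.
  apply: le_lt_trans (nc_sum _ _ _) _.
  apply: (@le_lt_trans _ _ (\sum_(i <- F) (e / 2 / (#|` F|.+1)%:R))).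
    by rewrite big_seq [leRHS]big_seq; apply: ler_sum => i /hn /ltW.
  rewrite big_const_seq count_predT iter_addr_0 -[_ *+ #|` F|]mulr_natr.
  by rewrite mulrAC ltr_pdivrMr// ltr_pM2l// ltr_nat.
have [n [h1 [h2 h3]]] := filter_ex (filterI near1 hU).
have h4 : nc (g - \sum_(i <- F) a n i) <= e / 2.
  have h5 : has_sum (fun i => if i \in F then a n i else 0) (\sum_(i <- F) a n i).
    have -> : \sum_(i <- F) a n i = \sum_(i <- F) (if i \in F then a n i else 0).
      by apply: eq_big_seq => i ->.
    by apply: has_sum_supp => i /negbTE ->.
  apply: has_sum_nc_le (has_sumB h3 h5) => G.
  rewrite (big_fsetID _ (mem F))/= big1_fset ?add0r; last first.
    by move=> i; rewrite !inE => /andP[_ ->]; rewrite subrr.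
  apply: le_trans (nc_sum _ _ _) _.
  apply: le_trans (ltW (h0 [fset x in G | x \notin F]%fset _)); last first.
    by apply/fdisjointP => i; rewrite !inE => /andP[_]; apply: contra; exact: (fsubsetP FF).
  rewrite big_seq [leRHS]big_seq; apply: ler_sum => i; rewrite !inE => /andP[_ /negbTE ->].
  by rewrite subr0.
have -> : g - \sum_(i <- F) A i = (g - \sum_(i <- F) a n i)
      - (\sum_(i <- F) A i - \sum_(i <- F) a n i) by ring.
by apply: le_lt_trans (ncB _ _) _; lra.
Qed.

End OneIndex.
End Sums.

Arguments has_sumZ {R I u s} c _.

(** * Sums over products of index sets *)
Section ProductSums.
Variable R : realType.
Local Notation C := R[i].
Local Notation Re := (@complex.Re R).
Local Notation Im := (@complex.Im R).
Local Notation nc := (@Normc.normc R).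

Lemma sum_le_inj (I J : choiceType) (f : I -> J) (v : J -> R) M :
  injective f -> sum_le v M -> sum_le (fun i => v (f i)) M.
Proof.
move=> fi hv F; have := hv [fset f i | i in F]%fset.
by rewrite big_imfset//= => i j _ _; exact: fi.
Qed.

(** Summability is unconditional, hence insensitive to reindexing. *)
Lemma has_sum_bij (I J : choiceType) (f : I -> J) (g : J -> I) (u : J -> C) s :
  cancel f g -> cancel g f -> has_sum u s -> has_sum (fun i => u (f i)) s.
Proof.
move=> fK gK /has_sumP hs; apply/has_sumP => e /hs [F0 h0].
exists [fset g j | j in F0]%fset => F FF.
have -> : \sum_(i <- F) u (f i) = \sum_(j <- [fset f i | i in F]%fset) u j.
  by rewrite big_imfset//= => i j _ _; exact: (can_inj fK).
apply: h0; apply/fsubsetP => j jF; apply/imfsetP; exists (g j) => //=.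
by apply: (fsubsetP FF); apply/imfsetP; exists j.
Qed.

Lemma has_sum_sum (I J : choiceType) (F : seq I) (u : I -> J -> C) (w : I -> C) :
  (forall i, has_sum (u i) (w i)) ->
  has_sum (fun j => \sum_(i <- F) u i j) (\sum_(i <- F) w i).
Proof.
move=> h; elim: F => [|i F IH].
  rewrite big_nil; under eq_fun do rewrite big_nil.
  have := @has_sum_supp R J (fun=> 0) fset0; rewrite big_seq_fset0; exact.
rewrite big_cons; under eq_fun do rewrite big_cons.
exact: (has_sumD (h i) IH).
Qed.

Arguments has_sum_sum {I J} F {u w} _.

Section Pairs.
Variables I J : choiceType.

Lemma sum_fsetM (V : nmodType) (v : I * J -> V) (A : {fset I}) (B : {fset J}) :
  \sum_(p <- (A `*` B)%fset) v p = \sum_(i <- A) \sum_(j <- B) v (i, j).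
Proof. by rewrite big_imfset2//= => -[i j] [k l] _ _ /= [-> ->]. Qed.

Lemma fset_sub_prod (F : {fset I * J}) :
  (F `<=` [fset p.1 | p in F] `*` [fset p.2 | p in F])%fset.
Proof.
apply/fsubsetP => p pF; rewrite inE; apply/andP; split; apply/imfsetP; by exists p.
Qed.

Lemma sum_le_pair (v : I * J -> R) (B : I -> R) M : (forall p, 0 <= v p) ->
  (forall i, sum_le (fun j => v (i, j)) (B i)) -> sum_le B M -> sum_le v M.
Proof.
move=> v0 hv hB F; apply: le_trans (sum_fset_le v0 (fset_sub_prod F)) _.
rewrite sum_fsetM; apply: le_trans (hB [fset p.1 | p in F]%fset).
by apply: ler_sum => i _; exact: hv.
Qed.

Lemma sum_le_section (v : I * J -> R) M i : sum_le v M -> sum_le (fun j => v (i, j)) M.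
Proof. by apply: (@sum_le_inj _ _ (fun j => (i, j))) => j k []. Qed.

(** Given a finite set F of rows containing the projection of a good finite set F0,
    enlarge the finite set G of columns until F * G contains F0 and each row in F is
    summed up to the error: the sum over F * G is close both to s and to the sum of
    the w i over F. *)
Lemma has_sum_sigma (u : I * J -> C) (w : I -> C) s :
  has_sum u s -> (forall i, has_sum (fun j => u (i, j)) (w i)) -> has_sum w s.
Proof.
move=> /has_sumP hs hw; apply/has_sumP => e e0.
have e2 : 0 < e / 2 by rewrite divr_gt0.
have [F0 h0] := hs _ e2; exists [fset p.1 | p in F0]%fset => F FF.
have /has_sumP /(_ _ e2)[G0 hG] := has_sum_sum F hw.
have h1 := hG _ (fsubsetUl G0 [fset p.2 | p in F0]%fset).
set G := (_ `|` _)%fset in h1.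
have /h0 : (F0 `<=` F `*` G)%fset.
  apply/fsubsetP => p pF; rewrite inE; apply/andP; split.
    by apply: (fsubsetP FF); apply/imfsetP; exists p.
  by rewrite inE; apply/orP; right; apply/imfsetP; exists p.
rewrite sum_fsetM exchange_big /= => h2.
set T := \sum_(j <- G) _ in h1 h2.
have -> : s - \sum_(i <- F) w i = (s - T) - (\sum_(i <- F) w i - T) by ring.
by apply: le_lt_trans (ncB _ _) _; lra.
Qed.

Lemma has_sum_swap (u : I * J -> C) s :
  has_sum u s -> has_sum (fun p : J * I => u (p.2, p.1)) s.
Proof.
by apply: (@has_sum_bij _ _ (fun p => (p.2, p.1)) (fun p => (p.2, p.1))) => -[].
Qed.

Lemma abs_le_sigma (u : I * J -> C) (w : I -> C) M :
  abs_le u M -> (forall i, has_sum (fun j => u (i, j)) (w i)) -> abs_le w M.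
Proof.
move=> hu hw F.
have ex i : exists t : R, has_sum (fun j => (nc (u (i, j)))%:C) t%:C.
  by apply: has_sum_ge0 => [j|]; [exact: nc_ge0 | exact: (sum_le_section i hu)].
have [t ht] := choice ex.
have wt i : nc (w i) <= t i.
  apply: abs_le_nc (hw i) => G; rewrite leNgt; apply/negP => lt.
  have /has_sumP := ht i => /(_ (\sum_(j <- G) nc (u (i, j)) - t i)).
  rewrite subr_gt0 => /(_ lt)[F0 /(_ _ (fsubsetUr G F0))].
  rewrite -rmorph_sum -rmorphB ncR.
  have := sum_fset_le (fun j => nc_ge0 (u (i, j))) (fsubsetUl G F0).
  move=> h; rewrite distrC ger0_norm; first by lra.
  by rewrite subr_ge0 ltW// (lt_le_trans lt).
apply: (@le_trans _ _ (\sum_(i <- F) t i)); first by apply: ler_sum.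
have h := has_sum_sum F ht.
apply: (@le_trans _ _ (nc (\sum_(i <- F) (t i)%:C))).
  by rewrite -rmorph_sum ncR ler_norm.
apply: has_sum_nc_le h => G.
under eq_bigr do rewrite -rmorph_sum.
rewrite -rmorph_sum ncR_ge0; last by do 2! apply: sumr_ge0 => ? _; exact: nc_ge0.
rewrite exchange_big /=.
by rewrite -(@sum_fsetM _ (fun p => nc (u p))); exact: hu.
Qed.

Lemma abs_le_mul (u : I -> C) (w : J -> C) A B :
  abs_le u A -> abs_le w B -> abs_le (fun p : I * J => u p.1 * w p.2) (A * B).
Proof.
move=> hu hw; apply: (@sum_le_pair _ (fun i => B * nc (u i))) => [p|i|].
- exact: nc_ge0.
- rewrite mulrC; apply: sum_leW (lexx _) (sum_leZ (nc_ge0 (u i)) hw) => j /=.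
  by rewrite ncM.
- by rewrite mulrC; apply: sum_leZ => //; exact: sum_le_ge0 hw.
Qed.

Lemma has_sum_mul (u : I -> C) (w : J -> C) A B s t :
  abs_le u A -> abs_le w B -> has_sum u s -> has_sum w t ->
  has_sum (fun p : I * J => u p.1 * w p.2) (s * t).
Proof.
move=> hu hw hs ht; have [S hS] := abs_le_has_sum (abs_le_mul hu hw).
have h := has_sum_sigma hS (fun i => has_sumZ (u i) ht).
suff -> : s * t = S by [].
apply: has_sum_unique h; rewrite mulrC.
by apply: has_sum_eq (has_sumZ t hs) => i; rewrite mulrC.
Qed.

End Pairs.

(** Expanding the product of the sums over a finite A produces the sum over the box
    A^d, and every finite set of vectors lies in such a box. *)
Lemma sum_le_rV (T : choiceType) d (v : 'I_d -> T -> R) (S : 'I_d -> R) :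
  (forall j t, 0 <= v j t) -> (forall j, sum_le (v j) (S j)) ->
  sum_le (fun k : 'rV[T]_d => \prod_j v j (k 0 j)) (\prod_j S j).
Proof.
move=> v0 hv F.
pose A := [fset fun_of_matrix k 0 j | k in F, j in 'I_d]%fset.
pose row (phi : {ffun 'I_d -> A}) : 'rV[T]_d := \row_j val (phi j).
have row_inj : injective row.
  move=> p q /rowP h; apply/ffunP => j; apply: val_inj.
  by have := h j; rewrite !mxE.
apply: (@le_trans _ _ (\sum_(phi : {ffun 'I_d -> A}) \prod_j v j (val (phi j)))); last first.
  rewrite -(bigA_distr_bigA (fun j (a : A) => v j (val a))) /=.
  apply: ler_prod => j _; rewrite sumr_ge0//=; have := hv j A.
  by rewrite big_seq_fsetE.
have -> : \sum_(phi : {ffun 'I_d -> A}) \prod_j v j (val (phi j)) =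
    \sum_(k <- [fset row phi | phi in {ffun 'I_d -> A}]%fset) \prod_j v j (k 0 j).
  rewrite big_imfset /=; last by move=> p q _ _; exact: row_inj.
  rewrite big_enum /=; apply: eq_bigr => phi _; apply: eq_bigr => j _.
  by rewrite mxE.
apply: sum_fset_le => [k|]; first by apply: prodr_ge0.
apply/fsubsetP => k kF; apply/imfsetP => /=.
have kA j : k 0 j \in A by apply/imfset2P; exists k => //; exists j.
exists [ffun j => [` kA j]%fset] => //.
by apply/rowP => j; rewrite mxE ffunE.
Qed.

Lemma sum_le_nat (v : nat -> R) M : (forall n, 0 <= v n) ->
  (forall N, \sum_(n < N) v n <= M) -> sum_le v M.
Proof.
move=> v0 h F; pose N := \max_(n <- F) n.+1.
apply: le_trans (h N).
have -> : \sum_(n < N) v n = \sum_(n <- [fset nat_of_ord x | x in 'I_N]%fset) v n.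
  rewrite big_imfset /=; last by move=> p q _ _; exact: val_inj.
  by rewrite big_enum.
apply: sum_fset_le => //; apply/fsubsetP => n nF; apply/imfsetP => /=.
have nN : (n < N)%N by rewrite /N (big_fsetD1 n)//= leq_maxl.
by exists (Ordinal nN).
Qed.

Lemma geo_le (q : R) N : 0 <= q <= 1 / 2 -> \sum_(n < N) q ^+ n <= 2.
Proof.
move=> /andP[q0 q1].
suff : \sum_(n < N) q ^+ n <= 2 - 2 * (1 / 2) ^+ N.
  have h : 0 <= (1 / 2 : R) ^+ N by apply: exprn_ge0; lra.
  move=> h'; apply: le_trans h' _; lra.
elim: N => [|N IH]; first by rewrite big_ord0 expr0; lra.
rewrite big_ord_recr /= exprS.
have : q ^+ N <= (1 / 2) ^+ N by rewrite lerXn2r ?nnegrE//; lra.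
by lra.
Qed.

Lemma sum_le_geo (q : R) : 0 <= q <= 1 / 2 -> sum_le (fun n : nat => q ^+ n) 2.
Proof.
move=> h; apply: sum_le_nat => [n|N]; last exact: geo_le.
by rewrite exprn_ge0//; case/andP: h.
Qed.

Definition invsq (k : int) : R := (1 + k%:~R ^+ 2)^-1.

Lemma invsq_ge0 k : 0 <= invsq k.
Proof. by rewrite invr_ge0 addr_ge0// sqr_ge0. Qed.

(** Each sign contributes at most 3, by comparison of 1 / (1 + n^2) with the
    telescoping 2 / n - 2 / (n + 1). *)
Lemma sum_le_invsq : sum_le invsq 6.
Proof.
pose v (p : bool * nat) : R := (1 + p.2%:R ^+ 2)^-1.
have -> : invsq = fun k => v (k < 0, `|k|%N).
  apply/funext => k; rewrite /invsq /v /=; congr ((1 + _)^-1).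
  by rewrite natr_absz -rmorphXn/= intr_norm  real_normK ?num_real// rmorphXn.
apply: (@sum_le_inj _ _ (fun k : int => (k < 0, `|k|%N))) => [k k' []|].
  by case: k k' => [n|n] [n'|n'] //= _; [move=> -> | case=> ->].
apply: (@sum_le_pair _ _ _ (fun=> 3)) => [p|b|F].
- by rewrite invr_ge0 addr_ge0// sqr_ge0.
- apply: sum_le_nat => [n|N]; first by rewrite invr_ge0 addr_ge0// sqr_ge0.
  suff : \sum_(n < N.+1) v (b, n : nat) <= 3 - 2 / N.+1%:R.
    rewrite big_ord_recr /= => h.
    have v0 : 0 <= v (b, N) by rewrite invr_ge0 addr_ge0// sqr_ge0.
    have N0 : 0 <= 2 / N.+1%:R :> R by rewrite divr_ge0.
    apply: (@le_trans _ _ (3 - 2 / N.+1%:R)); last by rewrite gerBl.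
    by apply: le_trans h; rewrite lerDl.
  elim: N => [|N IH]; first by rewrite big_ord1 /v /= expr0n/= addr0 invr1; lra.
  rewrite big_ord_recr /= /v /=.
  suff h : (1 + N.+1%:R ^+ 2)^-1 <= 2 / N.+1%:R - 2 / N.+2%:R :> R.
    by apply: le_trans (lerD IH h) _; rewrite addrA subrK.
  rewrite -[N.+2%:R]natr1 -[N.+1%:R]natr1; set x : R := N%:R.
  have x0 : 0 <= x by rewrite ler0n.
  have -> : 2 / (x + 1) - 2 / (x + 1 + 1) = 2 / ((x + 1) * (x + 1 + 1)).
    by field; rewrite !gt_eqF//; lra.
  rewrite -[_^-1]mul1r ler_pdivrMr; last by nra.
  rewrite mulrAC ler_pdivlMr; last by nra.
  by rewrite mul1r; nra.
- have -> : (6 : R) = \sum_(b <- [fset true; false]%fset) 3.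
    by rewrite big_fsetU1/= ?inE// big_seq_fset1; lra.
  apply: sum_fset_le => //; apply/fsubsetP => -[] _; rewrite !inE//.
Qed.

End ProductSums.

Arguments has_sum_sum {R I J} F {u w} _.

(** * Characters of the torus *)
Section Characters.
Variable R : realType.
Variable d : nat.
Local Notation C := R[i].
Local Notation Re := (@complex.Re R).
Local Notation Im := (@complex.Im R).
Local Notation nc := (@Normc.normc R).
Implicit Types (k j : 'rV[int]_d) (theta : 'rV[C]_d) (x : 'rV[R]_d) (z w : C).

Lemma expCD z w : expC (z + w) = expC z * expC w.
Proof.
rewrite /expC ReD ImD expRD cosD sinD; apply: complex_ext => /=; ring.
Qed.

Lemma expC0 : expC (0 : C) = 1.
Proof. by rewrite /expC /= expR0 cos0 sin0 mul1r. Qed.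

Lemma nc_expC z : nc (expC z) = expR (Re z).
Proof.
rewrite /expC ncM ncR_ge0 ?expR_ge0// /Normc.normc.
by rewrite cos2Dsin2 sqrtr1 mulr1.
Qed.

Lemma expC_conj z : conjc (expC z) = expC (conjc z).
Proof.
case: z => a b; rewrite /expC /= cosN sinN; apply: complex_ext; rewrite /=; ring.
Qed.

Definition dot k theta : C := \sum_(j < d) (k 0 j)%:~R * theta 0 j.

Lemma characterE k theta : character k theta = expC ('i%C * dot k theta).
Proof. by []. Qed.

Lemma dotDl k j theta : dot (k + j) theta = dot k theta + dot j theta.
Proof. by rewrite -big_split; apply: eq_bigr => i _; rewrite mxE rmorphD mulrDl. Qed.

Lemma dotNl k theta : dot (- k) theta = - dot k theta.
Proof. by rewrite -sumrN; apply: eq_bigr => i _; rewrite mxE rmorphN mulNr. Qed.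

Lemma dotDr k theta theta' : dot k (theta + theta') = dot k theta + dot k theta'.
Proof. by rewrite -big_split; apply: eq_bigr => i _; rewrite mxE mulrDr. Qed.

Lemma dotZr k z theta : dot k (z *: theta) = z * dot k theta.
Proof. by rewrite mulr_sumr; apply: eq_bigr => i _; rewrite mxE mulrCA. Qed.

Lemma dot0l theta : dot 0 theta = 0.
Proof. by apply: big1 => i _; rewrite mxE mul0r. Qed.

Lemma dot_toC k x : dot k (toC x) = (\sum_(j < d) (k 0 j)%:~R * x 0 j)%:C.
Proof.
rewrite rmorph_sum; apply: eq_bigr => i _.
by rewrite mxE [in RHS]rmorphM /= rmorph_int.
Qed.

Lemma characterD k j theta : character (k + j) theta = character k theta * character j theta.
Proof. by rewrite !characterE dotDl mulrDr expCD. Qed.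

Lemma character0 theta : character 0 theta = 1.
Proof. by rewrite characterE dot0l mulr0 expC0. Qed.

Lemma characterDr k theta theta' :
  character k (theta + theta') = character k theta * character k theta'.
Proof. by rewrite !characterE dotDr mulrDr expCD. Qed.

Lemma nc_character k theta : nc (character k theta) = expR (- Im (dot k theta)).
Proof. by rewrite characterE nc_expC ReM /= mul0r mul1r sub0r. Qed.

Lemma nc_character_real k x : nc (character k (toC x)) = 1.
Proof. by rewrite nc_character dot_toC /= oppr0 expR0. Qed.

Lemma character_conj k x : conjc (character k (toC x)) = character (- k) (toC x).
Proof.
rewrite !characterE expC_conj dotNl dot_toC; congr expC.
by apply: complex_ext; rewrite /= ?oppr0; ring.
Qed.

Lemma norm1N k : norm1 (- k) = norm1 k.
Proof. by apply: eq_bigr => j _; rewrite mxE abszN. Qed.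

Lemma norm1D k j : (norm1 (k + j) <= norm1 k + norm1 j)%N.
Proof. by rewrite /norm1 -big_split /=; apply: leq_sum => i _; rewrite mxE -lez_nat PoszD !abszE ler_normD. Qed.

Lemma norm1_ge k i : (`|k 0%R i| <= norm1 k)%N.
Proof. by rewrite /norm1 (bigD1 i)//= leq_addr. Qed.

Lemma norm1_0 : norm1 (0 : 'rV[int]_d) = 0%N.
Proof. by apply: big1 => i _; rewrite mxE. Qed.

Lemma abs_dot_Im k theta (rho : R) : strip rho theta ->
  `|Im (dot k theta)| <= rho * (norm1 k)%:R.
Proof.
move=> th; have -> : Im (dot k theta) = \sum_(j < d) (k 0 j)%:~R * Im (theta 0 j).
  rewrite (big_morph Im (id1:=0) (op1:=+%R)) //; last by move=> ? ?; exact: ImD.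
  apply: eq_bigr => i _; rewrite ImM.
  have -> : (k 0 i)%:~R = ((k 0 i)%:~R : R)%:C :> C by rewrite rmorph_int.
  by rewrite /= mul0r addr0.
apply: le_trans (ler_norm_sum _ _ _) _.
rewrite /norm1 natr_sum mulr_sumr; apply: ler_sum => i _.
by rewrite normrM mulrC natr_absz intr_norm ler_wpM2r.
Qed.

(** This growth is what the weight exp(rho |k|) of the norm compensates, so that
    Fourier series converge up to the edge of the strip. *)
Lemma nc_character_strip k theta rho : strip rho theta ->
  nc (character k theta) <= expR (rho * (norm1 k)%:R).
Proof.
move=> /(abs_dot_Im k) h; rewrite nc_character ler_expR.
by apply: le_trans h; rewrite -normrN ler_norm.
Qed.

Lemma strip_toC rho x : 0 <= rho -> strip rho (toC x).
Proof. by move=> r0 j; rewrite mxE /= normr0. Qed.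

End Characters.

(** * The weighted norm and its algebra of functions *)
Lemma cauchy_schwarz_sum (R : realFieldType) (I : Type) (r : seq I) (a b : I -> R) :
  (\sum_(i <- r) a i * b i) ^+ 2 <=
    (\sum_(i <- r) a i ^+ 2) * (\sum_(i <- r) b i ^+ 2).
Proof.
elim: r => [|i r IH]; first by rewrite !big_nil expr0n mul0r.
rewrite !big_cons; move: IH.
have : 0 <= \sum_(i <- r) a i ^+ 2 by apply: sumr_ge0 => ? _; exact: sqr_ge0.
have : 0 <= \sum_(i <- r) b i ^+ 2 by apply: sumr_ge0 => ? _; exact: sqr_ge0.
set S := \sum_(j <- r) a j * b j; set A := \sum_(j <- r) a j ^+ 2.
set B := \sum_(j <- r) b j ^+ 2; move: (a i) (b i) => x y B0 A0 h.
have h2 : 2 * S * (x * y) <= A * y ^+ 2 + B * x ^+ 2.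
  apply: le_trans (ler_norm _) _.
  have Z0 : 0 <= A * y ^+ 2 + B * x ^+ 2.
    by apply: addr_ge0; apply: mulr_ge0 => //; exact: sqr_ge0.
  rewrite -(ger0_norm Z0) -ler_sqr ?nnegrE// !real_normK ?num_real//.
  have h3 : S ^+ 2 * (x * y) ^+ 2 <= A * B * (x * y) ^+ 2.
    by rewrite ler_wpM2r ?sqr_ge0.
  have h4 : 0 <= (A * y ^+ 2 - B * x ^+ 2) ^+ 2 by exact: sqr_ge0.
  rewrite -subr_ge0.
  have -> : (A * y ^+ 2 + B * x ^+ 2) ^+ 2 - (2 * S * (x * y)) ^+ 2 =
   (A * y ^+ 2 - B * x ^+ 2) ^+ 2 + 4 * (A * B * (x * y) ^+ 2 - S ^+ 2 * (x * y) ^+ 2) by ring.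
  by rewrite addr_ge0// mulr_ge0// subr_ge0.
rewrite -subr_ge0.
have -> : (x ^+ 2 + A) * (y ^+ 2 + B) - (x * y + S) ^+ 2 =
  (A * B - S ^+ 2) + (A * y ^+ 2 + B * x ^+ 2 - 2 * S * (x * y)) by ring.
by rewrite addr_ge0// subr_ge0.
Qed.

Local Existing Instance totally_filter.

Section Space.
Variable R : realType.
Variables (d m : nat) (rho : R).
Hypothesis hm : (d < m)%N.
Hypothesis hrho : 0 < rho.
Local Notation C := R[i].
Local Notation Re := (@complex.Re R).
Local Notation Im := (@complex.Im R).
Local Notation nc := (@Normc.normc R).
Implicit Types (k j : 'rV[int]_d) (theta : 'rV[C]_d) (x : 'rV[R]_d) (u v : 'rV[int]_d -> C).

(** The weights, and the constant of the algebra property, are locked so that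
    simplification and rewriting do not open them. *)
Definition pw k : R := locked (((norm1 k)%:R ^+ 2 + 1) ^+ m).
Definition ew k : R := locked (expR (rho * (norm1 k)%:R)).
Definition wt k : R := locked (ew k ^+ 2 * pw k).
(** With this factor in the norm the product has norm at most the product of the
    norms; the powers of 4 and of 6 come from [pw_subD] and [sum_le_pwV]. *)
Definition Kc : R := locked (2 * 4 ^+ m * 6 ^+ d).

Lemma pwE k : pw k = ((norm1 k)%:R ^+ 2 + 1) ^+ m. Proof. by rewrite /pw -lock. Qed.
Lemma ewE k : ew k = expR (rho * (norm1 k)%:R). Proof. by rewrite /ew -lock. Qed.
Lemma wtE k : wt k = ew k ^+ 2 * pw k. Proof. by rewrite /wt -lock. Qed.
Lemma KcE : Kc = 2 * 4 ^+ m * 6 ^+ d. Proof. by rewrite /Kc -lock. Qed.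

Lemma base_ge1 k : 1 <= ((norm1 k)%:R ^+ 2 + 1 : R).
Proof. by rewrite lerDr sqr_ge0. Qed.

Lemma pw_ge1 k : 1 <= pw k. Proof. by rewrite pwE exprn_ege1// base_ge1. Qed.
Lemma pw_gt0 k : 0 < pw k. Proof. exact: lt_le_trans (pw_ge1 k). Qed.
Lemma ew_ge1 k : 1 <= ew k.
Proof. by rewrite !ewE -expR0 ler_expR mulr_ge0// ltW. Qed.
Lemma ew_gt0 k : 0 < ew k. Proof. by rewrite ewE expR_gt0. Qed.
Lemma ew_ge0 k : 0 <= ew k. Proof. by rewrite ewE expR_ge0. Qed.
Lemma pw_ge0 k : 0 <= pw k. Proof. exact: ltW (pw_gt0 k). Qed.
Lemma wt_ge1 k : 1 <= wt k.
Proof. by rewrite wtE -[leLHS]mulr1 ler_pM// ?pw_ge1// exprn_ege1// ew_ge1. Qed.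
Lemma wt_gt0 k : 0 < wt k. Proof. exact: lt_le_trans (wt_ge1 k). Qed.
Lemma wt_ge0 k : 0 <= wt k. Proof. exact: ltW (wt_gt0 k). Qed.

Lemma Kc_ge1 : 1 <= Kc.
Proof.
rewrite KcE -[leLHS]mulr1 ler_pM//; last by rewrite exprn_ege1//; lra.
by rewrite -[leLHS]mulr1 ler_pM// ?exprn_ege1//; lra.
Qed.
Lemma Kc_gt0 : 0 < Kc. Proof. exact: lt_le_trans Kc_ge1. Qed.
Lemma Kc_ge0 : 0 <= Kc. Proof. exact: ltW Kc_gt0. Qed.

(** As m > d, (1 + |k|^2)^m is at least the product of the 1 + k_j^2. *)
Lemma sum_le_pwV : sum_le (fun k => (pw k)^-1) (6 ^+ d).
Proof.
have := @sum_le_rV R int d (fun=> @invsq R) (fun=> 6) (fun _ t => invsq_ge0 R t) (fun=> @sum_le_invsq R).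
rewrite prodr_const card_ord; apply: sum_leW => // k.
rewrite /= /invsq prodfV lef_pV2 ?posrE ?pw_gt0//; last first.
  by apply: prodr_gt0 => j _; rewrite ltr_pwDl// sqr_ge0.
apply: (@le_trans _ _ (((norm1 k)%:R ^+ 2 + 1 : R) ^+ d)); last first.
  by rewrite pwE ler_weXn2l ?base_ge1// ltnW.
have -> : forall z : R, z ^+ d = \prod_(i < d) z by move=> z; rewrite prodr_const card_ord.
apply: ler_prod => j _.
rewrite addr_ge0 ?sqr_ge0//= addrC lerD2r.
rewrite -[leLHS]real_normK ?num_real// lerXn2r ?nnegrE//.
by rewrite -intr_norm -natr_absz ler_nat norm1_ge.
Qed.

Lemma ew_subM k j : ew k <= ew j * ew (k - j).
Proof.
rewrite !ewE -expRD ler_expR -mulrDr ler_wpM2l ?(ltW hrho)// -natrD ler_nat.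
by have := norm1D j (k - j); rewrite subrKC.
Qed.

(** The longer one of j and k - j has length at least |k| / 2. *)
Lemma pw_subD k j : pw k <= 4 ^+ m * (pw j + pw (k - j)).
Proof.
have := norm1D j (k - j); rewrite subrKC -(ler_nat R) natrD.
rewrite !pwE; set a : R := (norm1 k)%:R; set b : R := (norm1 j)%:R; set c : R := (norm1 (k - j))%:R.
have a0 : 0 <= a by []; have b0 : 0 <= b by []; have c0 : 0 <= c by [].
clearbody a b c => h.
have pc : 0 <= (c ^+ 2 + 1) ^+ m by rewrite exprn_ge0// addr_ge0// sqr_ge0.
have pb : 0 <= (b ^+ 2 + 1) ^+ m by rewrite exprn_ge0// addr_ge0// sqr_ge0.
have H (x y : R) : 0 <= x -> 0 <= y -> a <= x + y -> x <= y ->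
     (a ^+ 2 + 1) ^+ m <= 4 ^+ m * (y ^+ 2 + 1) ^+ m.
  move=> x0 y0 hxy xy; rewrite -exprMn lerXn2r ?nnegrE//; [nra|nra|nra].
case: (leP b c) => bc.
  by apply: le_trans (H _ _ b0 c0 h bc) _; rewrite ler_wpM2l ?exprn_ge0// lerDr.
apply: le_trans (H c b c0 b0 _ (ltW bc)) _; first by rewrite addrC.
by rewrite ler_wpM2l ?exprn_ge0// lerDl.
Qed.

Lemma wt_sub k j :
  wt k * ((wt j)^-1 * (wt (k - j))^-1) <= 4 ^+ m * ((pw (k - j))^-1 + (pw j)^-1).
Proof.
rewrite -invfM ler_pdivrMr; last by apply: mulr_gt0; exact: wt_gt0.
rewrite !wtE.
apply: (@le_trans _ _ ((ew j * ew (k - j)) ^+ 2 * (4 ^+ m * (pw j + pw (k - j))))).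
  rewrite ler_pM ?exprn_ge0 ?pw_ge0 ?ew_ge0 ?pw_subD//.
  by rewrite lerXn2r ?nnegrE ?mulr_ge0 ?ew_ge0 ?ew_subM.
rewrite le_eqVlt; apply/orP; left; apply/eqP; field.
by rewrite !gt_eqF ?pw_gt0 ?ew_gt0.
Qed.

(** The convolution inequality of the weights, from which the algebra property
    follows by the Cauchy-Schwarz inequality. *)
Lemma sum_wt_sub k (G : {fset 'rV[int]_d}) :
  wt k * (\sum_(j <- G) (wt j)^-1 * (wt (k - j))^-1) <= Kc.
Proof.
rewrite mulr_sumr; apply: le_trans (ler_sum _ (fun j _ => wt_sub k j)) _.
rewrite -mulr_sumr big_split /= KcE mulrAC mulrC ler_wpM2r ?exprn_ge0//.
rewrite mulr2n mulrDl mul1r; apply: lerD; last exact: sum_le_pwV.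
apply: (sum_le_inj (f := fun j => k - j)) sum_le_pwV _.
by move=> x y /addrI /oppr_inj.
Qed.

(** The square of the norm is bounded instead of defined, and multiplied by Kc^2 to make
    the norm submultiplicative. *)
Definition normH u (M : R) :=
  0 <= M /\ sum_le (fun k => Kc ^+ 2 * (nc (u k) ^+ 2 * wt k)) (M ^+ 2).

Lemma normH_term_ge0 u k : 0 <= Kc ^+ 2 * (nc (u k) ^+ 2 * wt k).
Proof. by rewrite mulr_ge0 ?sqr_ge0// mulr_ge0 ?sqr_ge0 ?wt_ge0. Qed.

Lemma normHW u M M' : M <= M' -> normH u M -> normH u M'.
Proof.
move=> h [M0 hu]; split; first exact: le_trans h.
by apply: sum_leW hu => //; rewrite lerXn2r ?nnegrE ?(le_trans M0).
Qed.

Lemma normH_le u v M : (forall k, nc (u k) <= nc (v k)) -> normH v M -> normH u M.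
Proof.
move=> h [M0 hv]; split => //; apply: sum_leW hv => // k.
rewrite ler_wpM2l ?sqr_ge0// ler_wpM2r ?wt_ge0//.
by rewrite lerXn2r ?nnegrE ?nc_ge0.
Qed.

Lemma normHZ u M (c : C) : normH u M -> normH (fun k => c * u k) (nc c * M).
Proof.
move=> [M0 hu]; split; first by rewrite mulr_ge0 ?nc_ge0.
apply: sum_leW (sum_leZ (sqr_ge0 (nc c)) hu) => [k|]; last by rewrite exprMn.
by rewrite ncM exprMn le_eqVlt; apply/orP; left; apply/eqP; ring.
Qed.

(** The Cauchy-Schwarz inequality, with the summability of 1 / pw. It yields the
    absolute convergence of the Fourier series on the closed strip. *)
Lemma normH_emb u M : normH u M -> sum_le (fun k => nc (u k) * ew k) M.
Proof.
move=> [M0 hu] F.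
have K2 : 0 < Kc ^+ 2 by rewrite exprn_gt0 ?Kc_gt0.
rewrite -ler_sqr ?nnegrE//; last first.
  by apply: sumr_ge0 => k _; rewrite mulr_ge0 ?nc_ge0 ?ew_ge0.
have -> : \sum_(k <- F) nc (u k) * ew k =
    \sum_(k <- F) (nc (u k) * Num.sqrt (wt k)) * (ew k / Num.sqrt (wt k)).
  apply: eq_bigr => k _; field.
  by rewrite sqrtr_eq0 -ltNge wt_gt0.
apply: le_trans (cauchy_schwarz_sum _ _ _) _.
apply: (@le_trans _ _ ((M ^+ 2 / Kc ^+ 2) * 6 ^+ d)).
  apply: ler_pM.
  - by apply: sumr_ge0 => k _; exact: sqr_ge0.
  - by apply: sumr_ge0 => k _; exact: sqr_ge0.
  - rewrite ler_pdivlMr// mulrC mulr_sumr; apply: le_trans (hu F).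
    by apply: ler_sum => k _; rewrite exprMn sqr_sqrtr ?wt_ge0.
  apply: le_trans (sum_le_pwV F); apply: ler_sum => k _.
  rewrite exprMn exprVn sqr_sqrtr ?wt_ge0// !wtE.
  by rewrite invfM mulrA divff ?mul1r// expf_neq0// gt_eqF ?ew_gt0.
rewrite mulrAC ler_pdivrMr// ler_wpM2l ?sqr_ge0//.
apply: (@le_trans _ _ Kc); last by rewrite expr2 ler_peMr ?Kc_ge1 ?Kc_ge0.
rewrite KcE ler_peMl ?exprn_ge0//.
by rewrite -[leLHS]mulr1 ler_pM// ?exprn_ege1//; lra.
Qed.

Lemma normH_pt u M k : normH u M -> nc (u k) <= M.
Proof.
move=> /normH_emb /(sum_le_pt k); apply: le_trans.
by rewrite ler_peMr ?nc_ge0 ?ew_ge1.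
Qed.

Lemma normH_abs u M : normH u M -> abs_le u M.
Proof.
move/normH_emb; apply: sum_leW => // k.
by rewrite ler_peMr ?nc_ge0 ?ew_ge1.
Qed.

(** Minkowski's inequality, from
    (a + b)^2 <= (1 + N / M) a^2 + (1 + M / N) b^2. *)
Lemma normHD u v M N : normH u M -> normH v N -> normH (fun k => u k + v k) (M + N).
Proof.
move=> hu hv.
have [M0 N0] : 0 <= M /\ 0 <= N by case: hu hv => [? _] [].
(* For M = 0 or N = 0 the quotients below make no sense. *)
have Z w P : normH w P -> P = 0 -> forall k, w k = 0.
  by move=> h P0 k; apply: nc_eq0; have := normH_pt k h; rewrite P0.
have [M0'|/eqP M0'] := eqVneq M 0.
  rewrite M0' add0r; apply: normH_le hv => k.
  by rewrite (Z _ _ hu M0') add0r.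
have [N0'|/eqP N0'] := eqVneq N 0.
  rewrite N0' addr0; apply: normH_le hu => k.
  by rewrite (Z _ _ hv N0') addr0.
have Mp : 0 < M by rewrite lt_neqAle M0 andbT eq_sym; apply/eqP.
have Np : 0 < N by rewrite lt_neqAle N0 andbT eq_sym; apply/eqP.
split; first exact: addr_ge0.
case: hu hv => [_ hu] [_ hv].
have -> : (M + N) ^+ 2 = (1 + N / M) * M ^+ 2 + (1 + M / N) * N ^+ 2.
  by field; rewrite !gt_eqF.
apply: sum_leW (sum_leD (sum_leZ _ hu) (sum_leZ _ hv)) => // [k||]; last 2 first.
- by rewrite addr_ge0// divr_ge0.
- by rewrite addr_ge0// divr_ge0.
set a := nc (u k); set b := nc (v k).
apply: (@le_trans _ _ (Kc ^+ 2 * ((a + b) ^+ 2 * wt k))).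
  rewrite ler_wpM2l ?sqr_ge0// ler_wpM2r ?wt_ge0//.
  by rewrite lerXn2r ?nnegrE ?addr_ge0 ?nc_ge0// ncD.
have -> : (1 + N / M) * (Kc ^+ 2 * (a ^+ 2 * wt k)) + (1 + M / N) * (Kc ^+ 2 * (b ^+ 2 * wt k))
  = Kc ^+ 2 * (((1 + N / M) * a ^+ 2 + (1 + M / N) * b ^+ 2) * wt k) by ring.
rewrite ler_wpM2l ?sqr_ge0// ler_wpM2r ?wt_ge0// -subr_ge0.
have -> : (1 + N / M) * a ^+ 2 + (1 + M / N) * b ^+ 2 - (a + b) ^+ 2 =
   (N * a - M * b) ^+ 2 / (M * N) by field; rewrite !gt_eqF.
by rewrite divr_ge0 ?sqr_ge0// mulr_ge0.
Qed.

Lemma normH_conj u M : normH u M -> normH (fun k => conjc (u (- k))) M.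
Proof.
move=> [M0 hu]; split=> //.
apply: sum_leW (sum_le_inj (f := fun k => - k) oppr_inj hu) => // k.
by rewrite nc_conj !wtE !ewE !pwE norm1N.
Qed.

(** The norm is lower semicontinuous under termwise convergence, as only finite partial
    sums enter; limits of bounded sequences therefore stay in the ball. *)
Lemma normH_lim (T : Type) (U : set_system T) (PU : ProperFilter U)
  (a : T -> 'rV[int]_d -> C) u M : 0 <= M ->
  (\forall n \near U, normH (a n) M) ->
  (forall k e, 0 < e -> \forall n \near U, nc (u k - a n k) < e) -> normH u M.
Proof.
move=> M0 hU hA; split=> // F.
have cv k : nc (a n k) @[n --> U] --> nc (u k).
  apply/cvgrPdist_lt => e /(hA k); apply: filterS => n.
  apply: le_lt_trans; rewrite ler_norml; apply/andP; split.
    rewrite lerBrDr addrC lerBlDr. 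
    by rewrite -{1}(subrK (u k) (a n k)) (le_trans (ncD _ _))// addrC nc_distC.
  by rewrite lerBlDr -{1}(subrK (a n k) (u k)) ncD.
have cvS : (\sum_(k <- F) Kc ^+ 2 * (nc (a n k) ^+ 2 * wt k)) @[n --> U] -->
     \sum_(k <- F) Kc ^+ 2 * (nc (u k) ^+ 2 * wt k).
  apply: cvg_big => [|k _]; first exact: add_continuous.
  apply: cvgMr; apply: cvgMl; rewrite expr2.
  by under eq_fun do rewrite expr2; apply: cvgM.
rewrite -(cvg_lim _ cvS)//; apply: limr_le; first by apply/cvg_ex; eexists; exact: cvS.
by apply: filterS hU => n [_]; exact.
Qed.

Lemma normH_sum (I : Type) (r : seq I) (a : I -> 'rV[int]_d -> C) (M : I -> R) :
  (forall i, normH (a i) (M i)) ->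
  normH (fun k => \sum_(i <- r) a i k) (\sum_(i <- r) M i).
Proof.
move=> h; elim: r => [|i r IH].
  rewrite big_nil; split=> // F; rewrite big1// => k _.
  by rewrite big_nil nc0 expr0n mul0r mulr0.
rewrite big_cons; under eq_fun do rewrite big_cons.
exact: normHD.
Qed.

(** By [normH_lim] it suffices to treat the partial convolutions over finite G. For
    these, Cauchy-Schwarz against the weights and [sum_wt_sub] bound the square of
    each coefficient by a sum that, summed over k, factorizes. *)
Lemma normH_conv u v M N w : normH u M -> normH v N ->
  (forall k, has_sum (fun j => u j * v (k - j)) (w k)) -> normH w (M * N).
Proof.
move=> hu hv hw.
apply: (@normH_lim _ (@totally _) (@totally_filter _)
   (fun G k => \sum_(j <- G) u j * v (k - j))).
- by case: hu hv => [? _] [? _]; exact: mulr_ge0.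
- apply: filterE => G; case: hu hv => [M0 hu] [N0 hv].
  split; first exact: mulr_ge0.
  move=> F.
  apply: (@le_trans _ _ (\sum_(k <- F) \sum_(j <- G) (Kc ^+ 2 * (nc (u j) ^+ 2 * wt j)) * (Kc ^+ 2 * (nc (v (k - j)) ^+ 2 * wt (k - j))))).
    apply: ler_sum => k _.
    set P := fun j => nc (u j) * nc (v (k - j)) * Num.sqrt (wt j * wt (k - j)).
    set Q := fun j => (Num.sqrt (wt j * wt (k - j)))^-1.
    have sq j : Num.sqrt (wt j * wt (k - j)) != 0.
      by rewrite sqrtr_eq0 -ltNge mulr_gt0 ?wt_gt0.
    have h1 : nc (\sum_(j <- G) u j * v (k - j)) <= \sum_(j <- G) P j * Q j.
      apply: le_trans (nc_sum _ _ _) _; apply: ler_sum => j _.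
      by rewrite /P /Q ncM mulfK.
    have h2 : nc (\sum_(j <- G) u j * v (k - j)) ^+ 2 <=
        (\sum_(j <- G) P j ^+ 2) * (\sum_(j <- G) Q j ^+ 2).
      apply: le_trans (cauchy_schwarz_sum _ _ _).
      by rewrite lerXn2r ?nnegrE ?nc_ge0// (le_trans (nc_ge0 _) h1).
    have Q2 : wt k * (\sum_(j <- G) Q j ^+ 2) <= Kc.
      apply: le_trans (sum_wt_sub k G); rewrite ler_wpM2l ?wt_ge0//.
      apply: ler_sum => j _; rewrite exprVn sqr_sqrtr ?mulr_ge0 ?wt_ge0//.
      by rewrite invfM.
    have P0 : 0 <= \sum_(j <- G) P j ^+ 2 by apply: sumr_ge0 => j _; exact: sqr_ge0.
    apply: (@le_trans _ _ (Kc ^+ 2 * (\sum_(j <- G) P j ^+ 2) * Kc)).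
      rewrite -mulrA ler_wpM2l ?sqr_ge0//.
      apply: le_trans (ler_wpM2r (wt_ge0 k) h2) _.
      by rewrite -mulrA ler_wpM2l// mulrC.
    apply: (@le_trans _ _ (Kc ^+ 4 * (\sum_(j <- G) P j ^+ 2))).
      rewrite mulrAC ler_wpM2r// -exprSr ler_weXn2l ?Kc_ge1//.
    rewrite mulr_sumr; apply: ler_sum => j _.
    rewrite /P exprMn sqr_sqrtr ?mulr_ge0 ?wt_ge0//.
    rewrite le_eqVlt; apply/orP; left; apply/eqP; ring.
  rewrite exchange_big /=.
  apply: (@le_trans _ _ (\sum_(j <- G) (Kc ^+ 2 * (nc (u j) ^+ 2 * wt j)) * N ^+ 2)).
    apply: ler_sum => j _; rewrite -mulr_sumr ler_wpM2l ?normH_term_ge0//.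
    apply: (sum_le_inj (f := fun k => k - j)) hv F.
    by move=> x y /addIr.
  by rewrite -mulr_suml exprMn ler_wpM2r ?sqr_ge0.
- move=> k e e0; have /has_sumP /(_ e e0)[F0 h0] := hw k.
  by exists F0.
Qed.

(** Real functions on the real torus with an absolutely convergent Fourier series in the
    weighted space. The bound M takes the place of the norm, so that no infimum over
    the representing families is needed. *)
Definition inH (phi : 'rV[R]_d -> R) (M : R) := exists2 u, normH u M &
  forall x, has_sum (fun k => u k * character k (toC x)) (phi x)%:C.

Lemma inH_ge0 phi M : inH phi M -> 0 <= M. Proof. by case=> u []. Qed.

Lemma inHW phi M N : M <= N -> inH phi M -> inH phi N.
Proof. by move=> h [u hu hs]; exists u => //; exact: normHW h hu. Qed.

Lemma inH_eq phi psi M : phi =1 psi -> inH phi M -> inH psi M.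
Proof. by move/funext ->. Qed.

Lemma abs_char u M x : abs_le u M -> abs_le (fun k => u k * character k (toC x)) M.
Proof. by apply: sum_leW => // k; rewrite ncM nc_character_real mulr1. Qed.

Lemma inH_sup phi M x : inH phi M -> `|phi x| <= M.
Proof.
move=> [u /normH_abs hu hs]; rewrite -ncR.
exact: abs_le_nc (abs_char x hu) (hs x).
Qed.

Lemma inHD phi psi M N : inH phi M -> inH psi N -> inH (fun x => phi x + psi x) (M + N).
Proof.
move=> [u hu hs] [v hv ht]; exists (fun k => u k + v k); first exact: normHD.
move=> x; rewrite realCD; apply: has_sum_eq (has_sumD (hs x) (ht x)) => k.
by rewrite mulrDl.
Qed.

Lemma inHZ phi M c : inH phi M -> inH (fun x => c * phi x) (`|c| * M).
Proof.
move=> [u hu hs]; exists (fun k => c%:C * u k); first by rewrite -ncR; exact: normHZ.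
move=> x; rewrite realCM; apply: has_sum_eq (has_sumZ _ (hs x)) => k.
by rewrite mulrA.
Qed.

Lemma inHN phi M : inH phi M -> inH (fun x => - phi x) M.
Proof.
move=> /(inHZ (-1)); rewrite normrN1 mul1r; apply: inH_eq => x.
by rewrite mulN1r.
Qed.

Lemma inHB phi psi M N : inH phi M -> inH psi N -> inH (fun x => phi x - psi x) (M + N).
Proof. by move=> h1 h2; exact: (inHD h1 (inHN h2)). Qed.

Lemma inH_cst c : inH (fun=> c) (Kc * `|c|).
Proof.
have supp (f : 'rV[int]_d -> C) : has_sum (fun k => (if k == 0 then c%:C else 0) * f k) (c%:C * f 0).
  have := @has_sum_supp R _ (fun k => (if k == 0 then c%:C else 0) * f k) [fset 0]%fset.
  rewrite big_seq_fset1 eqxx; apply=> k; rewrite inE => /negbTE ->.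
  by rewrite mul0r.
exists (fun k => if k == 0 then c%:C else 0); last first.
  by move=> x; have := supp (fun k => character k (toC x)); rewrite character0 mulr1.
split; first by rewrite mulr_ge0 ?Kc_ge0.
move=> F; have [F0|F0] := boolP (0 \in F).
  rewrite (big_fsetD1 0)//= eqxx big1_fset ?addr0; last first.
    by move=> k; rewrite !inE => /andP[/negbTE -> _] _; rewrite nc0 expr0n mul0r mulr0.
  rewrite ncR exprMn ler_wpM2l ?sqr_ge0//.
  by rewrite !wtE !ewE !pwE norm1_0 mulr0 expR0 expr0n add0r !expr1n !mulr1.
rewrite big1_fset ?sqr_ge0// => k kF _.
case: eqP => [k0|_]; last by rewrite nc0 expr0n mul0r mulr0.
by rewrite -k0 kF in F0.
Qed.

(** The coefficients of the product are the convolution of the coefficients. *)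
Lemma inHM phi psi M N : inH phi M -> inH psi N -> inH (fun x => phi x * psi x) (M * N).
Proof.
move=> [u hu hs] [v hv ht].
have au := normH_abs hu; have av := normH_abs hv.
have auv : abs_le (fun p => u p.2 * v (p.1 - p.2)) (M * N).
  apply: (sum_le_inj (f := fun p => (p.2, p.1 - p.2))) (abs_le_mul au av).
  by move=> [a b] [a' b'] /= [-> /addIr ->].
have ex k : exists s, has_sum (fun j => u j * v (k - j)) s.
  by apply: (@abs_le_has_sum _ _ _ (M * N)); have := sum_le_section k auv.
have [w hw] := choice ex.
exists w => [|x]; first exact: normH_conv hu hv hw.
have := has_sum_mul (abs_char x au) (abs_char x av) (hs x) (ht x).
move/(has_sum_bij (f := fun p => (p.2, p.1 - p.2)) (g := fun p => (p.1 + p.2, p.1))).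
rewrite -realCM => h; apply: has_sum_sigma (h _ _) _ => [[a b]|[a b]|k] /=.
- by rewrite subrKC.
- by rewrite addrAC subrr add0r.
- rewrite mulrC; apply: has_sum_eq (has_sumZ (character k (toC x)) (hw k)) => j.
  rewrite -{1}(subrKC j k) characterD; ring.
Qed.

(** The real part has the coefficients (u_k + conj u_(-k)) / 2, of norm at most that
    of u, since the weight is even. *)
Lemma inH_Re (z : 'rV[R]_d -> C) u M : normH u M ->
  (forall x, has_sum (fun k => u k * character k (toC x)) (z x)) ->
  inH (fun x => Re (z x)) M.
Proof.
move=> hu hs; exists (fun k => (2^-1)%:C * (u k + conjc (u (- k)))).
  have := normHZ (2^-1)%:C (normHD hu (normH_conj hu)).
  by rewrite ncR_ge0 ?invr_ge0// (_ : 2^-1 * (M + M) = M)//; field.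
move=> x; have h := has_sum_bij opprK opprK (has_sum_conj (hs x)).
have -> : (Re (z x))%:C = (2^-1)%:C * (z x + conjc (z x)).
  by apply: complex_ext; rewrite ?ReMl; case: (z x) => a b /=; field.
apply: has_sum_eq (has_sumZ (2^-1)%:C (has_sumD (hs x) h)) => k /=.
rewrite (_ : conjc (u (- k) * character (- k) (toC x)) = conjc (u (- k)) * character k (toC x)).
  ring.
have -> : character k (toC x) = conjc (character (- k) (toC x)) by rewrite character_conj opprK.
by case: (u _) (character _ _) => ? ? [? ?]; apply: complex_ext => /=; ring.
Qed.

(** For an absolutely summable sequence the unconditional sum is the limit of the partial
    sums, so a geometric estimate of the remainders identifies it. *)
Lemma has_sum_nat (u : nat -> C) s M B : abs_le u M ->
  (forall N, nc (s - \sum_(n < N) u n) <= B * (1 / 2) ^+ N) -> has_sum u s.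
Proof.
move=> hu hB; have [t ht] := abs_le_has_sum hu.
suff -> : s = t by [].
apply/eqP; rewrite -subr_eq0; apply/eqP; apply: nc_eq0.
apply/ler_addgt0Pl => e e0; rewrite addr0.
have e2 : 0 < e / 2 by rewrite divr_gt0.
have /has_sumP /(_ _ e2)[F0 h0] := ht.
have cB : B * (1 / 2) ^+ N @[N --> \oo] --> 0.
  rewrite -(mulr0 B); apply: cvgMr; apply: cvg_expr.
  by rewrite ger0_norm; lra.
have /cvgrPdist_lt /(_ _ e2) [N0 _ hN0] := cB.
pose N := maxn N0 (\max_(n <- F0) n.+1).
have := hN0 N (leq_maxl _ _); rewrite /= sub0r normrN => hN.
have hF : (F0 `<=` [fset nat_of_ord i | i in 'I_N])%fset.
  apply/fsubsetP => n nF; apply/imfsetP => /=.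
  have nN : (n < N)%N.
    by rewrite /N leq_max; apply/orP; right; rewrite (big_fsetD1 n)//= leq_maxl.
  by exists (Ordinal nN).
have := h0 _ hF; rewrite big_imfset /=; last by move=> p q _ _; exact: val_inj.
rewrite big_enum /= => h1; have h2 := hB N.
have -> : s - t = (s - \sum_(n < N) u n) - (t - \sum_(n < N) u n) by ring.
apply: le_trans (ncB _ _) _.
by have := ler_norm (B * (1 / 2) ^+ N); lra.
Qed.

(** Completeness, in the form in which it is used: power series of functions in the
    algebra. The coefficients are summed for each k, the norm passes to the limit by
    [normH_lim], and pointwise values follow by exchanging the two summations. *)
Lemma inH_geo (phi : nat -> 'rV[R]_d -> R) (psi : 'rV[R]_d -> R) B B' :
  (forall n, inH (phi n) (B * (1 / 2) ^+ n)) ->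
  (forall x N, `|psi x - \sum_(n < N) phi n x| <= B' * (1 / 2) ^+ N) ->
  inH psi (2 * B).
Proof.
move=> hphi hpsi.
have exu n : exists v, normH v (B * (1 / 2) ^+ n) /\
    forall x, has_sum (fun k => v k * character k (toC x)) (phi n x)%:C.
  by have [v h1 h2] := hphi n; exists v.
have [u hu] := choice exu.
have B0 : 0 <= B by have := inH_ge0 (hphi 0%N); rewrite expr0 mulr1.
have half : 0 <= (1 / 2 : R) <= (1 / 2 : R) by lra.
have sumB : sum_le (fun n : nat => B * (1 / 2) ^+ n) (2 * B).
  by rewrite [2 * B]mulrC; apply: sum_leZ => //; exact: sum_le_geo.
have ex k : exists s, has_sum (fun n => u n k) s.
  apply: (@abs_le_has_sum _ _ _ (2 * B)); apply: sum_leW sumB => // n.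
  by apply: normH_pt; case: (hu n).
have [w hw] := choice ex.
exists w => [|x].
  apply: (@normH_lim _ (@totally _) (@totally_filter _)
     (fun (G : {fset nat}) k => \sum_(n <- G) u n k)).
  - by rewrite mulr_ge0.
  - apply: filterE => G.
    apply: normHW (sumB G) _; apply: normH_sum => n; by case: (hu n).
  - move=> k e e0; have /has_sumP /(_ e e0)[F0 h0] := hw k.
    by exists F0.
have aup : abs_le (fun p : nat * 'rV[int]_d => u p.1 p.2 * character p.2 (toC x)) (2 * B).
  apply: (sum_le_pair _ _ sumB) => [p|n]; first exact: nc_ge0.
  by apply: abs_char; apply: normH_abs; case: (hu n).
have [S hS] := abs_le_has_sum aup.
have h1 := has_sum_sigma hS (fun n => (hu n).2 x).
have h2 : has_sum (fun n => (phi n x)%:C) (psi x)%:C.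
  apply: (@has_sum_nat _ _ (2 * B) B').
    exact: abs_le_sigma aup (fun n => (hu n).2 x).
  by move=> N; rewrite -rmorph_sum -rmorphB ncR.
rewrite (has_sum_unique h2 h1).
apply: (has_sum_sigma (has_sum_swap hS)) => k /=.
rewrite mulrC; apply: has_sum_eq (has_sumZ (character k (toC x)) (hw k)) => n.
by rewrite mulrC.
Qed.

End Space.

(** * Term-by-term differentiation of trigonometric series *)
Section Calculus.
Variable R : realType.
Local Notation C := R[i].
Local Notation Re := (@complex.Re R).
Local Notation Im := (@complex.Im R).
Local Notation nc := (@Normc.normc R).

(** The Taylor bounds of the exponential produce derivatives in this form, which passes
    through absolutely convergent sums without uniform convergence of derivatives. *)
Lemma is_derive_quad (f : R -> R) (t D B : R) :
  (forall s, `|f (t + s) - f t - s * D| <= B * s ^+ 2) -> is_derive t 1 f D.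
Proof.
move=> hB.
have cv : h^-1 *: ((f \o shift t) (h *: (1 : R)) - f t) @[h --> 0^'] --> D.
  have B0 : 0 <= B by have := hB 1; rewrite expr1n mulr1; apply: le_trans.
  apply/cvgrPdist_lt => e e0; near=> h.
  have h0 : h != 0 by near: h; exact: nbhs_dnbhs_neq.
  have hs : `|h| < e / (B + 1).
    near: h; apply: dnbhs0_lt; rewrite divr_gt0//; lra.
  have := hB h; rewrite /= [t + h]addrC => hh.
  rewrite -[_ *: 1]/(h * 1) mulr1 -normrN opprB.
  have -> : h^-1 *: (f (h + t) - f t) - D = h^-1 * (f (h + t) - f t - h * D).
    by rewrite -[_ *: _]/(h^-1 * _); field.
  rewrite normrM normfV.
  apply: (@le_lt_trans _ _ (`|h|^-1 * (B * h ^+ 2))).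
    by rewrite ler_wpM2l// invr_ge0.
  rewrite -[h ^+ 2]real_normK ?num_real//.
  have h1 : 0 < `|h| by rewrite normr_gt0.
  have -> : `|h|^-1 * (B * `|h| ^+ 2) = B * `|h| by field; rewrite gt_eqF.
  move: hs; rewrite ltr_pdivlMr; last by lra.
  by nra.
split; first by apply/cvg_ex; exists D.
exact: cvg_lim cv.
Unshelve. all: by end_near. Qed.

Lemma mvt_at0 (f df : R -> R) (x : R) : (forall y : R, is_derive y 1 f (df y)) ->
  continuous f -> exists2 c, `|c| <= `|x| & f x - f 0 = df c * x.
Proof.
move=> hf cf.
have cw (a b : R) : {within `[a, b], continuous f} by apply: continuous_subspaceT.
have [x0|/ltW x0] := leP 0 x.
  have [c + h] := MVT_segment x0 (fun y _ => hf y) (cw _ _).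
  rewrite in_itv/= => /andP[c0 cx]; exists c; first by rewrite !ger0_norm.
  by rewrite h subr0.
have [c + h] := MVT_segment x0 (fun y _ => hf y) (cw _ _).
rewrite in_itv/= => /andP[cx c0]; exists c; first by rewrite !ler0_norm// lerN2.
by rewrite -opprB h; ring.
Qed.

Lemma sin_le (x : R) : `|sin x| <= `|x|.
Proof.
have [c _] := @mvt_at0 sin cos x (@is_derive_sin R) (@continuous_sin R).
rewrite sin0 subr0 => ->; rewrite normrM ler_piMl// cos_max//.
Qed.

Lemma cos_sub1E (x : R) : 1 - cos x = 2 * sin (x / 2) ^+ 2.
Proof.
have -> : cos x = cos (x / 2 + x / 2) by congr cos; field.
rewrite cosD -!expr2.
have := cos2Dsin2 (x / 2).
by move: (cos _ ^+ 2) (sin _ ^+ 2) => a b; lra.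
Qed.

Lemma cos_quad (x : R) : `|cos x - 1| <= x ^+ 2 / 2.
Proof.
rewrite distrC cos_sub1E ger0_norm; last by rewrite mulr_ge0// sqr_ge0.
have := sin_le (x / 2); rewrite -ler_sqr ?nnegrE// !real_normK ?num_real//.
by rewrite expr_div_n; lra.
Qed.

Lemma cos_lip (x : R) : `|cos x - 1| <= `|x|.
Proof.
rewrite distrC cos_sub1E ger0_norm; last by rewrite mulr_ge0// sqr_ge0.
rewrite -real_normK ?num_real//.
have := sin_le (x / 2); have := sin_max (x / 2); rewrite normrM [X in _ <= _ * X -> _]gtr0_norm//.
have := normr_ge0 (sin (x / 2)); have := normr_ge0 x.
by nra.
Qed.

Lemma sin_quad (x : R) : `|sin x - x| <= x ^+ 2.
Proof.
have ct : continuous (sin - id : R -> R).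
  by move=> y; apply: cvgB; [exact: continuous_sin | exact: cvg_id].
have [c cx] := @mvt_at0 (sin - id) (fun y => cos y - 1) x
   (fun y => is_deriveB (is_derive_sin y) (is_derive_id y 1)) ct.
rewrite -[(sin - id) x]/(sin x - x) -[(sin - id) 0]/(sin 0 - 0) sin0 !subr0 => ->.
rewrite normrM -[x ^+ 2]real_normK ?num_real// expr2 ler_wpM2r//.
by apply: le_trans cx; exact: cos_lip.
Qed.

Lemma expCi (x : R) : expC ('i%C * x%:C) = cos x +i* sin x.
Proof.
have e : 'i%C * x%:C = 0 +i* x by apply: complex_ext => /=; ring.
by rewrite e /expC /= expR0 mul1r.
Qed.

Lemma nc_expCi (x : R) : nc (expC ('i%C * x%:C)) = 1.
Proof. by rewrite expCi /= cos2Dsin2 sqrtr1. Qed.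

Lemma expCi_quad (x : R) : nc (expC ('i%C * x%:C) - 1 - 'i%C * x%:C) <= 2 * x ^+ 2.
Proof.
apply: le_trans (nc_le_ReIm _) _.
have h0 : 0 * x = 0 by ring.
rewrite /expC /= !(mul0r, mulr0, mul1r, subr0, add0r, expR0, addr0, mulr1).
rewrite oppr0 subr0 expR0 !mul1r.
have := cos_quad x; have := sin_quad x; have := sqr_ge0 x; lra.
Qed.

(** The second-order Taylor bound of each exponential is at most 2 nu_k^2 s^2, and is
    summable by assumption. *)
Lemma trig_derive (I : choiceType) (nu : I -> R) u B (z z' : R -> C) :
  sum_le (fun k => nc (u k) * (1 + nu k ^+ 2)) B ->
  (forall t, has_sum (fun k => u k * expC ('i%C * (t * nu k)%:C)) (z t)) ->
  (forall t, has_sum (fun k => 'i%C * (nu k)%:C * u k * expC ('i%C * (t * nu k)%:C)) (z' t)) ->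
  forall t : R, is_derive t 1 (fun t => Re (z t)) (Re (z' t)).
Proof.
move=> hB hz hz' t; apply: (@is_derive_quad _ _ _ (2 * B)) => s.
have h := has_sumB (has_sumB (hz (t + s)) (hz t)) (has_sumZ s%:C (hz' t)).
have -> : Re (z (t + s)) - Re (z t) - s * Re (z' t) =
   Re (z (t + s) - z t - s%:C * z' t) by rewrite !ReB ReMl.
apply: le_trans (Re_le_nc _) _; apply: abs_le_nc h.
have s0 : 0 <= 2 * s ^+ 2 by rewrite mulr_ge0// sqr_ge0.
have -> : 2 * B * s ^+ 2 = (2 * s ^+ 2) * B by ring.
apply: sum_leW (sum_leZ s0 hB) => // k.
have -> : expC ('i%C * ((t + s) * nu k)%:C) =
    expC ('i%C * (t * nu k)%:C) * expC ('i%C * (s * nu k)%:C) :> C.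
  by rewrite -expCD -mulrDr -realCD -mulrDl.
have -> : u k * (expC ('i%C * (t * nu k)%:C) * expC ('i%C * (s * nu k)%:C)) -
    u k * expC ('i%C * (t * nu k)%:C) -
    s%:C * ('i%C * (nu k)%:C * u k * expC ('i%C * (t * nu k)%:C)) =
  u k * (expC ('i%C * (t * nu k)%:C) * (expC ('i%C * (s * nu k)%:C) - 1 -
     'i%C * (s * nu k)%:C)) by rewrite realCM; ring.
rewrite ncM [nc (expC _ * _)]ncM nc_expCi mul1r [leRHS]mulrCA.
rewrite ler_wpM2l ?nc_ge0//; apply: le_trans (expCi_quad _) _.
by rewrite exprMn mulrDr mulr1 [leLHS]mulrA lerDr.
Qed.

End Calculus.

(** * The linear equation along the flow *)
Section Linear.
Variable R : realType.
Variables (d m : nat) (rho : R).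
Hypothesis hm : (d < m)%N.
Hypothesis hrho : 0 < rho.
Local Notation C := R[i].
Local Notation Re := (@complex.Re R).
Local Notation Im := (@complex.Im R).
Local Notation nc := (@Normc.normc R).
Local Notation inH := (@inH R d m rho).
Local Notation normH := (@normH R d m rho).
Variable omega : 'rV[R]_d.

Definition freq (k : 'rV[int]_d) : R := \sum_(j < d) (k 0 j)%:~R * omega 0 j.

Lemma character_flow k t :
  character k (toC (t *: omega)) = expC ('i%C * (t * freq k)%:C).
Proof.
rewrite characterE dot_toC; congr (expC (_ * _%:C)); rewrite mulr_sumr.
by apply: eq_bigr => j _; rewrite mxE mulrCA.
Qed.

(** Exponential weights dominate every power of |k|; here expR (y / 2) >= y / 2 is
    squared. *)
Lemma ew_norm1 : exists2 B : R, 0 <= B & forall k : 'rV[int]_d, (norm1 k)%:R ^+ 2 <= B * ew rho k.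
Proof.
exists ((2 / rho) ^+ 2) => [|k]; first by rewrite sqr_ge0.
have -> : (norm1 k)%:R ^+ 2 = (2 / rho) ^+ 2 * (rho * (norm1 k)%:R / 2) ^+ 2.
  by field; rewrite gt_eqF.
rewrite ewE ler_wpM2l ?sqr_ge0//.
set y := rho * (norm1 k)%:R; have y0 : 0 <= y by rewrite mulr_ge0// ltW.
have -> : expR y = expR (y / 2) ^+ 2.
  by rewrite -expRM_natl; congr expR; rewrite mulrCA divff ?mulr1.
rewrite lerXn2r ?nnegrE ?expR_ge0 ?divr_ge0//.
by apply: le_trans (expR_ge1Dx _); rewrite lerDr.
Qed.

Lemma freq_quad : exists2 B : R, 0 <= B & forall k, freq k ^+ 2 <= B * ew rho k.
Proof.
have [B B0 hB] := ew_norm1; pose W := \sum_(j < d) `|omega 0 j|.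
exists (W ^+ 2 * B) => [|k]; first by rewrite mulr_ge0 ?sqr_ge0.
have h1 : `|freq k| <= (norm1 k)%:R * W.
  apply: le_trans (ler_norm_sum _ _ _) _; rewrite mulr_sumr; apply: ler_sum => j _.
  by rewrite normrM ler_wpM2r// -intr_norm -natr_absz ler_nat norm1_ge.
rewrite -[freq k ^+ 2]real_normK ?num_real//.
apply: (@le_trans _ _ (((norm1 k)%:R * W) ^+ 2)).
  by rewrite lerXn2r ?nnegrE// mulr_ge0// sumr_ge0.
by rewrite exprMn [leLHS]mulrC -[leRHS]mulrA ler_wpM2l ?sqr_ge0.
Qed.

(** What makes the series of elements of the space differentiable along the flow. *)
Lemma normH_freq u M : normH u M -> exists B,
  sum_le (fun k => nc (u k) * (1 + freq k ^+ 2)) B.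
Proof.
move=> hu; have [B B0 hB] := freq_quad; exists (B * M + M).
apply: sum_leW (sum_leD (sum_leZ B0 (normH_emb hm hrho hu)) (normH_abs hm hrho hu)) => // k.
rewrite mulrDr mulr1 [leLHS]addrC lerD2r [leRHS]mulrCA ler_wpM2l ?nc_ge0//.
Qed.

Lemma abs_freq u B : sum_le (fun k => nc (u k) * (1 + freq k ^+ 2)) B ->
  abs_le (fun k => 'i%C * (freq k)%:C * u k) B.
Proof.
apply: sum_leW => // k; rewrite !ncM nci mul1r ncR mulrC ler_wpM2l ?nc_ge0//.
have := sqr_ge0 (`|freq k| - 1); rewrite sqrrB real_normK ?num_real//.
by rewrite mulr1 expr1n; have := normr_ge0 (freq k); lra.
Qed.

Lemma flow_derive u B (z z' : R -> C) :
  sum_le (fun k => nc (u k) * (1 + freq k ^+ 2)) B ->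
  (forall t, has_sum (fun k => u k * character k (toC (t *: omega))) (z t)) ->
  (forall t, has_sum (fun k => 'i%C * (freq k)%:C * u k * character k (toC (t *: omega))) (z' t)) ->
  forall t : R, is_derive t 1 (fun t => Re (z t)) (Re (z' t)).
Proof.
move=> hB hz hz'; apply: (trig_derive hB) => t.
  by apply: has_sum_eq (hz t) => k; rewrite character_flow.
by apply: has_sum_eq (hz' t) => k; rewrite character_flow.
Qed.

Hypothesis homega : forall k : 'rV[int]_d, k != 0 -> freq k != 0.

Lemma freqB k j : freq (k - j) = freq k - freq j.
Proof.
by rewrite -sumrB; apply: eq_bigr => i _; rewrite !mxE rmorphB mulrBl.
Qed.

(** Multiply by exp(-i t k0.omega). Averaging the series at t and t + pi / mu_1
    annihilates the frequency mu_1 and does not increase any coefficient, while it fixes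
    the coefficient of frequency 0. After annihilating a finite set that carries all but
    e of the sum of the |a k|, the value 0 of the series at t = 0 shows |a k0| <= e. *)
Lemma almost_periodic_unique a M : abs_le a M ->
  (forall t, has_sum (fun k => a k * character k (toC (t *: omega))) 0) ->
  forall k, a k = 0.
Proof.
move=> ha hs k0.
pose mu k := freq k - freq k0.
have hs0 t : has_sum (fun k => a k * expC ('i%C * (t * mu k)%:C)) 0.
  have := has_sumZ (expC (- ('i%C * (t * freq k0)%:C))) (hs t).
  rewrite mulr0; apply: has_sum_eq => k.
  rewrite character_flow mulrCA -expCD; congr (_ * expC _).
  by rewrite /mu mulrBr rmorphB; ring.
(* The coefficients of index in s are annihilated one after the other. *)
have kill (s : seq 'rV[int]_d) : k0 \notin s -> exists b : 'rV[int]_d -> C,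
   [/\ forall k, nc (b k) <= nc (a k), b k0 = a k0, forall k, k \in s -> b k = 0 &
     forall t, has_sum (fun k => b k * expC ('i%C * (t * mu k)%:C)) 0].
  elim: s => [|k1 s IH]; first by move=> _; exists a; split.
  rewrite inE negb_or => /andP[k01 /IH [b [b1 b2 b3 b4]]].
  have mu1 : mu k1 != 0.
    by rewrite /mu -freqB homega// subr_eq0 eq_sym.
  pose c k : C := (1 + expC ('i%C * (pi / mu k1 * mu k)%:C)) / 2.
  exists (fun k => b k * c k); split=> [k||k|t].
  - apply: le_trans (b1 k); rewrite ncM ler_piMr ?nc_ge0//.
    rewrite /c ncM ncV.
    have -> : nc 2 = 2 :> R by rewrite (_ : 2 = 2%:C :> C) ?ncR_ge0// rmorph_nat.
    rewrite ler_pdivrMr// mul1r (le_trans (ncD _ _))// nc1 nc_expCi; lra.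
  - by rewrite /= /c b2 /mu subrr !mulr0 expC0 (_ : 1 + 1 = 2)// divff ?mulr1// pnatr_eq0.
  - rewrite inE => /orP[/eqP ->|/b3 ->]; last by rewrite mul0r.
    rewrite /c divfK// (_ : expC _ = -1) ?subrr ?mul0r ?mulr0//.
    by rewrite expCi cospi sinpi; apply: complex_ext => /=; ring.
  - have := has_sumZ 2^-1 (has_sumD (b4 t) (b4 (t + pi / mu k1))).
    rewrite addr0 mulr0; apply: has_sum_eq => k.
    have -> : expC ('i%C * ((t + pi / mu k1) * mu k)%:C) =
       expC ('i%C * (t * mu k)%:C) * expC ('i%C * (pi / mu k1 * mu k)%:C) :> C.
      by rewrite -expCD -mulrDr -realCD -mulrDl.
    by rewrite /c; ring.
apply: nc_eq0; apply/ler_addgt0Pl => e e0; rewrite addr0.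
have [F0 h0] := sum_le_tail (fun k => nc_ge0 (a k)) ha e0.
have [|b [b1 b2 b3 b4]] := kill (F0 `\ k0)%fset; first by rewrite !inE eqxx.
have hb := b4 0; have /has_sumP hP := hb.
apply/ler_addgt0Pl => e1 e10; have [F1 h1] := hP _ e10.
have := h1 _ (fsubsetUr [fset k0]%fset F1).
have -> : ([fset k0] `|` F1 = k0 |` (F1 `\ k0))%fset.
  by apply/fsetP => k; rewrite !inE; case: eqP.
rewrite big_fsetU1 ?inE ?eqxx//= {1}/mu subrr mulr0 mulr0 expC0 mulr1 b2.
set T := \sum_(i <- _) _ => h2.
have hT : nc T <= e.
  apply: le_trans (nc_sum _ _ _) _.
  under eq_bigr do rewrite ncM nc_expCi mulr1.
  rewrite (big_fsetID _ (mem F0))/= big1_fset ?add0r; last first.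
    move=> k; rewrite !inE => /andP[/andP[kk0 _] kF] _.
    by rewrite b3 ?nc0// !inE kk0.
  apply: le_trans (ltW (h0 [fset x in (F1 `\ k0)%fset | x \notin F0]%fset _)).
    by apply: ler_sum.
  by apply/fdisjointP => k; rewrite !inE => /andP[].
rewrite (_ : a k0 = - (0 - (a k0 + T)) - T); last by ring.
by apply: le_trans (ncB _ _) _; rewrite ncN; lra.
Qed.

Variable lam : R.
Hypothesis lam0 : lam != 0.

(** The absence of small divisors: the distance from the real number lam to the imaginary
    axis is |lam|. *)
Lemma symbol_ge k : `|lam| <= nc ('i%C * (freq k)%:C - lam%:C).
Proof.
apply: le_trans (Re_le_nc _); rewrite /= !mul0r mulr0 subrr sub0r normrN//.
Qed.

Lemma symbol_neq0 k : 'i%C * (freq k)%:C - lam%:C != 0 :> C.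
Proof.
apply/eqP => h; have := symbol_ge k; rewrite h nc0 normr_le0.
by rewrite (negbTE lam0).
Qed.

Lemma normH_symbol u p M : (forall k, ('i%C * (freq k)%:C - lam%:C) * u k = p k) ->
  normH p M -> normH u (M / `|lam|).
Proof.
move=> hup hp.
have l0 : 0 < `|lam| by rewrite normr_gt0.
have := normHZ (`|lam|^-1)%:C hp.
rewrite ncR_ge0 ?invr_ge0 // mulrC; apply: (normH_le hrho) => k.
rewrite -hup !ncM ncR_ge0 ?invr_ge0// mulrA ler_peMl ?nc_ge0//.
by rewrite mulrC ler_pdivlMr// mul1r symbol_ge.
Qed.

Lemma linear_solve psi M : inH psi M -> exists2 phi, inH phi (M / `|lam|) &
  forall t : R, is_derive t 1 (fun t => phi (t *: omega))
      (lam * phi (t *: omega) + psi (t *: omega)).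
Proof.
move=> [p hp hs].
pose u k := p k / ('i%C * (freq k)%:C - lam%:C).
have hup k : ('i%C * (freq k)%:C - lam%:C) * u k = p k.
  by rewrite /u mulrC divfK// symbol_neq0.
have hu := normH_symbol hup hp.
have ex x : exists s, has_sum (fun k => u k * character k (toC x)) s.
  by apply: abs_le_has_sum; apply: abs_char; exact: (normH_abs hm hrho hu).
have [z hz] := choice ex.
exists (fun x => Re (z x)); first by have := inH_Re hm hrho hu hz; exact.
move=> t; have [B hB] := normH_freq hu.
pose z' t := lam%:C * z (t *: omega) + (psi (t *: omega))%:C.
have -> : lam * Re (z (t *: omega)) + psi (t *: omega) = Re (z' t).
  by rewrite /z' ReD ReMl.
apply: (flow_derive hB) => // {}t.
apply: has_sum_eq (has_sumD (has_sumZ lam%:C (hz (t *: omega))) (hs (t *: omega))) => k.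
by rewrite -hup; ring.
Qed.

(** A solution of the linear equation satisfies the coefficient equations, by
    [almost_periodic_unique], so every solution in the space is bounded by the right-hand
    side, whatever bound M was known before. *)
Lemma linear_bound phi psi M N : inH phi M -> inH psi N ->
  (forall t : R, is_derive t 1 (fun t => phi (t *: omega))
      (lam * phi (t *: omega) + psi (t *: omega))) ->
  inH phi (N / `|lam|).
Proof.
move=> [u hu hs] [p hp ht] hd; exists u => //.
apply: (normH_symbol _ hp) => k.
have [B hB] := normH_freq hu.
have ex t : exists s, has_sum (fun k => 'i%C * (freq k)%:C * u k * character k (toC (t *: omega))) s.
  by apply: abs_le_has_sum; apply: abs_char; exact: (abs_freq hB).
have [z' hz'] := choice ex.
have d1 t := flow_derive hB (fun t => hs (t *: omega)) hz' t.
have hBi : sum_le (fun k => nc (- 'i%C * u k) * (1 + freq k ^+ 2)) B.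
  by apply: sum_leW hB => // j; rewrite ncM ncN nci mul1r.
have d2 (t : R) : is_derive t 1 (fun t => Re (- 'i%C * (phi (t *: omega))%:C)) (Re (- 'i%C * z' t)).
  apply: (flow_derive hBi (z := fun t => - 'i%C * (phi (t *: omega))%:C)
     (z' := fun t => - 'i%C * z' t)) => {}t.
    by apply: has_sum_eq (has_sumZ (- 'i%C) (hs (t *: omega))) => j; ring.
  by apply: has_sum_eq (has_sumZ (- 'i%C) (hz' t)) => j; ring.
have e t : z' t = (lam * phi (t *: omega) + psi (t *: omega))%:C.
  apply: complex_ext => /=.
    have /@derive_val <- := hd t; have /@derive_val <- := d1 t.
    by [].
  have /@derive_val := d2 t.
  have -> : (fun t => Re (- 'i%C * (phi (t *: omega))%:C)) = cst 0.
    by apply/funext => s /=; ring.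
  rewrite derive_cst; case: (z' t) => x y /= ->; ring.
have key : forall k, 'i%C * (freq k)%:C * u k - (lam%:C * u k + p k) = 0.
  have [] : exists M', abs_le (fun k => 'i%C * (freq k)%:C * u k - (lam%:C * u k + p k)) M'.
    exists (B + (nc (lam%:C) * M + N)).
    apply: sum_leW (sum_leD (abs_freq hB) (sum_leD (sum_leZ (nc_ge0 lam%:C) (normH_abs hm hrho hu)) (normH_abs hm hrho hp))) => // j.
    by apply: le_trans (ncB _ _) _; rewrite lerD2l (le_trans (ncD _ _))// ncM.
  move=> M' hM'; apply: almost_periodic_unique hM' _ => t.
  have := has_sumB (hz' t) (has_sumD (has_sumZ lam%:C (hs (t *: omega))) (ht (t *: omega))).
  rewrite e realCD realCM subrr; apply: has_sum_eq => j; ring.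
by have := key k => /eqP; rewrite subr_eq0 => /eqP h; rewrite mulrBl h; ring.
Qed.

End Linear.

(** * Fourier coefficients of trigonometric series *)
Section Fourier.
Variable R : realType.
Local Notation C := R[i].
Local Notation Re := (@complex.Re R).
Local Notation Im := (@complex.Im R).
Local Notation nc := (@Normc.normc R).

Lemma expC_2pi (k : int) : expC ('i%C * (2 * pi * k%:~R)%:C) = 1 :> C.
Proof.
have hn (n : nat) : expC ('i%C * (2 * pi * n%:R)%:C) = 1 :> C.
  elim: n => [|n IH]; first by rewrite !mulr0 expC0.
  rewrite -[n.+1%:R]natr1 mulrDr realCD mulrDr expCD IH mul1r mulr1 expCi.
  by rewrite mulr_natl cos2pi sin2pi.
case: k => n; first exact: hn.
rewrite NegzE rmorphN mulrN rmorphN mulrN.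
have hN (z : C) : expC z = 1 -> expC (- z) = 1.
  by move=> h; have := expCD (- z) z; rewrite addNr expC0 h mulr1 => <-.
by apply: hN; exact: hn.
Qed.

Lemma continuous_of_is_derive (f df : R -> R) : (forall t : R, is_derive t 1 f (df t)) -> continuous f.
Proof.
move=> h t; apply: differentiable_continuous; apply/derivable1_diffP.
by case: (h t).
Qed.

(** The series without its constant term has a periodic primitive, namely the series
    of the u k / (i k); the integral is computed from it by the fundamental theorem. *)
Lemma mean_trig (u : int -> C) B (z : R -> C) :
  sum_le (fun k : int => nc (u k) * (1 + k%:~R ^+ 2)) B ->
  (forall t, has_sum (fun k : int => u k * expC ('i%C * (t * k%:~R)%:C)) (z t)) ->
  (2 * pi)^-1 * Rintegral lebesgue_measure `[0, 2 * pi]%classic (fun t => Re (z t)) = Re (u 0).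
Proof.
move=> hB hz.
(* The coefficients of the primitive. *)
pose w k : C := if k == 0 then 0 else u k / ('i%C * k%:~R).
have i0 : 'i%C != 0 :> C.
  by apply/eqP => h; have := nci R; rewrite h nc0 => /eqP; rewrite eq_sym oner_eq0.
have wE k : 'i%C * k%:~R * w k = if k == 0 then 0 else u k.
  rewrite /w; case: eqP => [->|/eqP k0]; first by rewrite mulr0.
  by rewrite mulrC divfK// mulf_neq0// intr_eq0.
have nck (k : int) : nc (k%:~R : C) = `|k%:~R|.
  by rewrite (_ : k%:~R = (k%:~R : R)%:C :> C) ?ncR// rmorph_int.
have hw k : nc (w k) <= nc (u k).
  rewrite /w; case: eqP => [_|/eqP k0]; first by rewrite nc0 nc_ge0.
  rewrite ncM ncV ncM nci mul1r nck ler_piMr ?nc_ge0// invf_le1 ?normr_gt0 ?intr_eq0//.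
  by rewrite -intr_norm -natr_absz ler1n absz_gt0.
have hBw : sum_le (fun k : int => nc (w k) * (1 + k%:~R ^+ 2)) B.
  apply: sum_leW hB => // k; rewrite ler_wpM2r//.
  by rewrite addr_ge0// sqr_ge0.
have ex t : exists s, has_sum (fun k : int => w k * expC ('i%C * (t * k%:~R)%:C)) s.
  apply: (@abs_le_has_sum _ _ _ B); apply: sum_leW hBw => // k.
  by rewrite ncM nc_expCi mulr1 ler_peMr ?nc_ge0// lerDl sqr_ge0.
have [W hW] := choice ex.
have hW' t : has_sum (fun k : int => 'i%C * (k%:~R : R)%:C * w k * expC ('i%C * (t * k%:~R)%:C)) (z t - u 0).
  have h0 : has_sum (fun k : int => if k == 0 then u 0 else 0) (u 0).
    have := @has_sum_supp R _ (fun k : int => if k == 0 then u 0 else 0) [fset 0]%fset.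
    rewrite big_seq_fset1 eqxx; apply => k; rewrite inE => /negbTE -> //.
  apply: has_sum_eq (has_sumB (hz t) h0) => k.
  rewrite rmorph_int wE; case: eqP => [->|_]; last by rewrite subr0.
  by rewrite mulr0 mulr0 expC0 mulr1 subrr mul0r.
have dW := trig_derive hBw hW hW'.
have hz' t : exists s, has_sum (fun k : int => 'i%C * (k%:~R : R)%:C * u k * expC ('i%C * (t * k%:~R)%:C)) s.
  apply: (@abs_le_has_sum _ _ _ B); apply: sum_leW hB => // k.
  rewrite ncM nc_expCi mulr1 ncM ncM nci mul1r ncR mulrC ler_wpM2l ?nc_ge0//.
  have := sqr_ge0 (`|k%:~R| - 1 : R); rewrite sqrrB real_normK ?num_real//.
  by rewrite mulr1 expr1n; have := normr_ge0 (k%:~R : R); lra.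
have [z' hz''] := choice hz'.
have cz : continuous (fun t => Re (z t)).
  exact: continuous_of_is_derive (trig_derive hB hz hz'').
pose F t := Re (W t) + t * Re (u 0).
have dF (t : R) : is_derive t 1 F (Re (z t)).
  have -> : Re (z t) = Re (z t - u 0) + (Re (u 0) *: (1 : R)).
    by rewrite -[_ *: _]/(_ * _) ReB mulr1 subrK.
  have -> : F = (fun t => Re (W t)) + (Re (u 0) *: id).
    by apply/funext => s; rewrite /F /= mulrC.
  have d1 := dW t.
  by apply: is_deriveD.
have cF := continuous_of_is_derive dF.
have pi2 : 0 < 2 * pi :> R by rewrite mulr_gt0// pi_gt0.
rewrite /Rintegral (continuous_FTC2 (F := F) pi2) => [|||t _].
- rewrite /F; have -> : W (2 * pi) = W 0.
    apply: (has_sum_unique _ (hW 0)); apply: has_sum_eq (hW (2 * pi)) => k.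
    by rewrite expC_2pi mul0r mulr0 expC0.
  by rewrite -EFinB /= mul0r addr0 addrAC subrr add0r mulKf// gt_eqF.
- exact: continuous_subspaceT.
- split=> [t _||]; first by case: (dF t).
  + by apply: cvg_at_right_filter; exact: cF.
  + by apply: cvg_at_left_filter; exact: cF.
- by rewrite derive1E; have /@derive_val := dF t.
Qed.

(** Induction on the dimension: by the induction hypothesis the inner mean, over the
    last n variables, is a trigonometric series in the first variable, to which
    [mean_trig] applies. *)
Lemma torus_mean_trig n (a : 'rV[int]_n -> C) B (z : 'rV[R]_n -> C) :
  sum_le (fun k => nc (a k) * (1 + (norm1 k)%:R ^+ 2)) B ->
  (forall x, has_sum (fun k => a k * character k (toC x)) (z x)) ->
  torus_mean (fun x => Re (z x)) = Re (a 0).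
Proof.
elim: n a B z => [|n IH] a B z hB hz.
  rewrite /=; congr Re; apply: has_sum_unique (hz 0) _.
  have := @has_sum_supp R _ (fun k => a k * character k (toC 0)) [fset 0]%fset.
  rewrite big_seq_fset1 character0 mulr1; apply=> k; rewrite inE.
  by rewrite (_ : k = 0) ?eqxx//; apply/rowP => -[].
(* The index k is split into its first entry p and the others, as the iterated mean does
   with the variable. *)
pose cons (p : int) (k : 'rV[int]_n) : 'rV[int]_n.+1 := row_mx (const_mx p : 'rV[int]_1) k.
have hnorm p k : norm1 (cons p k) = (`|p| + norm1 k)%N.
  rewrite /norm1 (big_ord_recl n).
  congr (_ + _)%N.
    rewrite (_ : ord0 = lshift n ord0 :> 'I_(1 + n)); last exact: val_inj.
    by rewrite /cons (@row_mxEl _ 1 1 n) mxE.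
  apply: eq_bigr => j _.
  rewrite (_ : lift ord0 j = rshift 1 j :> 'I_(1 + n)); last exact: val_inj.
  by rewrite /cons (@row_mxEr _ 1 1 n).
have hdot p k (t : R) x : character (cons p k) (toC (row_mx (const_mx t : 'rV[R]_1) x : 'rV[R]_n.+1)) =
    expC ('i%C * (t * p%:~R)%:C) * character k (toC x).
  rewrite !characterE -expCD -mulrDr; congr (expC (_ * _)).
  rewrite [LHS](big_ord_recl n); congr (_ + _).
    rewrite (_ : ord0 = lshift n ord0 :> 'I_(1 + n)); last exact: val_inj.
    rewrite /cons (@row_mxEl _ 1 1 n) mxE mxE (@row_mxEl _ 1 1 n) mxE.
    by rewrite realCM rmorph_int mulrC.
  apply: eq_bigr => j _.
  rewrite (_ : lift ord0 j = rshift 1 j :> 'I_(1 + n)); last exact: val_inj.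
  by rewrite /cons (@row_mxEr _ 1 1 n) mxE (@row_mxEr _ 1 1 n) mxE.
pose fpair (p : int * 'rV[int]_n) := cons p.1 p.2.
pose gpair (k : 'rV[int]_n.+1) : int * 'rV[int]_n :=
   ((k : 'rV[int]_(1 + n)) 0 (lshift n ord0), rsubmx (k : 'rV[int]_(1 + n))).
have fK : cancel fpair gpair.
  move=> [p k]; rewrite /fpair /gpair /cons /=; congr pair.
    by rewrite (@row_mxEl _ 1 1 n) mxE.
  exact: row_mxKr.
have gK : cancel gpair fpair.
  move=> k; rewrite /fpair /gpair /cons /=.
  rewrite -[RHS](@hsubmxK _ 1 1 n).
  rewrite (_ : const_mx _ = lsubmx (k : 'rV[int]_(1 + n)))//.
  by apply/rowP => i; rewrite (ord1 i) [LHS]mxE [RHS]mxE.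
have hBp : sum_le (fun p => nc (a (fpair p)) * (1 + (norm1 (fpair p))%:R ^+ 2)) B.
  exact: sum_le_inj (can_inj fK) hB.
have swapI : injective (fun p : 'rV[int]_n * int => (p.2, p.1)) by move=> [? ?] [? ?] [-> ->].
have hBs := sum_le_inj swapI hBp.
have hsq p k : 1 + (norm1 k)%:R ^+ 2 <= 1 + (norm1 (cons p k))%:R ^+ 2 :> R.
  by rewrite lerD2l lerXn2r ?nnegrE// ler_nat hnorm leq_addl.
have hsq' p k : 1 + (`|p|%N)%:R ^+ 2 <= 1 + (norm1 (cons p k))%:R ^+ 2 :> R.
  by rewrite lerD2l lerXn2r ?nnegrE// ler_nat hnorm leq_addr.
have one (k : 'rV[int]_n) : 1 <= 1 + (norm1 k)%:R ^+ 2 :> R by rewrite lerDl sqr_ge0.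
have ex t k : exists s, has_sum (fun p : int => a (cons p k) * expC ('i%C * (t * p%:~R)%:C)) s.
  apply: (@abs_le_has_sum _ _ _ B).
  apply: sum_leW (sum_le_section k hBs) => // p.
  rewrite ncM nc_expCi mulr1 ler_peMr ?nc_ge0//.
  by apply: le_trans (hsq _ _); exact: one.
have inner t : torus_mean (fun x : 'rV[R]_n => Re (z (row_mx (const_mx t : 'rV[R]_1) x : 'rV[R]_n.+1))) =
    Re (projT1 (cid (ex t 0))).
  have [b hb] := choice (ex t).
  have hh : abs_le (fun p : 'rV[int]_n * int => (1 + (norm1 p.1)%:R ^+ 2)%:C * (a (cons p.2 p.1) * expC ('i%C * (t * p.2%:~R)%:C))) B.
    apply: sum_leW hBs => // p.
    rewrite ncM [nc (a _ * _)]ncM nc_expCi mulr1 ncR_ge0; last by rewrite addr_ge0// sqr_ge0.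
    rewrite mulrC ler_wpM2l ?nc_ge0//; exact: hsq.
  have hb' : sum_le (fun k => nc (b k) * (1 + (norm1 k)%:R ^+ 2)) B.
    have := abs_le_sigma hh (fun k => has_sumZ (1 + (norm1 k)%:R ^+ 2)%:C (hb k)).
    apply: sum_leW => // k; rewrite ncM ncR_ge0; last by rewrite addr_ge0// sqr_ge0.
    by rewrite mulrC.
  rewrite (IH b B) //.
    by case: cid => s hs /=; rewrite (has_sum_unique (hb 0) hs).
  move=> x.
  have h1 := has_sum_swap (has_sum_bij fK gK (hz (row_mx (const_mx t : 'rV[R]_1) x : 'rV[R]_n.+1))).
  apply: has_sum_sigma h1 _ => k /=.
  rewrite mulrC; apply: has_sum_eq (has_sumZ (character k (toC x)) (hb k)) => p.
  by rewrite /fpair /= hdot; ring.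
rewrite [LHS]/=; under [X in Rintegral _ _ X]eq_fun do rewrite inner.
have -> : (0 : 'rV[int]_n.+1) = cons 0 0.
  by apply/rowP => j; rewrite [RHS]mxE mxE; case: splitP => i _; rewrite mxE.
apply: (@mean_trig (fun p => a (cons p 0)) B (fun t => projT1 (cid (ex t 0)))).
  apply: sum_leW (sum_le_section 0 hBs) => // p.
  rewrite ler_wpM2l ?nc_ge0//; apply: le_trans (hsq' _ _).
  by rewrite natr_absz intr_norm real_normK ?num_real.
by move=> t; case: cid.
Qed.

(** Multiplication by the character of index -k shifts the coefficients by k, and the
    weight 1 + |k|^2 changes at most by a factor depending on k. *)
Lemma fourier_coef d (a : 'rV[int]_d -> C) B (V : 'rV[C]_d -> C) :
  sum_le (fun k => nc (a k) * (1 + (norm1 k)%:R ^+ 2)) B ->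
  (forall x, has_sum (fun k => a k * character k (toC x)) (V (toC x))) ->
  forall k, fourier V k = a k.
Proof.
move=> hB hV k.
have hB' : sum_le (fun j => nc (a (j + k)) * (1 + (norm1 j)%:R ^+ 2))
    ((2 * (1 + (norm1 k)%:R ^+ 2)) * B).
  have c0 : 0 <= 2 * (1 + (norm1 k)%:R ^+ 2) :> R.
    by rewrite mulr_ge0// addr_ge0// sqr_ge0.
  apply: sum_leW (lexx _) (sum_leZ c0 (sum_le_inj (addIr k) hB)) => j /=.
  rewrite [leRHS]mulrCA ler_wpM2l ?nc_ge0//.
  have : (norm1 j)%:R <= (norm1 (j + k))%:R + (norm1 k)%:R :> R.
    rewrite -natrD ler_nat -[k in (_ + norm1 k)%N]opprK norm1N.
    by have := norm1D (j + k) (- k); rewrite addrK.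
  move: (ler0n R (norm1 j)) (ler0n R (norm1 (j + k))) (ler0n R (norm1 k)).
  move: ((norm1 j)%:R) ((norm1 (j + k))%:R) ((norm1 k)%:R) => E D A E0 D0 A0 h.
  have h2 : E ^+ 2 <= (D + A) ^+ 2 by rewrite lerXn2r ?nnegrE//; lra.
  have := sqr_ge0 (D - A); have := sqr_ge0 (D * A).
  by move: h2; rewrite !expr2 => *; nra.
pose z x := V (toC x) * character (- k) (toC x).
have hz x : has_sum (fun j => a (j + k) * character j (toC x)) (z x).
  have h := has_sum_bij (addrK k) (subrK k) (has_sumZ (character (- k) (toC x)) (hV x)).
  rewrite /z mulrC; apply: has_sum_eq h => j /=.
  by rewrite mulrCA -characterD (_ : - k + (j + k) = j)// addrC addrK.
have hBi : sum_le (fun j => nc (- 'i%C * a (j + k)) * (1 + (norm1 j)%:R ^+ 2))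
    ((2 * (1 + (norm1 k)%:R ^+ 2)) * B).
  by apply: sum_leW hB' => // j; rewrite ncM ncN nci mul1r.
have hzi x : has_sum (fun j => - 'i%C * a (j + k) * character j (toC x)) (- 'i%C * z x).
  by apply: has_sum_eq (has_sumZ (- 'i%C) (hz x)) => j; rewrite mulrA.
rewrite /fourier /meanC.
have -> : (fun theta : 'rV[R]_d => Im (V (toC theta) * character (- k) (toC theta))) =
   (fun x => Re (- 'i%C * z x)).
  by apply/funext => x; rewrite -/(z x); case: (z x) => p q /=; ring.
rewrite (torus_mean_trig hBi hzi) (torus_mean_trig hB' hz) add0r.
by case: (a k) => p q; apply: complex_ext => /=; ring.
Qed.

End Fourier.

(** * Limits along an ultrafilter *)
Section Ultra.
Variable R : realType.
Local Notation C := R[i].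
Local Notation Re := (@complex.Re R).
Local Notation Im := (@complex.Im R).
Local Notation nc := (@Normc.normc R).

(** Along an ultrafilter every bounded sequence converges. Discrete Fourier coefficients
    thus have limits for all k and theta at once, without any proof of convergence. *)
Lemma exists_ultra : exists2 U : set_system nat, UltraFilter U & \oo `<=` U.
Proof. by have [U [h1 h2]] := ultraFilterLemma eventually_filter; exists U. Qed.

Definition clim (U : set_system nat) (a : nat -> C) (l : C) :=
  forall e : R, 0 < e -> \forall n \near U, nc (l - a n) < e.

Section UltraLimits.
Variable U : set_system nat.
Hypothesis HU : UltraFilter U.
Let PU : ProperFilter U := @ultra_proper _ _ HU.
Local Existing Instance PU.

Lemma ultra_real (a : nat -> R) M : (\forall n \near U, `|a n| <= M) ->
  exists l : R, a n @[n --> U] --> l.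
Proof.
move=> hM.
have [|p [_ hp]] := @segment_compact R (- M) M (fmap a U) _.
  by apply: filterS hM => n; rewrite /= in_itv/= -ler_norml.
exists p; apply/cvgrPdist_lt => e e0.
have [//|hc] := in_ultra_setVsetC (fun n => `|p - a n| < e) HU.
have nb : nbhs p [set x | `|p - x| < e].
  by apply/nbhs_normP; exists e.
have [x [h1 h2]] := hp (fun x => ~ `|p - x| < e) _ hc nb.
by [].
Qed.

Lemma ultra_lim (a : nat -> C) M : (\forall n \near U, nc (a n) <= M) ->
  exists l, clim U a l.
Proof.
move=> hM.
have [x hx] : exists l : R, Re (a n) @[n --> U] --> l.
  by apply: (@ultra_real _ M); apply: filterS hM => n; apply: le_trans; exact: Re_le_nc.
have [y hy] : exists l : R, Im (a n) @[n --> U] --> l.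
  by apply: (@ultra_real _ M); apply: filterS hM => n; apply: le_trans; exact: Im_le_nc.
exists (x +i* y) => e e0; have e2 : 0 < e / 2 by rewrite divr_gt0.
move/cvgrPdist_lt : hx => /(_ _ e2) hx; move/cvgrPdist_lt : hy => /(_ _ e2) hy.
near=> n; apply: le_lt_trans (nc_le_ReIm _) _.
rewrite ReB ImB /=.
have h1 : `|x - Re (a n)| < e / 2 by near: n.
have h2 : `|y - Im (a n)| < e / 2 by near: n.
by lra.
Unshelve. all: by end_near. Qed.

Lemma clim_le (a : nat -> C) l B : clim U a l -> (\forall n \near U, nc (a n) <= B) ->
  nc l <= B.
Proof.
move=> hl hB; apply/ler_addgt0Pr => e /hl he.
have [n [h1 h2]] := filter_ex (filterI he hB).
rewrite -(subrK (a n) l) (le_trans (ncD _ _))// addrC lerD// ltW//.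
Qed.

End UltraLimits.
End Ultra.

(** * Finite differences of powers *)
Section Differences.
Variable R : realType.
Local Notation C := R[i].
Local Notation Re := (@complex.Re R).
Local Notation Im := (@complex.Im R).
Local Notation nc := (@Normc.normc R).

(** dw Q i = (-1)^(Q - i) C(Q, i), the weights of the Q-th forward difference, defined by
    the recursion that expresses this difference as a difference of differences. *)
Fixpoint dw (Q : nat) : nat -> R :=
  match Q with
  | 0 => fun i => (i == 0%N)%:R
  | Q'.+1 => fun i => (if i is i'.+1 then dw Q' i' else 0) - dw Q' i
  end.

Lemma dw_gt Q i : (Q < i)%N -> dw Q i = 0.
Proof.
elim: Q i => [|Q IH] [|i] //= h; rewrite IH ?IH ?subrr//; exact: ltnW.
Qed.

Lemma dw_sumS Q (f : nat -> C) :
  \sum_(i < Q.+2) (dw Q.+1 i)%:C * f i = \sum_(i < Q.+1) (dw Q i)%:C * (f i.+1 - f i).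
Proof.
rewrite /=.
have -> : \sum_(i < Q.+2) ((if nat_of_ord i is i'.+1 then dw Q i' else 0) - dw Q i)%:C * f i =
   \sum_(i < Q.+2) (if nat_of_ord i is i'.+1 then dw Q i' else 0)%:C * f i -
   \sum_(i < Q.+2) (dw Q i)%:C * f i.
  by rewrite -sumrB; apply: eq_bigr => i _; rewrite rmorphB mulrBl.
rewrite big_ord_recl mul0r add0r [X in _ - X]big_ord_recr /= dw_gt// mul0r addr0.
by rewrite -sumrB; apply: eq_bigr => i _; rewrite mulrBr.
Qed.

Lemma dw_pow Q (x : C) : \sum_(i < Q.+1) (dw Q i)%:C * x ^+ i = (x - 1) ^+ Q.
Proof.
elim: Q => [|Q IH]; first by rewrite big_ord1 /= mul1r.
rewrite (dw_sumS Q (fun i => x ^+ i)) exprSr -IH mulr_suml; apply: eq_bigr => i _.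
by rewrite exprSr; ring.
Qed.

(** The Q-th difference annihilates the polynomials of degree less than Q. *)
Lemma dw_moment Q b : (b < Q)%N -> \sum_(i < Q.+1) (dw Q i)%:C * (i%:R : C) ^+ b = 0.
Proof.
elim: Q b => [//|Q IH] b bQ; rewrite (dw_sumS Q (fun i => i%:R ^+ b)).
have E (i : nat) : (i.+1%:R : C) ^+ b - i%:R ^+ b = \sum_(c < b) i%:R ^+ c *+ 'C(b, c).
  rewrite -natr1 [_ + 1]addrC exprDn big_ord_recr /= binn subnn expr0 mul1r mulr1n addrK.
  by apply: eq_bigr => c _; rewrite expr1n mul1r.
under eq_bigr do rewrite E mulr_sumr.
rewrite exchange_big /= big1// => c _.
under eq_bigr do rewrite mulrnAr.
by rewrite sumrMnl IH ?mul0rn// (leq_trans (ltn_ord c)).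
Qed.

Lemma dw_abs Q : \sum_(i < Q.+1) `|dw Q i| <= 2 ^+ Q.
Proof.
elim: Q => [|Q IH]; first by rewrite big_ord1 /= normr1.
apply: (@le_trans _ _ (\sum_(i < Q.+2) (`|if nat_of_ord i is i'.+1 then dw Q i' else 0| + `|dw Q i|))).
  by apply: ler_sum => i _; exact: ler_normB.
rewrite big_split /= big_ord_recl /= normr0 add0r [X in _ + X]big_ord_recr /= dw_gt// normr0 addr0.
by rewrite exprS mulr2n mulrDl mul1r lerD.
Qed.

(** In the binomial expansion of (t + z_i)^n the powers of z_i below Q disappear after
    summation against w, so the result carries the gain A of order Q. *)
Lemma monomial_bound (T : finType) (w : T -> C) (z : T -> C) (t : C) (s A : R) (Q n : nat) :
  0 <= s -> 0 <= A -> nc t <= s ->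
  (forall b, (b < Q)%N -> \sum_(i : T) w i * z i ^+ b = 0) ->
  (forall b, (Q <= b)%N -> \sum_(i : T) nc (w i) * nc (z i) ^+ b <= A * s ^+ b) ->
  nc (\sum_(i : T) w i * (t + z i) ^+ n) <= A * (2 * s) ^+ n.
Proof.
move=> s0 A0 ts hQ hA.
have -> : \sum_(i : T) w i * (t + z i) ^+ n =
   \sum_(b < n.+1) (t ^+ (n - b) * \sum_(i : T) w i * z i ^+ b) *+ 'C(n, b).
  under eq_bigr do rewrite exprDn mulr_sumr.
  rewrite exchange_big /=; apply: eq_bigr => b _.
  rewrite mulr_sumr -sumrMnl; apply: eq_bigr => i _.
  by rewrite mulrnAr mulrCA.
apply: le_trans (nc_sum _ _ _) _.
have -> : A * (2 * s) ^+ n = \sum_(b < n.+1) (s ^+ (n - b) * (A * s ^+ b)) *+ 'C(n, b).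
  rewrite (_ : 2 * s = s + s) ?exprDn; last by ring.
  rewrite mulr_sumr; apply: eq_bigr => b _; by rewrite mulrnAr mulrCA.
apply: ler_sum => b _; rewrite normcMn lerMn2r; apply/orP; right.
rewrite ncM; apply: ler_pM; rewrite ?nc_ge0//.
  by rewrite ncX lerXn2r ?nnegrE ?nc_ge0.
have [bQ|Qb] := ltnP b Q; first by rewrite hQ// nc0 mulr_ge0// exprn_ge0.
apply: le_trans (hA _ Qb); apply: le_trans (nc_sum _ _ _) _.
by apply: ler_sum => i _; rewrite ncM ncX.
Qed.

(** The Q-th difference with mesh h of a power on a disc of radius 2 s gains (h / s)^Q.
    The number of nodes Q' may exceed Q, in order that differences of several orders be
    taken over a common set of nodes. *)
Lemma dw_bound Q Q' (h s : R) (t : C) n : 0 <= h -> 0 < s -> Q'%:R * h <= s -> nc t <= s ->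
  (Q <= Q')%N ->
  nc (\sum_(i < Q'.+1) (dw Q i)%:C * (t + (h * i%:R)%:C) ^+ n) <=
    (2 * Q'%:R * h / s) ^+ Q * (2 * s) ^+ n.
Proof.
move=> h0 s0 hs ts QQ.
have trunc (f : nat -> C) : \sum_(i < Q'.+1) (dw Q i)%:C * f i = \sum_(i < Q.+1) (dw Q i)%:C * f i.
  rewrite [RHS](big_ord_widen Q'.+1 (fun i => (dw Q i)%:C * f i)) ?ltnS//.
  rewrite [RHS]big_mkcond /=; apply: eq_bigr => i _.
  by case: ltnP => // h1; rewrite dw_gt ?mul0r.
apply: (@monomial_bound _ _ (fun i : 'I_Q'.+1 => (h * i%:R)%:C) t s _ Q n) => //.
- exact: ltW.
- by rewrite exprn_ge0// divr_ge0 ?(ltW s0)// !mulr_ge0.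
- move=> b bQ; rewrite (trunc (fun i => (h * i%:R)%:C ^+ b)).
  under eq_bigr do rewrite realCM exprMn mulrCA (rmorph_nat (real_complex R)).
  by rewrite -mulr_sumr dw_moment ?mulr0.
- move=> b bQ.
  apply: (@le_trans _ _ (\sum_(i < Q'.+1) `|dw Q i| * (Q'%:R * h) ^+ b)).
    apply: ler_sum => i _; rewrite !ncR ler_wpM2l// lerXn2r ?nnegrE ?mulr_ge0//.
    by rewrite ger0_norm ?mulr_ge0// mulrC ler_wpM2r// ler_nat -ltnS.
  rewrite -mulr_suml.
  have -> : \sum_(i < Q'.+1) `|dw Q i| = \sum_(i < Q.+1) `|dw Q i|.
    rewrite [RHS](big_ord_widen Q'.+1 (fun i => `|dw Q i|)) ?ltnS//.
    rewrite [RHS]big_mkcond /=; apply: eq_bigr => i _.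
    by case: ltnP => // h1; rewrite dw_gt ?normr0.
  apply: (@le_trans _ _ (2 ^+ Q * ((Q'%:R * h / s) ^+ Q * s ^+ b))).
    apply: ler_pM; rewrite ?dw_abs ?exprn_ge0 ?mulr_ge0 ?sumr_ge0//.
    have -> : (Q'%:R * h) ^+ b = (Q'%:R * h / s) ^+ b * s ^+ b.
      by rewrite -exprMn divfK// gt_eqF.
    rewrite ler_wpM2r ?exprn_ge0 ?(ltW s0)//.
    rewrite ler_wiXn2l// ?divr_ge0 ?mulr_ge0 ?(ltW s0)//.
    by rewrite ler_pdivrMr// mul1r.
  by rewrite mulrA -exprMn !mulrA.
Qed.

(** The three values at 0, zeta and h are combined with weights annihilating 1 and z.
    This is a discrete Cauchy-Riemann equation: the increment in the complex direction
    zeta is zeta / h times the increment in the real direction h, up to second order. *)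
Lemma cr_bound (h s : R) (t zeta : C) n : 0 < h -> 0 < s -> h <= s -> nc zeta <= s -> nc t <= s ->
  nc ((t + zeta) ^+ n - t ^+ n - zeta / h%:C * ((t + h%:C) ^+ n - t ^+ n)) <=
    ((nc zeta ^+ 2 + nc zeta * h) / s ^+ 2) * (2 * s) ^+ n.
Proof.
move=> h0 s0 hs zs ts.
have hC : h%:C != 0 :> C by rewrite (inj_eq (@complexI R)) gt_eqF.
pose w (i : 'I_3) : C := [:: 1; - (1 - zeta / h%:C); - (zeta / h%:C)]`_i.
pose z (i : 'I_3) : C := [:: zeta; 0; h%:C]`_i.
have -> : (t + zeta) ^+ n - t ^+ n - zeta / h%:C * ((t + h%:C) ^+ n - t ^+ n) =
   \sum_(i : 'I_3) w i * (t + z i) ^+ n.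
  by rewrite !big_ord_recl big_ord0 /w /z /= !addr0; ring.
have z0 := nc_ge0 zeta.
apply: (@monomial_bound _ w z t s _ 2 n) => //.
- exact: ltW.
- by rewrite divr_ge0 ?sqr_ge0// addr_ge0 ?mulr_ge0 ?sqr_ge0 ?(ltW h0).
- move=> [|[|//]] _; rewrite !big_ord_recl big_ord0 /w /z /= ?expr0 ?expr1.
    by ring.
  by field.
- move=> [|[|b]]// _; rewrite !big_ord_recl big_ord0 /w /z ![nth _ _ _]/= nc0 expr0n mulr0 add0r addr0.
  rewrite nc1 mul1r ncN ncM ncV ncR_ge0 ?(ltW h0)//.
  rewrite -addn2 !exprD.
  have -> : nc zeta / h * (h ^+ b * h ^+ 2) = nc zeta * h * h ^+ b by field; rewrite gt_eqF.
  have -> : (nc zeta ^+ 2 + nc zeta * h) / s ^+ 2 * (s ^+ b * s ^+ 2) =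
    (nc zeta ^+ 2 + nc zeta * h) * s ^+ b by field; rewrite gt_eqF.
  rewrite mulrDl [leLHS]addrC [leRHS]addrC; apply: lerD.
    rewrite ler_wpM2l ?mulr_ge0 ?(ltW h0)// lerXn2r ?nnegrE ?(ltW h0) ?(ltW s0)//.
  by rewrite mulrC ler_wpM2l ?sqr_ge0// lerXn2r ?nnegrE ?(ltW s0).
Qed.

Lemma expR_quad (a : R) : `|a| <= 1 / 2 -> `|expR a - 1 - a| <= 2 * a ^+ 2.
Proof.
rewrite ler_norml => /andP[a1 a2].
have h1 := expR_ge1Dx a; have h2 := expR_ge1Dx (- a).
have e0 := expR_gt0 a.
have h3 : expR a * expR (- a) = 1 by rewrite -expRD subrr expR0.
rewrite ger0_norm; last by lra.
have h4 : expR a * (1 - a) <= 1 by rewrite -[leRHS]h3 ler_wpM2l// ltW.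
suff : expR a <= 1 + a + 2 * a ^+ 2 by lra.
have a3 : 0 < 1 - a by lra.
rewrite -(ler_pM2r a3); apply: le_trans h4 _.
by rewrite expr2; nra.
Qed.

Lemma expC_quad (w : C) : nc w <= 1 / 2 -> nc (expC w - 1 - w) <= 10 * nc w ^+ 2.
Proof.
move=> hw.
have ha : `|Re w| <= 1 / 2 by apply: le_trans hw; exact: Re_le_nc.
have e1 : expC w = (expR (Re w))%:C * expC ('i%C * (Im w)%:C).
  rewrite {1}[w]complexRI expCD; congr (_ * _).
  by rewrite /expC /= cos0 sin0; apply: complex_ext => /=; ring.
rewrite e1 [X in _ - 1 - X]complexRI.
have hra := Re_le_nc w; have hrb := Im_le_nc w.
move: (Re w) (Im w) ha hra hrb => a b ha hra hrb.
have r1 := expR_quad ha; have r2 := expCi_quad b; have u1 := nc_expCi b.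
set E := expC _ in r2 u1 *.
have -> : (expR a)%:C * E - 1 - (a%:C + 'i%C * b%:C) =
  (E - 1 - 'i%C * b%:C) + a%:C * ('i%C * b%:C + (E - 1 - 'i%C * b%:C)) + (expR a - 1 - a)%:C * E.
  by rewrite !rmorphB /= rmorph1; ring.
apply: le_trans (ncD _ _) _; rewrite ncM ncR u1 mulr1.
apply: le_trans (lerD (ncD _ _) (lexx _)) _; rewrite ncM ncR.
have h3 : nc ('i%C * b%:C + (E - 1 - 'i%C * b%:C)) <= `|b| + 2 * b ^+ 2.
  by apply: le_trans (ncD _ _) _; rewrite ncM nci mul1r ncR lerD2l.
have h4 : `|a| * nc ('i%C * b%:C + (E - 1 - 'i%C * b%:C)) <= `|a| * (`|b| + 2 * b ^+ 2).
  by rewrite ler_wpM2l.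
move: r1 r2 h4; rewrite -[a ^+ 2]real_normK ?num_real// -[b ^+ 2]real_normK ?num_real//.
have := normr_ge0 a; have := normr_ge0 b; have := nc_ge0 w.
move: (nc w) (`|a|) (`|b|) hw ha hra hrb => W A B hw ha hra hrb W0 B0 A0.
move: (nc _) (nc _) (`|_|) => x y z h5 h6 h7.
have hA2 : A ^+ 2 <= W ^+ 2 by rewrite lerXn2r ?nnegrE.
have hB2 : B ^+ 2 <= W ^+ 2 by rewrite lerXn2r ?nnegrE.
have hAB : A * B <= W ^+ 2 by rewrite expr2 ler_pM.
have hAB2 : A * (2 * B ^+ 2) <= W ^+ 2.
  apply: (@le_trans _ _ (B ^+ 2)) => //; have := sqr_ge0 B; move: (B ^+ 2) => B2; nra.
have h8 : A * x <= W ^+ 2 + W ^+ 2 by apply: le_trans h7 _; rewrite mulrDr lerD.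
apply: le_trans (lerD (lerD h6 h8) h5) _.
move: hA2 hB2; move: (A ^+ 2) (B ^+ 2) => A2 B2 hA2 hB2; have := sqr_ge0 W; lra.
Qed.

Lemma sin_lower (y : R) : 0 <= y <= pi / 2 -> y / 8 <= sin y.
Proof.
move=> /andP[y0 y1].
have small (x : R) : 0 <= x <= 1 / 2 -> x / 2 <= sin x.
  move=> /andP[x0 x1]; have := sin_quad x; rewrite ler_norml => /andP[h _].
  have : x ^+ 2 <= x / 2 by rewrite expr2; nra.
  by lra.
have [h|h] := leP y (1 / 2).
  by apply: le_trans (small y _); [lra | rewrite y0].
have p2 := pihalf_lt2 R; have p0 := pi_gt0 R.
have : sin (1 / 2) < sin y.
  by rewrite ltr_sin// in_itv/=; lra.
have := small (1 / 2); rewrite lexx andbT => /(_ _) h3.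
have : 1 / 2 / 2 <= sin (1 / 2 : R) by apply: h3; lra.
by lra.
Qed.

(** Used to divide by the numbers exp(i k_j h) - 1 produced by summation by parts. *)
Lemma expCi_lower (x : R) : `|x| <= pi -> `|x| / 8 <= nc (expC ('i%C * x%:C) - 1).
Proof.
move=> hx.
have h1 : nc (expC ('i%C * x%:C) - 1) ^+ 2 = 2 * (1 - cos x).
  rewrite expCi /= sqr_sqrtr; last by rewrite addr_ge0// sqr_ge0.
  rewrite oppr0 addr0; have := cos2Dsin2 x.
  rewrite sqrrB mulr1 expr1n; move: (cos x ^+ 2) (sin x ^+ 2) (cos x) => a b c; lra.
rewrite -ler_sqr ?nnegrE ?nc_ge0 ?divr_ge0// h1 cos_sub1E.
have h2 : (`|x| / 2) / 8 <= sin (`|x| / 2).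
  by apply: sin_lower; rewrite divr_ge0//= ler_pM2r.
have -> : sin (x / 2) ^+ 2 = sin (`|x| / 2) ^+ 2.
  by case: (ger0P x) => // _; rewrite mulNr sinN sqrrN.
have h3 : (`|x| / 2 / 8) ^+ 2 <= sin (`|x| / 2) ^+ 2.
  have h0 : 0 <= `|x| / 2 / 8 by rewrite !divr_ge0.
  by rewrite lerXn2r ?nnegrE// (le_trans h0).
by move: h3; rewrite !exprMn; lra.
Qed.

End Differences.

(** * Local power series on the strip *)
Section Torus.
Variable R : realType.
Variable d : nat.
Local Notation C := R[i].
Local Notation Re := (@complex.Re R).
Local Notation Im := (@complex.Im R).
Local Notation nc := (@Normc.normc R).
Implicit Types (theta p : 'rV[C]_d) (x : 'rV[R]_d) (k : 'rV[int]_d) (alpha : 'rV[nat]_d).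
Local Notation e_ j := (basis_vec R j).

(** The factor of [monomial] carried by theta. *)
Definition mono p theta alpha : C := \prod_(j < d) (theta 0 j - p 0 j) ^+ alpha 0 j.

(** G is, near theta, the sum of a power series centred at a nearby p, with terms bounded
    by M on a polydisc of radius 4 sigma, twice that on which it is used. The radius is
    only bounded below by s, so that the notion is stable under small changes of theta. *)
Definition local_series (s rho M : R) (G : 'rV[C]_d -> C) theta :=
  exists p, exists c : 'rV[nat]_d -> C, exists2 sigma : R, s <= sigma &
    [/\ forall j, nc (theta 0 j - p 0 j) <= sigma,
        forall alpha, nc (c alpha) * \prod_(j < d) (4 * sigma) ^+ alpha 0 j <= M &
        forall theta', strip rho theta' -> (forall j, nc (theta' 0 j - p 0 j) <= 2 * sigma) ->
      has_sum (fun alpha => c alpha * mono p theta' alpha) (G theta')].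

Definition periodic (rho : R) (G : 'rV[C]_d -> C) :=
  forall theta j, strip rho theta -> G (theta + (2 * pi)%:C *: e_ j) = G theta.

Lemma toCD x y : toC (x + y) = toC x + toC y.
Proof. by rewrite /toC map_mxD. Qed.

Lemma strip_shift rho theta x : strip rho theta -> strip rho (theta + toC x).
Proof. by move=> h j; rewrite !mxE ImD /= addr0; exact: h. Qed.

Lemma basis_toC (t : R) j : t%:C *: e_ j = toC (t *: (delta_mx 0 j : 'rV[R]_d)).
Proof.
apply/rowP => i; rewrite !mxE rmorphM; congr (_ * _).
by case: (_ && _); rewrite ?rmorph1 ?rmorph0.
Qed.

Arguments strip_shift {rho theta} x _.

Lemma periodic_int rho G : periodic rho G -> forall (w : 'rV[int]_d) theta, strip rho theta ->
  G (theta + toC ((2 * pi) *: map_mx intr w)) = G theta.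
Proof.
move=> hG.
(* The set of periods is a group; it contains 2 pi e_j. *)
pose P x := forall theta, strip rho theta -> G (theta + toC x) = G theta.
have PD x y : P x -> P y -> P (x + y).
  by move=> hx hy theta h; rewrite toCD addrA hy ?hx//; exact: strip_shift.
have PN x : P x -> P (- x).
  move=> hx theta h; rewrite -(hx _ (strip_shift (- x) h)) -addrA -toCD addNr.
  by rewrite /toC map_mx0 addr0.
have P0 : P 0 by move=> theta _; rewrite /toC map_mx0 addr0.
have Pe j : P ((2 * pi) *: delta_mx 0 j).
  by move=> theta h; rewrite -basis_toC hG.
have Pn j n : P (((2 * pi) *: delta_mx 0 j) *+ n).
  by elim: n => [|n IH]; rewrite ?mulr0n// mulrS; exact: PD.
have Pz j (z : int) : P (((2 * pi) *: delta_mx 0 j) *~ z).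
  by case: z => n; rewrite ?NegzE ?mulrNz -?pmulrn; [exact: Pn | apply: PN; exact: Pn].
move=> w; rewrite -/(P _).
have -> : (2 * pi) *: map_mx intr w = \sum_j ((2 * pi) *: delta_mx 0 j) *~ w 0 j :> 'rV[R]_d.
  rewrite [map_mx _ _]row_sum_delta scaler_sumr; apply: eq_bigr => j _.
  by rewrite mxE -[RHS]scaler_int !scalerA mulrC.
by elim/big_ind: _ => // *; exact: PD.
Qed.

(** Bounds on combinations of values of monomials are transferred to the power series:
    going from radius 4 s to radius 2 s leaves a geometric series in each variable, of
    sum 2. *)
Lemma local_comb (s M : R) (G : 'rV[C]_d -> C) (T : finType) (w : T -> C) (eta : T -> 'rV[C]_d) p c B : 0 < s -> 0 <= M -> 0 <= B ->
  (forall alpha, nc (c alpha) * \prod_(j < d) (4 * s) ^+ alpha 0 j <= M) ->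
  (forall i, has_sum (fun alpha => c alpha * mono p (eta i) alpha) (G (eta i))) ->
  (forall alpha, nc (\sum_i w i * mono p (eta i) alpha) <= B * \prod_(j < d) (2 * s) ^+ alpha 0 j) ->
  nc (\sum_i w i * G (eta i)) <= B * M * 2 ^+ d.
Proof.
move=> s0 M0 B0 hc hs hw.
have h := has_sum_sum (index_enum T) (fun i => has_sumZ (w i) (hs i)).
apply: abs_le_nc h.
have half : 0 <= (1 / 2 : R) <= (1 / 2 : R) by lra.
have := @sum_le_rV R nat d (fun _ n => (1 / 2) ^+ n) (fun=> 2) _ (fun=> sum_le_geo half).
rewrite prodr_const card_ord => hgeo.
have {}hgeo := hgeo (fun _ n => exprn_ge0 n (proj1 (andP half))).
apply: sum_leW (lexx _) (sum_leZ (mulr_ge0 B0 M0) hgeo) => alpha /=.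
have -> : \sum_i w i * (c alpha * mono p (eta i) alpha) = c alpha * \sum_i w i * mono p (eta i) alpha.
  by rewrite mulr_sumr; apply: eq_bigr => i _; rewrite mulrCA.
rewrite ncM.
apply: (@le_trans _ _ (nc (c alpha) * (B * \prod_(j < d) (2 * s) ^+ alpha 0 j))).
  by rewrite ler_wpM2l ?nc_ge0.
have -> : \prod_(j < d) (2 * s) ^+ alpha 0 j =
   \prod_(j < d) (4 * s) ^+ alpha 0 j * \prod_(j < d) (1 / 2) ^+ alpha 0 j.
  rewrite -big_split /=; apply: eq_bigr => j _; rewrite -exprMn; congr (_ ^+ _).
  by field.
rewrite mulrCA -mulrA ler_wpM2l// mulrA ler_wpM2r//.
by apply: prodr_ge0 => j _; rewrite exprn_ge0; lra.
Qed.

Section Bounds.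
Variables (s rho M : R) (G : 'rV[C]_d -> C).
Hypothesis s0 : 0 < s.
Hypothesis M0 : 0 <= M.
Hypothesis hper : periodic rho G.
Hypothesis hloc : forall theta, strip rho theta -> local_series s rho M G theta.

Lemma local_bound theta : strip rho theta -> nc (G theta) <= M * 2 ^+ d.
Proof.
move=> h; have [p [c [sg hsg [hp hc hs]]]] := hloc h.
have sg0 : 0 < sg := lt_le_trans s0 hsg.
have s_le : sg <= 2 * sg by rewrite mulr2n mulrDl mul1r lerDl ltW.
have e (F : unit -> C) : \sum_i F i = F tt.
  by rewrite (bigD1 tt)//= big1 ?addr0// => -[].
have -> : nc (G theta) = nc (\sum_(i : unit) 1 * G theta) by rewrite e mul1r.
rewrite -[M]mul1r; apply: (@local_comb sg M G unit (fun=> 1) (fun=> theta) p c 1) => //.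
  by move=> _; apply: hs => // j; apply: le_trans (hp j) s_le.
move=> alpha; rewrite e mul1r nc_prod mul1r; apply: ler_prod => j _.
by rewrite nc_ge0/= ncX lerXn2r ?nnegrE ?nc_ge0// ?mulr_ge0 ?(ltW sg0)// (le_trans (hp j)).
Qed.

(** The mixed difference of orders Qs is a product of one-dimensional differences on each
    monomial. *)
Lemma mixed_bound theta Q (Qs : 'I_d -> nat) (h : R) : strip rho theta ->
  0 <= h -> Q%:R * h <= s -> (forall j, (Qs j <= Q)%N) ->
  nc (\sum_(i : {ffun 'I_d -> 'I_Q.+1}) (\prod_j (dw R (Qs j) (i j))%:C) *
       G (theta + toC (\row_j (h * (i j)%:R)))) <=
   (\prod_j (2 * Q%:R * h / s) ^+ Qs j) * M * 2 ^+ d.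
Proof.
move=> ht h0 hs hQ; have [p [c [sg hsg [hp hc hsum]]]] := hloc ht.
have sg0 : 0 < sg := lt_le_trans s0 hsg.
have ent (i : {ffun 'I_d -> 'I_Q.+1}) j : (theta + toC (\row_j (h * (i j)%:R))) 0 j - p 0 j =
     (theta 0 j - p 0 j) + (h * (i j)%:R)%:C.
  by rewrite !mxE addrAC.
have b0 : 0 <= 2 * Q%:R * h by rewrite !mulr_ge0.
have hsg' : Q%:R * h <= sg := le_trans hs hsg.
apply: (@le_trans _ _ ((\prod_j (2 * Q%:R * h / sg) ^+ Qs j) * M * 2 ^+ d)); last first.
  rewrite ler_wpM2r ?exprn_ge0// ler_wpM2r//; apply: ler_prod => j _.
  rewrite exprn_ge0/=; last by rewrite divr_ge0// ltW.
  by rewrite lerXn2r ?nnegrE ?divr_ge0 ?(ltW s0) ?(ltW sg0)// ler_wpM2l// lef_pV2.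
apply: (@local_comb sg M G _ _ (fun i : {ffun 'I_d -> 'I_Q.+1} => theta + toC (\row_j (h * (i j)%:R))) p c) => //.
- by apply: prodr_ge0 => j _; rewrite exprn_ge0// divr_ge0// ltW.
- move=> i; apply: hsum => [|j]; first exact: strip_shift.
  rewrite ent (le_trans (ncD _ _))// mulr2n mulrDl mul1r lerD// ncR_ge0 ?mulr_ge0//.
  apply: le_trans hsg'; rewrite mulrC ler_wpM2r// ler_nat -ltnS//.
move=> alpha.
have -> : \sum_(i : {ffun 'I_d -> 'I_Q.+1}) (\prod_j (dw R (Qs j) (i j))%:C) *
      mono p (theta + toC (\row_j (h * (i j)%:R))) alpha =
   \prod_j \sum_(i < Q.+1) (dw R (Qs j) i)%:C * ((theta 0 j - p 0 j) + (h * i%:R)%:C) ^+ alpha 0 j.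
  rewrite bigA_distr_bigA /=; apply: eq_bigr => i _.
  rewrite -big_split /=; apply: eq_bigr => j _.
  by rewrite ent.
rewrite nc_prod -big_split /=; apply: ler_prod => j _.
rewrite nc_ge0/=; exact: dw_bound.
Qed.

Lemma mono_shift p theta (z : C) j alpha :
  mono p (theta + z *: e_ j) alpha =
   (theta 0 j - p 0 j + z) ^+ alpha 0 j * \prod_(i < d | i != j) (theta 0 i - p 0 i) ^+ alpha 0 i.
Proof.
rewrite /mono (bigD1 j)//=; congr (_ * _).
  by rewrite !mxE !eqxx mulr1 addrAC.
by apply: eq_bigr => i /negbTE ij; rewrite !mxE eqxx ij mulr0 addr0.
Qed.

Lemma cauchy_riemann theta (zeta : C) (h : R) j : strip rho theta ->
  strip rho (theta + zeta *: e_ j) -> nc zeta <= s -> 0 < h -> h <= s ->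
  nc (G (theta + zeta *: e_ j) - G theta -
      zeta / h%:C * (G (theta + h%:C *: e_ j) - G theta)) <=
   ((nc zeta ^+ 2 + nc zeta * h) / s ^+ 2) * M * 2 ^+ d.
Proof.
move=> ht ht' hz h0 hs; have [p [c [sg hsg [hp hc hsum]]]] := hloc ht.
have sg0 : 0 < sg := lt_le_trans s0 hsg.
pose w (i : 'I_3) : C := [:: 1; - (1 - zeta / h%:C); - (zeta / h%:C)]`_i.
pose z (i : 'I_3) : C := [:: zeta; 0; h%:C]`_i.
have sum3 (F : C -> C) : \sum_i w i * F (z i) =
   F zeta - F 0 - zeta / h%:C * (F h%:C - F 0).
  by rewrite !big_ord_recl big_ord0 /w /z /= !addr0; ring.
have := sum3 (fun z => G (theta + z *: e_ j)); rewrite scale0r addr0 => <-.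
have hz' := le_trans hz hsg; have hs' := le_trans hs hsg.
have c0 : 0 <= nc zeta ^+ 2 + nc zeta * h.
  by rewrite addr_ge0 ?mulr_ge0 ?sqr_ge0 ?nc_ge0 ?(ltW h0).
apply: (@le_trans _ _ (((nc zeta ^+ 2 + nc zeta * h) / sg ^+ 2) * M * 2 ^+ d)); last first.
  rewrite ler_wpM2r ?exprn_ge0// ler_wpM2r// ler_wpM2l// lef_pV2 ?posrE ?exprn_gt0//.
  by rewrite lerXn2r ?nnegrE ?(ltW s0) ?(ltW sg0).
apply: (@local_comb sg M G _ w (fun i => theta + z i *: e_ j) p c) => //.
- by rewrite divr_ge0 ?sqr_ge0.
- have zs (i : 'I_3) : nc (z i) <= sg.
    case: i => -[|[|[|//]]] hi; rewrite /z ![nth _ _ _]/= ?nc0 ?(ltW sg0)//.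
    by rewrite ncR_ge0 ?(ltW h0).
  have st (i : 'I_3) : strip rho (theta + z i *: e_ j).
    case: i => -[|[|[|//]]] hi; rewrite /z ![nth _ _ _]/= ?scale0r ?addr0//.
    by rewrite basis_toC; exact: strip_shift.
  move=> i; apply: hsum => // j'.
  have -> : (theta + z i *: e_ j) 0 j' - p 0 j' = (theta 0 j' - p 0 j') + z i * (j' == j)%:R.
    by rewrite !mxE eqxx addrAC.
  rewrite (le_trans (ncD _ _))// mulr2n mulrDl mul1r lerD//.
  by case: (j' == j); rewrite ?mulr1 ?mulr0 ?nc0 ?(ltW sg0).
move=> alpha.
have -> : \sum_i w i * mono p (theta + z i *: e_ j) alpha =
   ((theta 0 j - p 0 j + zeta) ^+ alpha 0 j - (theta 0 j - p 0 j) ^+ alpha 0 j -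
    zeta / h%:C * ((theta 0 j - p 0 j + h%:C) ^+ alpha 0 j - (theta 0 j - p 0 j) ^+ alpha 0 j)) *
    \prod_(i < d | i != j) (theta 0 i - p 0 i) ^+ alpha 0 i.
  rewrite (sum3 (fun z => mono p (theta + z *: e_ j) alpha)) !mono_shift addr0.
  move: (\prod_(i < d | _) _) => P; move: ((theta 0 j - p 0 j) ^+ _) => X.
  move: (_ ^+ alpha 0 j) (_ ^+ alpha 0 j) => Y Z; move: (zeta / h%:C) => q; ring.
rewrite ncM [X in _ <= _ * X](bigD1 j)//= mulrA; apply: ler_pM; rewrite ?nc_ge0//.
  by apply: cr_bound.
rewrite nc_prod; apply: ler_prod => i _; rewrite nc_ge0/= ncX.
by rewrite lerXn2r ?nnegrE ?nc_ge0// ?mulr_ge0 ?(ltW sg0)// (le_trans (hp i))// mulr2n mulrDl mul1r lerDl ltW.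
Qed.

End Bounds.
End Torus.

(** * Discrete Fourier transforms *)
Section Grid.
Variable R : realType.
Variable d : nat.
Local Notation C := R[i].
Local Notation Re := (@complex.Re R).
Local Notation Im := (@complex.Im R).
Local Notation nc := (@Normc.normc R).
Implicit Types (theta p : 'rV[C]_d) (x : 'rV[R]_d) (k : 'rV[int]_d).
Local Notation e_ j := (basis_vec R j).

(** The mesh of the grid of 2 n + 1 points per variable; an odd number of points makes
    the frequencies -n, ..., n a symmetric set of representatives. *)
Definition step (n : nat) : R := 2 * pi / (n.*2.+1)%:R.

Lemma step_gt0 n : 0 < step n.
Proof. by rewrite divr_gt0// mulr_gt0// pi_gt0. Qed.

Lemma stepN n : step n * (n.*2.+1)%:R = 2 * pi.
Proof. by rewrite divfK// pnatr_eq0. Qed.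

Definition grid (n : nat) (v : 'I_d -> nat) : 'rV[R]_d := \row_j (step n * (v j)%:R).

Definition grid_mean (n : nat) (F : {ffun 'I_d -> 'I_n.*2.+1} -> C) : C :=
  (((n.*2.+1)%:R ^+ d)^-1)%:C * \sum_j F j.

Lemma grid_mean_le n F B : (forall j, nc (F j) <= B) -> nc (@grid_mean n F) <= B.
Proof.
move=> h; rewrite /grid_mean ncM ncR_ge0 ?invr_ge0 ?exprn_ge0//.
rewrite ler_pdivrMl ?exprn_gt0//; apply: le_trans (nc_sum _ _ _) _.
apply: (@le_trans _ _ (\sum_(j : {ffun 'I_d -> 'I_n.*2.+1}) B)); first exact: ler_sum.
by rewrite sumr_const card_ffun !card_ord -[B *+ _]mulr_natl natrX.
Qed.

Lemma grid_meanZ n F (c : C) : grid_mean (fun j => c * F j) = c * @grid_mean n F.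
Proof. by rewrite /grid_mean -mulr_sumr mulrCA. Qed.

Lemma grid_meanB n F F' : grid_mean (fun j => F j - F' j) = @grid_mean n F - grid_mean F'.
Proof. by rewrite /grid_mean sumrB mulrBr. Qed.

Lemma grid_mean_sum n (T : finType) (F : T -> {ffun 'I_d -> 'I_n.*2.+1} -> C) :
  grid_mean (fun j => \sum_i F i j) = \sum_i grid_mean (F i).
Proof. by rewrite /grid_mean exchange_big mulr_sumr. Qed.

Lemma character_prod k x :
  character k (toC x) = \prod_i expC ('i%C * ((k 0 i)%:~R * x 0 i)%:C).
Proof.
rewrite characterE dot_toC rmorph_sum mulr_sumr.
exact: (big_morph _ (@expCD R) (@expC0 R)).
Qed.

Lemma expCX (z : C) n : expC z ^+ n = expC (z *+ n).
Proof. by elim: n => [|n IH]; rewrite ?expr0 ?mulr0n ?expC0// exprS IH mulrS expCD. Qed.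

Lemma expCiX (y : R) n : expC ('i%C * y%:C) ^+ n = expC ('i%C * (y * n%:R)%:C) :> C.
Proof. by rewrite expCX -mulrnAr realCM rmorph_nat mulr_natr. Qed.

Lemma character_grid k n (v : 'I_d -> nat) :
  character k (toC (grid n v)) =
  \prod_i expC ('i%C * ((k 0 i)%:~R * step n)%:C) ^+ v i.
Proof.
rewrite character_prod; apply: eq_bigr => i _; rewrite expCX mxE; congr expC.
by rewrite mulrA [X in _ * X]realCM rmorph_nat mulrA mulr_natr.
Qed.

Lemma grid_add n (v w : 'I_d -> nat) : grid n (fun i => (v i + w i)%N) = grid n v + grid n w.
Proof. by apply/rowP => i; rewrite !mxE natrD mulrDr. Qed.

Definition sample (G : 'rV[C]_d -> C) n k theta (v : 'I_d -> nat) : C :=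
  G (theta + toC (grid n v)) * character (- k) (toC (grid n v)).

(** The discrete Fourier coefficient of index k of x |-> G (theta + x). *)
Definition dft G n k theta : C := @grid_mean n (fun j => sample G n k theta (fun i => j i)).

Section PeriodicFunction.
Variables (s rho M : R) (G : 'rV[C]_d -> C).
Hypothesis s0 : 0 < s.
Hypothesis M0 : 0 <= M.
Hypothesis hper : periodic rho G.
Hypothesis hloc : forall theta, strip rho theta -> local_series s rho M G theta.

Lemma sample_mod n k theta v : strip rho theta ->
  sample G n k theta v = sample G n k theta (fun i => (v i %% n.*2.+1)%N).
Proof.
move=> ht; pose w : 'rV[int]_d := \row_i (v i %/ n.*2.+1)%N%:Z.
have e : grid n v = grid n (fun i => (v i %% n.*2.+1)%N) + (2 * pi) *: map_mx intr w.
  apply/rowP => i; rewrite !mxE -(stepN n) -mulrA -mulrDr; congr (_ * _).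
  by rewrite {1}(divn_eq (v i) n.*2.+1) natrD natrM addrC mulrC.
rewrite /sample e toCD addrA (periodic_int hper) ?characterDr; last exact: strip_shift.
suff -> : character (- k) (toC ((2 * pi) *: (map_mx intr w : 'rV[R]_d))) = 1 by rewrite mulr1.
rewrite character_prod big1// => i _.
have -> : ((- k) 0 i)%:~R * ((2 * pi) *: (map_mx intr w : 'rV[R]_d)) 0 i =
   2 * pi * ((- k) 0 i * w 0 i)%:~R :> R by rewrite !mxE intrM; ring.
exact: expC_2pi.
Qed.

(** Translation of a periodic function by a grid vector permutes the grid. *)
Lemma sample_shift n k theta (a : 'I_d -> nat) : strip rho theta ->
  @grid_mean n (fun j => sample G n k theta (fun i => (j i + a i)%N)) = dft G n k theta.
Proof.
move=> ht; rewrite /dft /grid_mean; congr (_ * _).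
pose b : {ffun 'I_d -> 'I_n.*2.+1} := [ffun i => inZp (a i)].
pose f (j : {ffun 'I_d -> 'I_n.*2.+1}) : {ffun 'I_d -> 'I_n.*2.+1} := [ffun i => j i + b i].
have fI : injective f.
  move=> j j' /ffunP h; apply/ffunP => i; have := h i; rewrite !ffunE; exact: addIr.
rewrite [RHS](reindex_inj fI) /=; apply: eq_bigr => j _.
rewrite [LHS]sample_mod// [RHS]sample_mod//; congr (sample _ _ _ _ _); apply/funext => i.
by rewrite !ffunE /= modn_mod modnDmr.
Qed.

Lemma dft_bound n k theta : strip rho theta -> nc (dft G n k theta) <= M * 2 ^+ d.
Proof.
move=> ht; apply: grid_mean_le => j; rewrite ncM nc_character_real mulr1.
by apply: (local_bound s0 M0 hloc); exact: strip_shift.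
Qed.

Definition root_step k n i : C := expC ('i%C * ((k 0 i)%:~R * step n)%:C).

(** Summation by parts: multiplying the coefficient by exp(i k_j h) - 1 amounts to
    taking a forward difference of G in the variable j. *)
Lemma dft_mixed n k theta Q (Qs : 'I_d -> nat) : strip rho theta ->
  Q%:R * step n <= s -> (forall j, (Qs j <= Q)%N) ->
  nc (dft G n k theta) * \prod_i nc (root_step k n i - 1) ^+ Qs i <=
    (\prod_j (2 * Q%:R * step n / s) ^+ Qs j) * M * 2 ^+ d.
Proof.
move=> ht hs hQ.
have -> : nc (dft G n k theta) * \prod_i nc (root_step k n i - 1) ^+ Qs i =
   nc (dft G n k theta * \prod_i (root_step k n i - 1) ^+ Qs i).
  rewrite ncM nc_prod; congr (_ * _); by apply: eq_bigr => i _; rewrite ncX.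
have -> : dft G n k theta * \prod_i (root_step k n i - 1) ^+ Qs i =
   grid_mean (fun j : {ffun 'I_d -> 'I_n.*2.+1} =>
    (\sum_(i : {ffun 'I_d -> 'I_Q.+1}) (\prod_l (dw R (Qs l) (i l))%:C) *
       G ((theta + toC (grid n (fun l => j l))) + toC (\row_l (step n * (i l)%:R)))) *
    character (- k) (toC (grid n (fun l => j l)))).
  have -> : \prod_i (root_step k n i - 1) ^+ Qs i =
     \sum_(i : {ffun 'I_d -> 'I_Q.+1}) (\prod_l (dw R (Qs l) (i l))%:C) *
       character k (toC (grid n (fun l => i l))).
    transitivity (\prod_i \sum_(a < Q.+1) (dw R (Qs i) a)%:C * root_step k n i ^+ a).
      apply: eq_bigr => i _; rewrite -dw_pow.
      rewrite (big_ord_widen Q.+1 (fun a => (dw R (Qs i) a)%:C * root_step k n i ^+ a)) ?ltnS//.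
      rewrite big_mkcond /=; apply: eq_bigr => a _.
      by case: ltnP => // h; rewrite dw_gt ?mul0r.
    rewrite bigA_distr_bigA /=; apply: eq_bigr => i _.
    by rewrite big_split /= character_grid.
  under [in RHS]eq_fun do rewrite mulr_suml.
  rewrite grid_mean_sum mulr_sumr; apply: eq_bigr => i _.
  rewrite mulrC -mulrA -(sample_shift n k (fun l => i l) ht) -!grid_meanZ.
  congr grid_mean; apply/funext => j.
  rewrite -mulrA /sample grid_add toCD addrA; congr (_ * _).
  set zi := toC (grid n (fun l => i l)); set zj := toC (grid n (fun l => j l)).
  have e : character k zi * character (- k) (zj + zi) = character (- k) zj.
    by rewrite characterDr mulrCA -characterD subrr character0 mulr1.
  by rewrite mulrCA e.
apply: grid_mean_le => j; rewrite ncM nc_character_real mulr1.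
apply: (mixed_bound s0 M0 hloc) => //; [exact: strip_shift | exact: ltW (step_gt0 n)].
Qed.

(** For |k_j h| <= pi the divisor exp(i k_j h) - 1 is at least |k_j h| / 8, and h cancels
    against the h of the difference, so 2 q differences give the factor k_j^(-2 q). No
    difference is taken in a variable with k_j = 0. *)
Lemma coord_decay (q n : nat) (kappa : int) : `|kappa%:~R * step n| <= pi :> R ->
  (2 * (q.*2)%:R * step n / s) ^+ (if kappa == 0 then 0%N else q.*2) <=
   (1 + (16 * (q.*2)%:R / s) ^+ q.*2 * 2 ^+ q) * invsq R kappa ^+ q *
    nc (expC ('i%C * (kappa%:~R * step n)%:C) - 1) ^+ (if kappa == 0 then 0%N else q.*2).
Proof.
set Q := q.*2 => hk; have [->|k0] := eqVneq kappa 0.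
  rewrite !expr0 mulr1 /invsq expr0n addr0 invr1 expr1n mulr1 lerDl.
  by rewrite mulr_ge0 ?exprn_ge0// divr_ge0 ?mulr_ge0 ?(ltW s0).
have := expCi_lower hk; set Z := nc _ => hZ.
have h0 := step_gt0 n.
have k1 : 1 <= `|kappa%:~R| :> R by rewrite -intr_norm -natr_absz ler1n absz_gt0.
have Y0 : 0 <= `|kappa%:~R * step n| / 8 by rewrite divr_ge0.
have X0 : 0 <= 16 * Q%:R / s by rewrite divr_ge0 ?(ltW s0)// mulr_ge0.
have hZQ : (`|kappa%:~R * step n| / 8) ^+ Q <= Z ^+ Q.
  by rewrite lerXn2r ?nnegrE// (le_trans Y0).
have inv : (1 / `|kappa%:~R|) ^+ Q <= 2 ^+ q * invsq R kappa ^+ q.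
  rewrite /Q -muln2 mulnC exprM -exprMn lerXn2r ?nnegrE ?sqr_ge0 ?mulr_ge0 ?invsq_ge0//.
  rewrite expr_div_n expr1n /invsq -[kappa%:~R ^+ 2]real_normK ?num_real//.
  have y1 : 1 <= `|kappa%:~R| ^+ 2 :> R by rewrite exprn_ege1.
  move: (`|kappa%:~R| ^+ 2) y1 => Y Y1.
  rewrite ler_pdivrMr; last by lra.
  by rewrite mulrAC ler_pdivlMr; lra.
apply: (@le_trans _ _ ((16 * Q%:R / s) ^+ Q * (1 / `|kappa%:~R|) ^+ Q * (`|kappa%:~R * step n| / 8) ^+ Q)).
  rewrite -!exprMn le_eqVlt; apply/orP; left; apply/eqP; congr (_ ^+ _).
  rewrite normrM (gtr0_norm h0); field.
  by rewrite (gt_eqF s0) (gt_eqF (lt_le_trans ltr01 k1)).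
apply: ler_pM; [|exact: exprn_ge0| |exact: hZQ].
  by apply: mulr_ge0; apply: exprn_ge0 => //; rewrite divr_ge0.
apply: (@le_trans _ _ ((16 * Q%:R / s) ^+ Q * (2 ^+ q * invsq R kappa ^+ q))).
  by rewrite ler_wpM2l ?exprn_ge0.
by rewrite mulrA ler_wpM2r ?exprn_ge0 ?invsq_ge0// lerDr.
Qed.

Definition decay_const (q : nat) : R := 1 + (16 * (q.*2)%:R / s) ^+ q.*2 * 2 ^+ q.

Lemma decay_const_ge0 q : 0 <= decay_const q.
Proof.
by rewrite /decay_const addr_ge0// mulr_ge0 ?exprn_ge0// divr_ge0 ?mulr_ge0 ?(ltW s0).
Qed.

Lemma dft_decay (q n : nat) k theta : strip rho theta ->
  (q.*2)%:R * step n <= s -> (forall i, (`|k 0%R i| <= n)%N) ->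
  nc (dft G n k theta) <= M * 2 ^+ d * \prod_i (decay_const q * invsq R (k 0 i) ^+ q).
Proof.
move=> ht hs hk; have h0 := step_gt0 n.
have hpi i : `|(k 0 i)%:~R * step n| <= pi.
  rewrite normrM (gtr0_norm h0) -intr_norm -natr_absz.
  apply: (@le_trans _ _ (n%:R * step n)); first by rewrite ler_wpM2r ?(ltW h0)// ler_nat.
  rewrite /step mulrA ler_pdivrMr// mulrC -mulrA -subr_ge0.
  have -> : pi * (n.*2.+1)%:R - 2 * (pi * n%:R) = pi :> R.
    by rewrite -natr1 -muln2 natrM; ring.
  exact: pi_ge0.
pose Qs i : nat := if k 0 i == 0 then 0%N else q.*2.
have hQs i : (Qs i <= q.*2)%N by rewrite /Qs; case: eqP.
have hm := dft_mixed k ht hs hQs.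
pose Z i := nc (root_step k n i - 1) ^+ Qs i.
have Z0 i : 0 < Z i.
  rewrite /Z /Qs; case: eqVneq => [_|ki]; first by rewrite expr0.
  rewrite exprn_gt0//; apply: lt_le_trans (expCi_lower (hpi i)).
  by rewrite divr_gt0// normr_gt0 mulf_neq0 ?intr_eq0// gt_eqF.
have PZ : 0 < \prod_i Z i by apply: prodr_gt0.
rewrite -(ler_pM2r PZ); apply: le_trans hm _.
rewrite -mulrA [leLHS]mulrC -[leRHS]mulrA ler_wpM2l ?mulr_ge0 ?exprn_ge0//.
rewrite -big_split /=; apply: ler_prod => i _.
rewrite exprn_ge0/=; first exact: coord_decay.
apply: divr_ge0; last exact: ltW.
by apply: mulr_ge0; [rewrite mulr_ge0 | exact: ltW].
Qed.

(** By [sample_shift] the coefficient at theta + h e_j is exp(i k_j h) times that at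
    theta, so the discrete Cauchy-Riemann equation relates the coefficients at
    theta + zeta e_j and at theta. *)
Lemma dft_cr n k theta (zeta : C) j : strip rho theta ->
  strip rho (theta + zeta *: e_ j) -> nc zeta <= s -> step n <= s ->
  nc (dft G n k (theta + zeta *: e_ j) - dft G n k theta -
      zeta / (step n)%:C * (root_step k n j - 1) * dft G n k theta) <=
   ((nc zeta ^+ 2 + nc zeta * step n) / s ^+ 2) * M * 2 ^+ d.
Proof.
move=> ht ht' hz hs.
have e1 : root_step k n j * dft G n k theta = @grid_mean n (fun v =>
   G (theta + toC (grid n (fun i => v i)) + (step n)%:C *: e_ j) * character (- k) (toC (grid n (fun i => v i)))).
  pose a (i : 'I_d) : nat := i == j.
  rewrite -(sample_shift n k a ht) -grid_meanZ; congr grid_mean; apply/funext => v.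
  have ga : grid n a = step n *: (delta_mx 0 j : 'rV[R]_d).
    by apply/rowP => i; rewrite !mxE eqxx /a; case: (i == j).
  have ra : root_step k n j = character k (toC (grid n a)).
    rewrite character_grid (bigD1 j)//= /a eqxx expr1 big1 ?mulr1// => i /negbTE ->.
    by rewrite expr0.
  rewrite ra /sample grid_add toCD addrA basis_toC -ga mulrCA; congr (_ * _).
  by rewrite characterDr mulrCA -characterD subrr character0 mulr1.
have -> : dft G n k (theta + zeta *: e_ j) - dft G n k theta -
      zeta / (step n)%:C * (root_step k n j - 1) * dft G n k theta =
  @grid_mean n (fun v => let th := theta + toC (grid n (fun i => v i)) in
    (G (th + zeta *: e_ j) - G th - zeta / (step n)%:C * (G (th + (step n)%:C *: e_ j) - G th)) *
     character (- k) (toC (grid n (fun i => v i)))).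
  rewrite -mulrA mulrBl e1 mul1r /dft -!grid_meanB -grid_meanZ -grid_meanB.
  congr grid_mean; apply/funext => v /=; rewrite /sample [theta + zeta *: _ + _]addrAC; ring.
apply: grid_mean_le => v /=; rewrite ncM nc_character_real mulr1.
apply: (cauchy_riemann s0 M0 hloc) => //; last exact: step_gt0.
  exact: strip_shift.
by rewrite [theta + _ + _]addrAC; exact: strip_shift.
Qed.

End PeriodicFunction.

(** Orthogonality of the roots of unity of order 2 n + 1. *)
Lemma sum_roots n (b : 'I_n.*2.+1) :
  \sum_(a < n.*2.+1) expC ('i%C * ((n%:Z - a%:Z)%:~R * (step n * b%:R))%:C) =
   (if b == ord0 then (n.*2.+1)%:R else 0 : C).
Proof.
case: eqP => [->|/eqP b0].
  under eq_bigr do rewrite !mulr0 expC0.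
  by rewrite sumr_const card_ord.
pose z : C := expC ('i%C * (- (step n * b%:R))%:C).
have e (a : 'I_n.*2.+1) : expC ('i%C * ((n%:Z - a%:Z)%:~R * (step n * b%:R))%:C) =
    expC ('i%C * (n%:R * (step n * b%:R))%:C) * z ^+ a.
  rewrite /z expCiX -expCD -mulrDr -realCD; congr (expC (_ * _%:C)).
  by rewrite rmorphB /=; ring.
under eq_bigr do rewrite e.
rewrite -mulr_sumr.
have zN : z ^+ n.*2.+1 = 1.
  rewrite /z expCiX.
  have -> : - (step n * b%:R) * (n.*2.+1)%:R = 2 * pi * (- b%:Z)%:~R :> R.
    by rewrite -(stepN n) rmorphN /=; ring.
  exact: expC_2pi.
have z1 : z != 1.
  apply/eqP => h.
  have hb : (0 < b < n.*2.+1)%N by rewrite ltn_ord lt0n andbT.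
  have [y [y0 hy yz]] : exists y : R, [/\ y != 0, `|y| <= pi & expC ('i%C * y%:C) = 1].
    have sN := stepN n; have s00 := step_gt0 n.
    have [bn|nb] := leqP b n.
      exists (- (step n * b%:R)); split; last exact: h.
        by rewrite oppr_eq0 mulf_neq0 ?gt_eqF// ltr0n; case/andP: hb.
      rewrite normrN ger0_norm; last by apply: mulr_ge0; [exact: ltW|].
      rewrite -(ler_pM2l (@ltr0Sn R 1)) -sN mulrCA ler_pM2l// -natrM ler_nat; lia.
    exists (2 * pi - step n * b%:R); split.
    - by rewrite -sN -mulrBr mulf_neq0 ?gt_eqF ?subr_gt0 ?ltr_nat.
    - rewrite -sN -mulrBr ger0_norm; last first.
        by apply: mulr_ge0; [exact: ltW | rewrite subr_ge0 ler_nat ltnW].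
      rewrite -(ler_pM2l (@ltr0Sn R 1)) -sN mulrCA ler_pM2l// -natrB; last exact: ltnW.
      rewrite -natrM ler_nat; lia.
    - rewrite realCD mulrDr expCD -/z h mulr1.
      by have := expC_2pi R 1; rewrite mulr1.
  have := expCi_lower hy; rewrite yz subrr nc0 => h0.
  have : 0 < `|y| / 8 by rewrite divr_gt0 ?normr_gt0.
  by rewrite ltNge h0.
have : (z - 1) * \sum_(a < n.*2.+1) z ^+ a = 0 by rewrite -subrX1 zN subrr.
by move=> /eqP; rewrite mulf_eq0 subr_eq0 (negbTE z1) /= => /eqP ->; rewrite mulr0.
Qed.

(** The frequencies of the grid of parameter n: the vectors with entries in -n, ..., n. *)
Definition box_index n (kappa : {ffun 'I_d -> 'I_n.*2.+1}) : 'rV[int]_d :=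
  \row_i ((kappa i)%:Z - n%:Z).

Lemma box_index_inj n : injective (@box_index n).
Proof.
move=> a b /rowP h; apply/ffunP => i; apply: val_inj; have := h i; rewrite !mxE.
by move/addIr => [].
Qed.

Lemma dft_inversion G n theta :
  \sum_(kappa : {ffun 'I_d -> 'I_n.*2.+1}) dft G n (box_index kappa) theta = G theta.
Proof.
rewrite /dft -grid_mean_sum /grid_mean.
have e (j : {ffun 'I_d -> 'I_n.*2.+1}) :
  \sum_(kappa : {ffun 'I_d -> 'I_n.*2.+1}) sample G n (box_index kappa) theta (fun i => j i) =
  G (theta + toC (grid n (fun i => j i))) * \prod_i (if j i == ord0 then (n.*2.+1)%:R else 0).
  rewrite /sample -mulr_sumr; congr (_ * _).
  under [RHS]eq_bigr do rewrite -sum_roots.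
  rewrite bigA_distr_bigA /=; apply: eq_bigr => kappa _.
  rewrite character_prod; apply: eq_bigr => i _; congr (expC (_ * _%:C)).
  by rewrite !mxE opprB.
under eq_bigr do rewrite e.
rewrite (bigD1 [ffun=> ord0])//= [X in _ + X]big1 ?addr0; last first.
  move=> j j0; have [i hi] : exists i, j i != ord0.
    apply/existsP; rewrite -negb_forall; apply: contra j0 => /forallP h.
    by apply/eqP/ffunP => i; rewrite ffunE; apply/eqP.
  by rewrite (bigD1 i)//= (negbTE hi) mul0r mulr0.
under eq_bigr do rewrite ffunE eqxx.
rewrite prodr_const card_ord.
have -> : grid n (fun i : 'I_d => ([ffun=> ord0] : {ffun 'I_d -> 'I_n.*2.+1}) i : nat) = 0.
  by apply/rowP => i; rewrite !mxE ffunE mulr0.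
rewrite (_ : toC 0 = 0) ?addr0; last by rewrite /toC map_mx0.
have -> : (n.*2.+1)%:R ^+ d = ((n.*2.+1)%:R ^+ d : R)%:C :> C.
  by rewrite realCX rmorph_nat.
by rewrite mulrCA -realCM mulVf ?mulr1// expf_neq0// pnatr_eq0.
Qed.

End Grid.

(** * Fourier series of analytic functions on the strip *)
Section TorusTheorem.
Variable R : realType.
Variable d : nat.
Local Notation C := R[i].
Local Notation Re := (@complex.Re R).
Local Notation Im := (@complex.Im R).
Local Notation nc := (@Normc.normc R).
Implicit Types (theta p : 'rV[C]_d) (x : 'rV[R]_d) (k : 'rV[int]_d).
Local Notation e_ j := (basis_vec R j).

Lemma le_of_le_addM (x y K : R) : 0 <= K -> (forall e, 0 < e -> x <= y + e * K) -> x <= y.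
Proof.
move=> K0 h; apply/ler_addgt0Pr => e e0.
apply: le_trans (h (e / (K + 1)) _) _; first by rewrite divr_gt0// ltr_wpDl.
rewrite lerD2l mulrAC ler_pdivrMr ?ltr_wpDl//.
by rewrite ler_wpM2l ?(ltW e0)// lerDl.
Qed.

Lemma step_small (e : R) : 0 < e -> \forall n \near \oo, step R n <= e.
Proof.
move=> e0; have := nbhs_infty_ger (2 * pi / e); apply: filterS => n h.
rewrite /step ler_pdivrMr// [leRHS]mulrC -ler_pdivrMr//.
by apply: le_trans h _; rewrite ler_nat; lia.
Qed.

Lemma invsq_le1 (k : int) : invsq R k <= 1.
Proof. by rewrite /invsq invf_le1 ?lerDl ?sqr_ge0// ltr_pwDl// sqr_ge0. Qed.

Lemma dot_basis k j (z : C) : dot k (z *: e_ j) = z * (k 0 j)%:~R.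
Proof.
rewrite dotZr; congr (_ * _); rewrite /dot (bigD1 j)//= big1 => [|i /negbTE ij].
  by rewrite mxE !eqxx mulr1 addr0.
by rewrite mxE eqxx ij mulr0.
Qed.

Variables (s rho M : R) (G : 'rV[C]_d -> C) (q : nat).
Hypothesis s0 : 0 < s.
Hypothesis rho0 : 0 <= rho.
Hypothesis M0 : 0 <= M.
Hypothesis q0 : (0 < q)%N.
Hypothesis hper : periodic rho G.
Hypothesis hloc : forall theta, strip rho theta -> local_series s rho M G theta.

(** The bound of [dft_decay]; its sum over k is finite and uniform in the mesh. *)
Definition coef_bound k : R := M * 2 ^+ d * \prod_i (decay_const s q * invsq R (k 0 i) ^+ q).

Lemma sum_le_coef_bound :
  sum_le coef_bound (M * 2 ^+ d * (decay_const s q * 6) ^+ d).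
Proof.
have D0 := decay_const_ge0 s0 q.
apply: sum_leZ; first by rewrite mulr_ge0 ?exprn_ge0.
have h1 (j : 'I_d) (t : int) : 0 <= decay_const s q * invsq R t ^+ q.
  by rewrite mulr_ge0 ?exprn_ge0 ?invsq_ge0.
have h2 (j : 'I_d) : sum_le (fun t : int => decay_const s q * invsq R t ^+ q) (decay_const s q * 6).
  apply: sum_leW (sum_leZ D0 (@sum_le_invsq R)) => // t; rewrite ler_wpM2l//.
  by rewrite -{2}[invsq R t]expr1 ler_wiXn2l ?invsq_ge0 ?invsq_le1.
have := @sum_le_rV R int d (fun _ t => decay_const s q * invsq R t ^+ q) (fun=> decay_const s q * 6) h1 h2.
by rewrite prodr_const card_ord.
Qed.

Section LimitCoefficients.
Variable U : set_system nat.
Hypothesis HU : UltraFilter U.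
Hypothesis Uoo : \oo `<=` U.
Let PU : ProperFilter U := @ultra_proper _ _ HU.
Local Existing Instance PU.

Variable E : 'rV[int]_d -> 'rV[C]_d -> C.
Hypothesis hE : forall k theta, strip rho theta -> clim U (fun n => dft G n k theta) (E k theta).

Let B0 : R := M * 2 ^+ d.
Let B0_ge0 : 0 <= B0. Proof. by rewrite mulr_ge0 ?exprn_ge0. Qed.

Lemma E_bound k theta : strip rho theta -> nc (E k theta) <= B0.
Proof.
move=> ht; apply: (clim_le HU (hE k ht)); apply: filterE => n.
exact: (dft_bound s0 M0 hloc).
Qed.

Lemma E_decay k theta : strip rho theta -> nc (E k theta) <= coef_bound k.
Proof.
move=> ht; apply: (clim_le HU (hE k ht)); apply: Uoo.
have e0 : 0 < s / ((q.*2)%:R + 1) by rewrite divr_gt0// ltr_wpDl.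
near=> n; apply: (dft_decay s0 M0 hper hloc) => //.
  have : step R n <= s / ((q.*2)%:R + 1) by near: n; exact: step_small.
  rewrite ler_pdivlMr ?ltr_wpDl// mulrDr mulr1 => h.
  by rewrite mulrC; apply: le_trans h; rewrite lerDl ltW// step_gt0.
move=> i; apply: leq_trans (norm1_ge k i) _; near: n; exact: nbhs_infty_ge.
Unshelve. all: by end_near. Qed.

Lemma nc_intr (z : int) : nc (z%:~R : C) = `|z%:~R|.
Proof. by rewrite (_ : z%:~R = (z%:~R : R)%:C :> C) ?ncR// rmorph_int. Qed.

(** The limit of [dft_cr] as h tends to 0, where (exp(i k_j h) - 1) / h tends to i k_j. *)
Lemma E_cr k theta (zeta : C) j : strip rho theta ->
  strip rho (theta + zeta *: e_ j) -> nc zeta <= s ->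
  nc (E k (theta + zeta *: e_ j) - E k theta - 'i%C * (k 0 j)%:~R * zeta * E k theta) <=
    nc zeta ^+ 2 * (B0 / s ^+ 2).
Proof.
move=> ht ht' hz; set kap : C := (k 0 j)%:~R; set Z := nc zeta.
have Z0 : 0 <= Z := nc_ge0 zeta.
pose A := nc kap; have A0 : 0 <= A := nc_ge0 kap.
apply: (@le_of_le_addM _ _ (1 + (1 + A * Z) + Z * B0 / s ^+ 2 + 2 * Z * A ^+ 2 * B0)).
  have t1 : 0 <= Z * B0 / s ^+ 2 by rewrite divr_ge0 ?sqr_ge0 ?mulr_ge0.
  have t2 : 0 <= 2 * Z * A ^+ 2 * B0 by rewrite !mulr_ge0 ?sqr_ge0.
  have t3 : 0 <= A * Z by rewrite mulr_ge0.
  by lra.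
move=> e e0.
have ms : 0 < Num.min e s by rewrite lt_min e0 s0.
have nearh : \forall n \near U, step R n <= Num.min e s by apply: Uoo; exact: step_small.
have [n [[h1 h2] h3]] := filter_ex (filterI (filterI (hE k ht e0) (hE k ht' e0)) nearh).
move: h3; rewrite le_min => /andP[he hs].
have st := step_gt0 R n.
set a := dft G n k (theta + zeta *: e_ j) in h2 *; set b := dft G n k theta in h1 *.
set h := step R n in he hs st *.
have hC : h%:C != 0 :> C by rewrite (inj_eq (@complexI R)) gt_eqF.
set r := root_step R k n j.
have cr : nc (a - b - zeta / h%:C * (r - 1) * b) <= ((Z ^+ 2 + Z * h) / s ^+ 2) * B0.
  by rewrite /B0 [leRHS]mulrA; apply: (dft_cr s0 M0 hper hloc).
have kapE : kap = ((k 0 j)%:~R : R)%:C by rewrite /kap rmorph_int.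
have hr : nc (r - 1 - 'i%C * kap * h%:C) <= 2 * (A * h) ^+ 2.
  have -> : 'i%C * kap * h%:C = 'i%C * ((k 0 j)%:~R * h)%:C by rewrite kapE -mulrA -realCM.
  apply: le_trans (expCi_quad _) _; rewrite ler_wpM2l//.
  have AE : A = `|(k 0 j)%:~R| by rewrite /A kapE ncR.
  by rewrite AE !exprMn real_normK ?num_real.
have bB : nc b <= B0 by exact: (dft_bound s0 M0 hloc).
have -> : E k (theta + zeta *: e_ j) - E k theta - 'i%C * kap * zeta * E k theta =
  (E k (theta + zeta *: e_ j) - a) - (E k theta - b) * (1 + 'i%C * kap * zeta) +
  (a - b - zeta / h%:C * (r - 1) * b) + zeta / h%:C * (r - 1 - 'i%C * kap * h%:C) * b.
  by field.
apply: le_trans (ncD _ _) _; apply: le_trans (lerD (ncD _ _) (lexx _)) _.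
apply: le_trans (lerD (lerD (ncB _ _) (lexx _)) (lexx _)) _.
have b2 : nc ((E k theta - b) * (1 + 'i%C * kap * zeta)) <= e * (1 + A * Z).
  rewrite ncM; apply: ler_pM; rewrite ?nc_ge0 ?(ltW h1)//.
  apply: le_trans (ncD _ _) _; rewrite nc1 lerD2l [nc ('i%C * _ * _)]ncM.
  by rewrite [nc ('i%C * _)]ncM nci mul1r.
have b3 : nc (zeta / h%:C * (r - 1 - 'i%C * kap * h%:C) * b) <= (2 * Z * A ^+ 2 * B0) * e.
  rewrite ncM ncM ncM ncV ncR_ge0 ?(ltW st)//.
  apply: (@le_trans _ _ (Z / h * (2 * (A * h) ^+ 2) * B0)).
    apply: ler_pM; rewrite ?mulr_ge0 ?nc_ge0 ?invr_ge0 ?(ltW st)//.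
    by rewrite ler_wpM2l ?mulr_ge0 ?invr_ge0 ?(ltW st).
  have -> : Z / h * (2 * (A * h) ^+ 2) * B0 = (2 * Z * A ^+ 2 * B0) * h by field; rewrite gt_eqF.
  by rewrite ler_wpM2l// !mulr_ge0 ?sqr_ge0.
have b4 : (Z ^+ 2 + Z * h) / s ^+ 2 * B0 <= Z ^+ 2 * (B0 / s ^+ 2) + e * (Z * B0 / s ^+ 2).
  have -> : (Z ^+ 2 + Z * h) / s ^+ 2 * B0 = Z ^+ 2 * (B0 / s ^+ 2) + h * (Z * B0 / s ^+ 2).
    by field; rewrite gt_eqF.
  by rewrite lerD2l ler_wpM2r// divr_ge0 ?sqr_ge0 ?mulr_ge0.
apply: le_trans (lerD (lerD (lerD (ltW h2) b2) (le_trans cr b4)) b3) _.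
rewrite le_eqVlt; apply/orP; left; apply/eqP; ring.
Qed.

(** To be shown constant on the strip, which means that E k is a multiple of a character. *)
Definition phase k theta := character (- k) theta * E k theta.

(** By [E_cr] the derivative of the phase in every complex coordinate direction vanishes,
    with a uniform second-order remainder. The constants 4, 10 and 21 bound exp w and its
    Taylor remainders for |w| <= 1 / 2. *)
Lemma phase_quad k : exists2 K : R, 0 <= K & exists2 delta, 0 < delta &
  forall theta zeta j, strip rho theta -> strip rho (theta + zeta *: e_ j) -> nc zeta <= delta ->
  nc (phase k (theta + zeta *: e_ j) - phase k theta) <= K * nc zeta ^+ 2.
Proof.
pose N : R := (norm1 k)%:R; have N0 : 0 <= N by [].
pose X : R := expR (rho * N); have X0 : 0 <= X := expR_ge0 _.
exists (X * (4 * (B0 / s ^+ 2) + B0 * (21 * N ^+ 2))).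
  have c1 : 0 <= 4 * (B0 / s ^+ 2) by apply: mulr_ge0 => //; apply: divr_ge0 => //; exact: sqr_ge0.
  have c2 : 0 <= B0 * (21 * N ^+ 2) by apply: mulr_ge0 => //; apply: mulr_ge0 => //; exact: sqr_ge0.
  by apply: mulr_ge0 => //; exact: addr_ge0.
pose delta := Num.min s (1 / (2 * (N + 1))).
have d1 : 0 < 1 / (2 * (N + 1)) by rewrite divr_gt0// mulr_gt0// ltr_wpDl.
exists delta; first by rewrite lt_min s0.
move=> theta zeta j ht ht' hz; move: hz; rewrite le_min => /andP[hz hz'].
set w := 'i%C * (zeta * (- (k 0 j)%:~R)).
have ew : character (- k) (theta + zeta *: e_ j) = character (- k) theta * expC w.
  by rewrite characterDr; congr (_ * _); rewrite characterE dot_basis mxE rmorphN.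
have Z0 := nc_ge0 zeta; set Z := nc zeta in hz hz' Z0 *.
have kN : nc ((k 0 j)%:~R : C) <= N.
  by rewrite nc_intr -intr_norm -natr_absz ler_nat norm1_ge.
have wE : nc w = Z * nc ((k 0 j)%:~R : C) by rewrite ncM nci mul1r ncM ncN.
have wN : nc w <= Z * N by rewrite wE ler_wpM2l.
have w12 : nc w <= 1 / 2.
  apply: le_trans wN _; move: hz'; rewrite ler_pdivlMr; last by rewrite mulr_gt0// ltr_wpDl.
  by nra.
have q1 := expC_quad w12.
have wsq : nc w ^+ 2 <= Z ^+ 2 * N ^+ 2 by rewrite -exprMn lerXn2r ?nnegrE ?nc_ge0 ?mulr_ge0.
have hcr := E_cr k ht ht' hz.
have hb := E_bound k ht.
rewrite /phase ew.
set E1 := E k (_ + _) in hcr *; set E2 := E k theta in hcr hb *.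
have -> : character (- k) theta * expC w * E1 - character (- k) theta * E2 =
  character (- k) theta * (expC w * (E1 - E2 - 'i%C * (k 0 j)%:~R * zeta * E2) +
     E2 * ((expC w - 1 - w) * (1 - w) - w ^+ 2)) by rewrite /w; ring.
rewrite ncM -[leRHS]mulrA; apply: ler_pM; rewrite ?nc_ge0//.
  by have := nc_character_strip (- k) ht; rewrite norm1N.
apply: le_trans (ncD _ _) _; rewrite ncM [nc (E2 * _)]ncM.
have b1 : nc (expC w) <= 4.
  rewrite (_ : expC w = (expC w - 1 - w) + 1 + w); last by ring.
  apply: le_trans (ncD _ _) _; apply: le_trans (lerD (ncD _ _) (lexx _)) _.
  rewrite nc1; have := nc_ge0 w; move: (nc w) w12 q1 => W w12 q1 W0.
  by apply: le_trans (lerD (lerD q1 (lexx _)) (lexx _)) _; rewrite expr2; nra.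
have b2 : nc ((expC w - 1 - w) * (1 - w) - w ^+ 2) <= 21 * (Z ^+ 2 * N ^+ 2).
  apply: le_trans (ncB _ _) _; rewrite ncM ncX.
  have b3 : nc (1 - w) <= 2 by apply: le_trans (ncB _ _) _; rewrite nc1; lra.
  have b4 : nc (expC w - 1 - w) * nc (1 - w) <= 10 * nc w ^+ 2 * 2.
    by apply: ler_pM; rewrite ?nc_ge0.
  by lra.
have b5 : nc (expC w) * nc (E1 - E2 - 'i%C * (k 0 j)%:~R * zeta * E2) <= 4 * (Z ^+ 2 * (B0 / s ^+ 2)).
  by apply: ler_pM; rewrite ?nc_ge0.
have b6 : nc E2 * nc ((expC w - 1 - w) * (1 - w) - w ^+ 2) <= B0 * (21 * (Z ^+ 2 * N ^+ 2)).
  by apply: ler_pM; rewrite ?nc_ge0.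
apply: le_trans (lerD b5 b6) _.
rewrite le_eqVlt; apply/orP; left; apply/eqP; ring.
Qed.

Lemma strip_segment theta (zeta : C) j (t : R) : 0 <= t <= 1 -> strip rho theta ->
  strip rho (theta + zeta *: e_ j) -> strip rho (theta + (t%:C * zeta) *: e_ j).
Proof.
move=> /andP[t0 t1] h1 h2 i; have := h1 i; have := h2 i; rewrite !mxE eqxx /=.
case: (i == j); last by rewrite !mulr0 addr0.
rewrite !mulr1 !ImD ImM /= mul0r addr0.
move: (Im (theta 0 i)) (Im zeta) => a b; rewrite !ler_norml => /andP[? ?] /andP[? ?].
by apply/andP; split; nra.
Qed.

(** Cut the segment into n equal parts: the increments add up to at most n O(1 / n^2). *)
Lemma phase_edge k theta zeta j : strip rho theta -> strip rho (theta + zeta *: e_ j) ->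
  phase k (theta + zeta *: e_ j) = phase k theta.
Proof.
move=> ht ht'; have [K K0 [delta dl0 hK]] := phase_quad k.
apply/eqP; rewrite -subr_eq0; apply/eqP; apply: nc_eq0.
have Z0 := nc_ge0 zeta; set Z := nc zeta in Z0 *.
apply: (@le_of_le_addM _ _ (K * Z)) => [|e e0]; first by rewrite mulr_ge0.
rewrite add0r.
have me : 0 < Num.min e delta by rewrite lt_min e0.
have [n n1] : exists n, Z / n.+1%:R <= Num.min e delta.
  have [n hn] : exists n, Z / Num.min e delta <= n%:R.
    by exists (Num.bound (Z / Num.min e delta)); rewrite ltW// archi_boundP// divr_ge0// ltW.
  exists n; rewrite ler_pdivrMr// mulrC -ler_pdivrMr//.
  by apply: le_trans hn _; rewrite ler_nat.
move: n1; rewrite le_min => /andP[n1 n2].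
pose pt i := theta + (((i%:R / n.+1%:R) : R)%:C * zeta) *: e_ j.
have st i : (i <= n.+1)%N -> strip rho (pt i).
  move=> hi; apply: strip_segment => //; rewrite divr_ge0//= ler_pdivrMr// mul1r ler_nat//.
have edge i : (i < n.+1)%N -> nc (phase k (pt i.+1) - phase k (pt i)) <= K * (Z / n.+1%:R) ^+ 2.
  move=> hi; pose dz : C := ((1 / n.+1%:R) : R)%:C * zeta.
  have e1 : pt i.+1 = pt i + dz *: e_ j.
    rewrite /pt /dz -addrA -scalerDl; congr (_ + _ *: _).
    by rewrite -mulrDl -realCD -mulrDl -natr1.
  have ndz : nc dz = Z / n.+1%:R.
    by rewrite /dz ncM ncR_ge0 ?divr_ge0// mul1r mulrC.
  rewrite e1 -ndz; apply: hK; rewrite ?ndz//; first exact: st (ltnW hi).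
  by rewrite -e1; exact: st.
have tele m : (m <= n.+1)%N -> nc (phase k (pt m) - phase k theta) <= m%:R * (K * (Z / n.+1%:R) ^+ 2).
  elim: m => [|m IH] hm; first by rewrite /pt mul0r mul0r scale0r addr0 subrr nc0 mul0r.
  rewrite (_ : _ - _ = (phase k (pt m.+1) - phase k (pt m)) + (phase k (pt m) - phase k theta)); last by ring.
  apply: le_trans (ncD _ _) _; apply: le_trans (lerD (edge _ hm) (IH (ltnW hm))) _.
  by rewrite -[m.+1%:R]natr1 mulrDl mul1r addrC.
have := tele n.+1 (leqnn _).
rewrite /pt divff ?pnatr_eq0// mul1r => h; apply: le_trans h _.
have -> : n.+1%:R * (K * (Z / n.+1%:R) ^+ 2) = (Z / n.+1%:R) * (K * Z).
  by have : n.+1%:R != 0 :> R by []; move: (n.+1%:R) => N nz; field.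
by rewrite ler_wpM2r ?mulr_ge0.
Qed.

(** Join 0 to theta through the points whose first coordinates are those of theta and the
    others 0. *)
Lemma phase_const k theta : strip rho theta -> phase k theta = phase k 0.
Proof.
move=> ht; pose tr m : 'rV[C]_d := \row_i (if (i < m)%N then theta 0 i else 0).
have st m : strip rho (tr m).
  move=> i; rewrite mxE; case: ifP => _; [exact: ht | by rewrite /= normr0].
have step m : phase k (tr m) = phase k 0.
  elim: m => [|m IH].
    by congr phase; apply/rowP => i; rewrite !mxE.
  have [dm|md] := leqP d m.
    rewrite -IH; congr phase; apply/rowP => i; rewrite !mxE.
    by rewrite (leq_trans (ltn_ord i) dm) (leq_trans (ltn_ord i) (leqW dm)).
  pose j := Ordinal md.
  have e1 : tr m.+1 = tr m + theta 0 j *: e_ j.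
    apply/rowP => i; rewrite !mxE eqxx /= ltnS leq_eqVlt.
    have -> : (i == j) = (nat_of_ord i == m) by [].
    case: eqP => [im|_] /=; last by rewrite mulr0 addr0.
    by rewrite im ltnn add0r mulr1; congr (theta 0 _); apply: val_inj.
  by rewrite e1 phase_edge ?IH// -e1.
have := step d; congr (phase k _ = _).
by apply/rowP => i; rewrite mxE ltn_ord.
Qed.

Lemma strip0 : strip rho (0 : 'rV[C]_d).
Proof. by move=> i; rewrite mxE /= normr0. Qed.

Lemma E_character k theta : strip rho theta -> E k theta = E k 0 * character k theta.
Proof.
move=> ht; have := phase_const k ht; rewrite /phase.
have -> : character (- k) (0 : 'rV[C]_d) = 1.
  by rewrite characterE /dot big1 ?mulr0 ?expC0// => i _; rewrite !mxE mulr0.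
rewrite mul1r => <-.
rewrite mulrC mulrA -characterD subrr character0 mul1r//.
Qed.

(** Evaluate the decay of E k at the point of the strip, of imaginary part -rho sgn k_j in
    each coordinate, at which the character of index k has modulus exp(rho |k|). *)
Lemma E_coef_bound k : nc (E k 0) * expR (rho * (norm1 k)%:R) <= coef_bound k.
Proof.
pose th : 'rV[C]_d := \row_i (0 +i* (- rho * Num.sg (k 0 i)%:~R)).
have st : strip rho th.
  move=> i; rewrite mxE /= normrM normrN (ger0_norm rho0) ler_piMr//.
  by rewrite normr_sg lern1 leq_b1.
have := E_decay k st; rewrite (E_character k st) ncM nc_character.
have -> : - Im (dot k th) = rho * (norm1 k)%:R => //.
rewrite /dot (big_morph Im (id1:=0) (op1:=+%R)) //; last by move=> ? ?; exact: ImD.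
rewrite /norm1 natr_sum mulr_sumr -sumrN; apply: eq_bigr => i _.
rewrite mxE ImM /= mulr0 addr0.
have -> : Re (k 0 i)%:~R = (k 0 i)%:~R.
  by rewrite (_ : (k 0 i)%:~R = ((k 0 i)%:~R : R)%:C :> C)// rmorph_int.
rewrite natr_absz intr_norm normrEsg; ring.
Qed.

(** For each n the finite inversion formula sums the discrete coefficients to G theta;
    the passage to the limit is dominated by [coef_bound]. *)
Lemma E_series theta : strip rho theta -> has_sum (fun k => E k theta) (G theta).
Proof.
move=> ht.
(* The discrete coefficients, extended by 0 outside of the frequencies of the grid. *)
pose bx n := [fset @box_index d n kap | kap in {ffun 'I_d -> 'I_n.*2.+1}]%fset.
pose a n k := if k \in bx n then dft G n k theta else 0.
apply: (@Tannery R _ nat U PU a _ coef_bound _ _ sum_le_coef_bound).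
- apply: Uoo.
  have e0 : 0 < s / ((q.*2)%:R + 1) by rewrite divr_gt0// ltr_wpDl.
  apply: filterS (step_small e0) => n hn; split.
    move=> k; rewrite /a; case: ifP => [/imfsetP /= [kap _ ->]|_]; last first.
      rewrite nc0; apply: le_trans (nc_ge0 _) (E_decay k ht).
    apply: (dft_decay s0 M0 hper hloc) => //.
      move: hn; rewrite ler_pdivlMr ?ltr_wpDl// mulrDr mulr1 => h.
      by rewrite mulrC; apply: le_trans h; rewrite lerDl ltW// step_gt0.
    move=> i; rewrite mxE; have := ltn_ord (kap i); lia.
  have -> : G theta = \sum_(k <- bx n) a n k.
    rewrite -(dft_inversion G n theta) /bx big_imfset /=; last first.
      by move=> x y _ _; exact: box_index_inj.
    rewrite big_enum /=; apply: eq_bigr => kap _; rewrite /a.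
    by have -> : box_index kap \in bx n by apply/imfsetP; exists kap.
  by apply: has_sum_supp => k /negbTE; rewrite /a => ->.
- move=> k e e0.
  have nk : \forall n \near U, (norm1 k <= n)%N by apply: Uoo; exact: nbhs_infty_ge.
  apply: filterS2 nk (hE k ht e0) => n hn; rewrite /a.
  suff -> : k \in bx n by [].
  apply/imfsetP => /=; exists [ffun i => inord (absz (k 0 i + n%:Z))] => //.
  apply/rowP => i; rewrite [RHS]mxE ffunE.
  have := leq_trans (norm1_ge k i) hn; move: (fun_of_matrix k 0 i) => z hz.
  rewrite inordK; lia.
Qed.

End LimitCoefficients.

(** A periodic function with uniform local power series on the closed strip is the sum of
    its Fourier series, with coefficients exponentially small at the exact rate rho, and
    with polynomial decay of any order q besides. *)
Theorem torus_fourier : exists2 c : 'rV[int]_d -> C,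
  forall k, nc (c k) * expR (rho * (norm1 k)%:R) <= coef_bound k &
  forall x, has_sum (fun k => c k * character k (toC x)) (G (toC x)).
Proof.
have [U HU Uoo] := exists_ultra.
have ex (p : 'rV[int]_d * 'rV[C]_d) : exists l, strip rho p.2 -> clim U (fun n => dft G n p.1 p.2) l.
  have [h|h] := pselect (strip rho p.2); last by exists 0.
  have [|l hl] := @ultra_lim R U HU (fun n => dft G n p.1 p.2) (M * 2 ^+ d).
    by apply: filterE => n; exact: (dft_bound s0 M0 hloc).
  by exists l.
have [E0 hE0] := choice ex.
pose E k theta := E0 (k, theta).
have hE k theta : strip rho theta -> clim U (fun n => dft G n k theta) (E k theta).
  exact: hE0 (k, theta).
exists (fun k => E k 0) => [k|x]; first exact: (E_coef_bound HU Uoo hE).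
have st : strip rho (toC x) by exact: strip_toC.
by apply: has_sum_eq (E_series HU Uoo hE st) => k; exact: (E_character HU Uoo hE).
Qed.

End TorusTheorem.

(** * Uniform power series *)
Section Analytic.
Variable R : realType.
Variable d : nat.
Local Notation C := R[i].
Local Notation Re := (@complex.Re R).
Local Notation Im := (@complex.Im R).
Local Notation nc := (@Normc.normc R).
Implicit Types (theta p : 'rV[C]_d) (x : 'rV[R]_d) (k : 'rV[int]_d).

Variables (rho r : R) (g : 'rV[C]_d -> C -> C).
Hypothesis rho0 : 0 <= rho.
Hypothesis r0 : 0 < r.
Hypothesis hg : torus_analytic rho r g.

(** The analogue of [local_series] for functions of theta and x, with centre 0 in x. *)
Definition good_series (s M : R) theta :=
  exists p, exists c : 'rV[nat]_d * nat -> C, exists2 sigma : R, s <= sigma /\ 4 * sigma <= r &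
   [/\ forall j, nc (theta 0 j - p 0 j) <= sigma,
       forall a, nc (c a) * (\prod_j (4 * sigma) ^+ a.1 0 j * (4 * sigma) ^+ a.2) <= M &
       forall theta' z, strip rho theta' -> (forall j, nc (theta' 0 j - p 0 j) <= 2 * sigma) ->
         nc z <= 2 * sigma -> has_sum (fun a => c a * monomial p 0 theta' z a) (g theta' z)].

Lemma good_seriesW s M s' M' theta : s' <= s -> M <= M' ->
  good_series s M theta -> good_series s' M' theta.
Proof.
move=> hs hM [p [c [sg [h1 h1'] [h2 h3 h4]]]]; exists p, c, sg.
  by split=> //; exact: le_trans h1.
by split=> // a; apply: le_trans (h3 a) hM.
Qed.

Lemma torus_analytic_periodic z : nc z < r -> periodic rho (fun theta => g theta z).
Proof. by move=> hz theta j ht; exact: hg.1. Qed.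

Lemma good_series_translate s M theta (w : 'rV[int]_d) : 0 < s ->
  good_series s M theta -> good_series s M (theta + toC ((2 * pi) *: map_mx intr w)).
Proof.
move=> s0 [p [c [sg [h1 h1'] [h2 h3 h4]]]].
have sg0 : 0 < sg := lt_le_trans s0 h1.
set tau := toC _; exists (p + tau), c, sg => //; split=> //.
  by move=> j; rewrite !mxE opprD addrACA subrr addr0.
move=> theta' z ht hp hz.
have tauN : toC ((2 * pi) *: map_mx intr (- w)) = - tau.
  by rewrite /tau /toC map_mxN scalerN map_mxN.
have e : g theta' z = g (theta' - tau) z.
  rewrite -tauN (periodic_int (torus_analytic_periodic _))//.
  by apply: le_lt_trans hz _; lra.
rewrite e; have := h4 (theta' - tau) z.
have ht' : strip rho (theta' - tau) by rewrite -tauN; exact: strip_shift.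
have hp' j : nc ((theta' - tau) 0 j - p 0 j) <= 2 * sg.
  by have := hp j; rewrite !mxE opprD addrA [_ - p 0 j - _]addrAC.
move=> /(_ ht' hp' hz); apply: has_sum_eq => a; congr (_ * (_ * _)).
by apply: eq_bigr => j _; rewrite !mxE opprD addrA [_ - p 0 j - _]addrAC.
Qed.

Lemma reduce_torus theta : exists w : 'rV[int]_d, forall j,
  0 <= Re ((theta + toC ((2 * pi) *: map_mx intr w)) 0 j) <= 2 * pi.
Proof.
exists (\row_j (- Num.floor (Re (theta 0 j) / (2 * pi)))) => j.
have p0 : 0 < 2 * pi :> R by rewrite mulr_gt0// pi_gt0.
rewrite !mxE ReD /=; set t := Re (theta 0 j).
have -> : t + 2 * pi * (- Num.floor (t / (2 * pi)))%:~R =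
   2 * pi * (t / (2 * pi) - (Num.floor (t / (2 * pi)))%:~R).
  rewrite mulrBr rmorphN mulrN; congr (_ - _).
  by rewrite mulrCA divff ?mulr1// gt_eqF.
have := floor_itv (t / (2 * pi)); rewrite intrD => /andP[h1 h2].
by rewrite mulr_ge0 ?(ltW p0) ?subr_ge0//= ler_piMr ?(ltW p0)// lerBlDr addrC ltW.
Qed.

(** Compactness of the closed strip modulo periods, by contradiction: points theta_n without
    good series of radius 1 / (n + 1) and bound n are moved into a bounded set and converge
    along an ultrafilter to a point of the strip, whose power series is good for
    infinitely many theta_n. *)
Lemma uniform_series : exists s M, [/\ 0 < s, 0 <= M &
  forall theta, strip rho theta -> good_series s M theta].
Proof.
apply: contrapT => hcontra.
have bad (n : nat) : exists theta, [/\ strip rho theta, ~ good_series (n.+1%:R^-1) n%:R theta &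
    forall j, 0 <= Re (theta 0 j) <= 2 * pi].
  apply: contrapT => h; apply: hcontra; exists (n.+1%:R^-1), n%:R.
  split=> [||theta ht]; rewrite ?invr_gt0//.
  apply: contrapT => hng; apply: h.
  have [w hw] := reduce_torus theta.
  exists (theta + toC ((2 * pi) *: map_mx intr w)); split=> //; first exact: strip_shift.
  move=> /(good_series_translate (- w)); rewrite invr_gt0 => /(_ (ltr0Sn _ _)).
  by rewrite /toC map_mxN scalerN map_mxN addrK.
have [th hth] := choice bad.
have [U HU Uoo] := exists_ultra.
have PU : ProperFilter U := @ultra_proper _ _ HU.
have exl j : exists l, clim U (fun n => th n 0 j) l.
  apply: (@ultra_lim R U HU _ (2 * pi + rho)); apply: filterE => n.
  have [h1 _ h2] := hth n; apply: le_trans (nc_le_ReIm _) _; apply: lerD; last exact: h1.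
  by have /andP[h3 h4] := h2 j; rewrite ger0_norm.
have [l hl] := choice exl.
pose thl : 'rV[C]_d := \row_j l j.
have stl : strip rho thl.
  move=> j; rewrite mxE; apply/ler_addgt0Pl => e e0.
  have [n hn] := filter_ex (hl j e e0).
  have [h1 _ _] := hth n; rewrite -(subrK (th n 0 j) (l j)) ImD.
  apply: le_trans (ler_normD _ _) _; apply: lerD; last exact: h1.
  by apply: le_trans (Im_le_nc _) _; exact: ltW.
have d0 : disc r (0 : C) by change (is_true (nc (0 : C) < r)); rewrite nc0.
have [s s0 [c hc]] := hg.2 thl 0 stl d0.
pose sg := Num.min (s / 8) (r / 4).
have sg0 : 0 < sg by rewrite lt_min !divr_gt0.
have sgs : sg <= s / 8 by rewrite ge_min lexx.
have sgr : sg <= r / 4 by rewrite ge_min lexx orbT.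
pose pt : 'rV[C]_d := thl + \row_j (4 * sg)%:C.
have sg4 : nc (4 * sg)%:C = 4 * sg by rewrite ncR_ge0// mulr_ge0// ltW.
have hpt j : pt 0 j - thl 0 j = (4 * sg)%:C by rewrite !mxE addrAC subrr add0r.
(* The terms of the series at the corner pt of the polydisc of radius 4 sg are bounded,
   which bounds the coefficients. *)
have hpt1 j : nc (pt 0 j - thl 0 j) < s by rewrite hpt sg4; lra.
have hpt2 : nc ((4 * sg)%:C - 0) < s by rewrite subr0 sg4; lra.
have [M hM] := has_sum_bounded (hc pt (4 * sg)%:C hpt1 hpt2).
have near1 : \forall n \near U, forall j, nc (l j - th n 0 j) < sg.
  by apply: filter_forall => j; exact: hl.
have near2 : \forall n \near U, (n.+1%:R^-1 : R) <= sg.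
  apply: Uoo; have := nbhs_infty_ger (sg^-1); apply: filterS => n h.
  by rewrite -[sg]invrK lef_pV2 ?posrE ?invr_gt0//; apply: le_trans h _; rewrite ler_nat.
have near3 : \forall n \near U, M <= n%:R by apply: Uoo; exact: nbhs_infty_ger.
have [n [[n1 n2] n3]] := filter_ex (filterI (filterI near1 near2) near3).
have [_ hbad _] := hth n; apply: hbad; apply: (@good_seriesW sg M) => //.
exists thl, c, sg; first by split=> //; lra.
split.
- by move=> j; rewrite mxE nc_distC ltW.
- move=> a; have := hM a; rewrite ncM; congr (_ * _ <= _).
  rewrite /monomial ncM nc_prod ncX subr0 sg4; congr (_ * _).
  by apply: eq_bigr => j _; rewrite hpt ncX sg4.
- move=> theta' z ht hp hz; apply: hc => [j|]; first by apply: le_lt_trans (hp j) _; lra.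
  by rewrite subr0; apply: le_lt_trans hz _; lra.
Qed.

(** Once the earlier coefficients vanish, the next one is the limit, as y tends to 0, of
    the sum divided by the corresponding power of y. *)
Lemma power_unique (a : nat -> C) (s B : R) : 0 < s ->
  (forall n, nc (a n) * s ^+ n <= B) ->
  (forall y : R, 0 < y <= s / 2 -> has_sum (fun n => a n * y%:C ^+ n) 0) -> forall n, a n = 0.
Proof.
move=> s0 hB ha; elim/ltn_ind => n IH; apply: nc_eq0.
have B0 : 0 <= B by apply: le_trans (hB 0%N); rewrite mulr_ge0 ?nc_ge0.
pose K := 2 * (B * (2 / s) ^+ n.+1).
have K0 : 0 <= K by rewrite !mulr_ge0// exprn_ge0// divr_ge0// ltW.
apply: (@le_of_le_addM R _ _ (K + 0)) => [|e e0]; first by rewrite addr0.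
rewrite add0r addr0; pose y := Num.min e (s / 2).
have y0 : 0 < y by rewrite lt_min e0 divr_gt0.
have yle : y <= s / 2 by rewrite ge_min lexx orbT.
have ye : y <= e by rewrite ge_min lexx.
have hy : 0 < y <= s / 2 by rewrite y0.
have h1 : has_sum (fun m => if m == n then a n * y%:C ^+ n else 0) (a n * y%:C ^+ n).
  have := @has_sum_supp R _ (fun m => if m == n then a n * y%:C ^+ n else 0) [fset n]%fset.
  by rewrite big_seq_fset1 eqxx; apply => m; rewrite inE => /negbTE ->.
have h2 := has_sumB (ha y hy) h1; rewrite sub0r in h2.
have q0 : 0 <= y / s <= 1 / 2.
  by rewrite divr_ge0 ?(ltW y0) ?(ltW s0)//= ler_pdivrMr// mulrC; lra.
have half : 0 <= (1 / 2 : R) <= (1 / 2 : R) by lra.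
have c0 : 0 <= B * ((2 * (y / s)) ^+ n.+1).
  by rewrite mulr_ge0// exprn_ge0// mulr_ge0//; case/andP: q0.
have h3 : abs_le (fun m => a m * y%:C ^+ m - (if m == n then a n * y%:C ^+ n else 0))
    (B * ((2 * (y / s)) ^+ n.+1) * 2).
  apply: sum_leW (lexx _) (sum_leZ c0 (sum_le_geo half)) => m /=.
  have rhs0 : 0 <= B * (2 * (y / s)) ^+ n.+1 * (1 / 2) ^+ m.
    by apply: mulr_ge0 => //; apply: exprn_ge0; lra.
  have [mn|mn] := eqVneq m n; first by move: rhs0; rewrite mn subrr nc0.
  rewrite subr0 ncM ncX (ncR_ge0 (ltW y0)).
  have [ltmn|lenm] := ltnP m n; first by rewrite IH// nc0 mul0r.
  have ltnm : (n < m)%N by rewrite ltn_neqAle eq_sym mn.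
  have -> : y ^+ m = s ^+ m * (y / s) ^+ m.
    by rewrite -exprMn mulrC divfK// gt_eqF.
  have qm : 0 <= (y / s) ^+ m by rewrite exprn_ge0//; case/andP: q0.
  rewrite [leLHS]mulrA; apply: le_trans (ler_wpM2r qm (hB m)) _.
  rewrite -[leRHS]mulrA ler_wpM2l// -(subnKC ltnm) !exprD [(2 * (y / s)) ^+ _]exprMn.
  have q1 : (y / s) ^+ (m - n.+1) <= (1 / 2) ^+ (m - n.+1).
    by case/andP: q0 => ? ?; rewrite lerXn2r ?nnegrE//; lra.
  have -> : 2 ^+ n.+1 * (y / s) ^+ n.+1 * ((1 / 2) ^+ n.+1 * (1 / 2) ^+ (m - n.+1)) =
     (y / s) ^+ n.+1 * (1 / 2) ^+ (m - n.+1) * (2 * (1 / 2)) ^+ n.+1.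
    by rewrite [(2 * (1 / 2)) ^+ _]exprMn; ring.
  rewrite (_ : 2 * (1 / 2) = 1) ?expr1n ?mulr1; last by field.
  by rewrite ler_wpM2l// exprn_ge0//; case/andP: q0.
have := abs_le_nc h3 h2; rewrite ncN ncM ncX (ncR_ge0 (ltW y0)) => h4.
have yn : 0 < y ^+ n by rewrite exprn_gt0.
rewrite -(ler_pM2r yn); apply: le_trans h4 _.
have -> : B * (2 * (y / s)) ^+ n.+1 * 2 = y * K * y ^+ n.
  by rewrite /K !exprMn !exprS; ring.
by rewrite ler_wpM2r ?(ltW yn)// ler_wpM2r.
Qed.

End Analytic.

(** * Expansion in powers of the state variable *)
Section Tail.
Variable R : realType.
Local Notation C := R[i].
Local Notation nc := (@Normc.normc R).

Lemma sum_le_half_tail N : sum_le (fun n : nat => if (n < N)%N then 0 else (1 / 2) ^+ n : R) (2 * (1 / 2) ^+ N).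
Proof.
have h0 n : 0 <= (1 / 2 : R) ^+ n by apply: exprn_ge0; lra.
apply: sum_le_nat => [n|K]; first by case: ifP.
suff h : \sum_(n < K) (if (n < N)%N then 0 else (1 / 2) ^+ n : R) <=
    2 * (1 / 2) ^+ N - 2 * (1 / 2) ^+ (maxn K N).
  by apply: le_trans h _; rewrite gerBl mulr_ge0.
elim: K => [|K IH]; first by rewrite big_ord0 max0n subrr.
rewrite big_ord_recr /=; apply: le_trans (lerD IH (lexx _)) _.
case: (boolP (K < N)%N) => [KN|]; first by rewrite addr0 !(maxn_idPr _)// ltnW.
rewrite -leqNgt => NK; rewrite (maxn_idPl NK) (maxn_idPl (leqW NK)) exprS; lra.
Qed.

Lemma geo_tail (u : nat -> C) s B N : has_sum u s -> (forall n, nc (u n) <= B * (1 / 2) ^+ n) ->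
  nc (s - \sum_(n < N) u n) <= B * 2 * (1 / 2) ^+ N.
Proof.
move=> hs hu.
have B0 : 0 <= B by have := hu 0%N; rewrite expr0 mulr1; apply: le_trans; exact: nc_ge0.
have h1 : has_sum (fun n => if (n < N)%N then u n else 0) (\sum_(n < N) u n).
  pose F := [fset nat_of_ord i | i in 'I_N]%fset.
  have -> : \sum_(n < N) u n = \sum_(n <- F) (if (n < N)%N then u n else 0).
    rewrite /F big_imfset /=; last by move=> i j _ _; exact: val_inj.
    by rewrite big_enum /=; apply: eq_bigr => i _; rewrite ltn_ord.
  apply: has_sum_supp => n; case: ltnP => // nN /imfsetP h; exfalso; apply: h => /=.
  by exists (Ordinal nN).
rewrite -mulrA; apply: abs_le_nc (has_sumB hs h1).
apply: sum_leW (lexx _) (sum_leZ B0 (sum_le_half_tail N)) => n.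
by case: ifP => _; rewrite ?subrr ?nc0 ?mulr0 ?subr0.
Qed.

End Tail.

Section Expansion.
Variable R : realType.
Variables (d m : nat) (rho : R).
Hypothesis hm : (d < m)%N.
Hypothesis hrho : 0 < rho.
Local Notation C := R[i].
Local Notation Re := (@complex.Re R).
Local Notation Im := (@complex.Im R).
Local Notation nc := (@Normc.normc R).
Implicit Types (theta p : 'rV[C]_d) (x : 'rV[R]_d) (k : 'rV[int]_d).

Lemma prod_1D_ge (I : Type) (r : seq I) (a : I -> R) : (forall i, 0 <= a i) ->
  1 + \sum_(i <- r) a i <= \prod_(i <- r) (1 + a i).
Proof.
move=> a0; elim: r => [|i r IH]; first by rewrite !big_nil addr0.
rewrite !big_cons.
have S0 : 0 <= \sum_(j <- r) a j by apply: sumr_ge0.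
have h : (1 + a i) * (1 + \sum_(j <- r) a j) <= (1 + a i) * \prod_(j <- r) (1 + a j).
  by rewrite ler_wpM2l// addr_ge0.
apply: le_trans h; have := a0 i; nra.
Qed.

(** The weight 1 + |k|^2 is at most 2^d times the product of the 1 + k_j^2, so a decay of
    order m in each variable absorbs it. *)
Lemma base_le_prod k : (norm1 k)%:R ^+ 2 + 1 <= 2 ^+ d * (\prod_i invsq R (k 0 i))^-1.
Proof.
have h1 : 1 + (norm1 k)%:R <= \prod_(i < d) (1 + (`|k 0%R i|%N)%:R) :> R.
  by rewrite /norm1 natr_sum; apply: prod_1D_ge.
apply: (@le_trans _ _ ((1 + (norm1 k)%:R) ^+ 2)).
  have := ler0n R (norm1 k); move: (_%:R) => t t0; rewrite sqrrD; nra.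
apply: (@le_trans _ _ ((\prod_(i < d) (1 + (`|k 0%R i|%N)%:R)) ^+ 2)).
  by rewrite lerXn2r ?nnegrE ?addr_ge0// prodr_ge0// => i _; rewrite addr_ge0.
rewrite -prodrXl -prodfV.
have -> : 2 ^+ d = \prod_(i < d) 2 :> R by rewrite prodr_const card_ord.
rewrite -big_split /=; apply: ler_prod => i _; rewrite sqr_ge0/= /invsq invrK.
rewrite natr_absz intr_norm -[(k 0 i)%:~R ^+ 2]real_normK ?num_real//.
move: (`|_|) => t; have := sqr_ge0 (1 - t); rewrite sqrrB sqrrD; lra.
Qed.

Definition decay_norm : R := Kc R d m * 2 ^+ (d * m) * 6 ^+ d.

Lemma normH_of_decay u A : 0 <= A ->
  (forall k, nc (u k) * expR (rho * (norm1 k)%:R) <= A * \prod_i invsq R (k 0 i) ^+ m) ->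
  normH m rho u (decay_norm * A).
Proof.
move=> A0 hu.
have K0 := Kc_ge0 R d m.
have L0 : 0 <= decay_norm by rewrite /decay_norm !mulr_ge0 ?exprn_ge0.
split; first exact: mulr_ge0.
have c0 : 0 <= Kc R d m ^+ 2 * A ^+ 2 * 2 ^+ (d * m).
  by rewrite !mulr_ge0 ?sqr_ge0 ?exprn_ge0.
have := @sum_le_rV R int d (fun=> @invsq R) (fun=> 6) (fun _ t => invsq_ge0 R t) (fun=> @sum_le_invsq R).
rewrite prodr_const card_ord => h6.
apply: sum_leW (sum_leZ c0 h6) => [k|]; last first.
  rewrite /decay_norm !exprMn.
  have -> : Kc R d m ^+ 2 * (2 ^+ (d * m)) ^+ 2 * (6 ^+ d) ^+ 2 * A ^+ 2 =
     (Kc R d m ^+ 2 * A ^+ 2) * ((2 ^+ (d * m)) ^+ 2 * (6 ^+ d) ^+ 2) by ring.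
  rewrite -[leLHS]mulrA ler_wpM2l ?mulr_ge0 ?sqr_ge0//.
  have e1 (a : R) n : 1 <= a -> a ^+ n <= (a ^+ n) ^+ 2.
    by move=> a1; rewrite expr2 ler_peMr ?exprn_ege1// exprn_ge0// (le_trans ler01).
  by apply: ler_pM; rewrite ?exprn_ge0// e1//; lra.
set P := \prod_j invsq R (k 0 j).
have P0 : 0 < P.
  by apply: prodr_gt0 => j _; rewrite invr_gt0 ltr_pwDl// sqr_ge0.
have P1 : P <= 1.
  have e1 : \prod_(j < d) (1 : R) = 1 by rewrite big1.
  by rewrite -e1; apply: ler_prod => j _; rewrite invsq_ge0 invsq_le1.
have hk := hu k; rewrite prodrXl -/P in hk.
rewrite wtE ewE.
have -> : nc (u k) ^+ 2 * (expR (rho * (norm1 k)%:R) ^+ 2 * pw R m k) =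
   (nc (u k) * expR (rho * (norm1 k)%:R)) ^+ 2 * pw R m k by ring.
have -> : Kc R d m ^+ 2 * A ^+ 2 * 2 ^+ (d * m) * P =
   Kc R d m ^+ 2 * (A ^+ 2 * (2 ^+ (d * m) * P)) by ring.
rewrite ler_wpM2l ?sqr_ge0//.
have h1 : (nc (u k) * expR (rho * (norm1 k)%:R)) ^+ 2 <= (A * P ^+ m) ^+ 2.
  by rewrite lerXn2r ?nnegrE ?mulr_ge0 ?nc_ge0 ?expR_ge0 ?exprn_ge0 ?(ltW P0).
have h2 : pw R m k <= (2 ^+ d * P^-1) ^+ m.
  rewrite pwE lerXn2r ?nnegrE ?base_le_prod ?addr_ge0 ?sqr_ge0//.
  by rewrite mulr_ge0 ?exprn_ge0// invr_ge0 ltW.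
apply: (@le_trans _ _ ((A * P ^+ m) ^+ 2 * (2 ^+ d * P^-1) ^+ m)).
  by apply: ler_pM => //; rewrite ?sqr_ge0// ltW// pw_gt0.
have -> : (A * P ^+ m) ^+ 2 * (2 ^+ d * P^-1) ^+ m = A ^+ 2 * (2 ^+ (d * m) * P ^+ m).
  rewrite !exprMn exprVn exprM.
  have PM : P ^+ m != 0 by rewrite expf_neq0// gt_eqF.
  move: (P ^+ m) PM => Q Q0; by field.
rewrite ler_wpM2l ?sqr_ge0// ler_wpM2l ?exprn_ge0//.
by rewrite -[leRHS]expr1 ler_wiXn2l ?(ltW P0)// (leq_ltn_trans _ hm).
Qed.

Section TaylorCoefficients.
Variables (r : R) (g : 'rV[C]_d -> C -> C).
Hypothesis r0 : 0 < r.
Hypothesis hg : torus_analytic rho r g.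
Let rho0 : 0 <= rho := ltW hrho.

(** The Taylor coefficients in x of g(theta, .), normalized so as to be unique. The same
    s and B serve all theta, which makes the coefficients functions of theta. *)
Definition taylor_at (s B : R) theta (b : nat -> C) :=
  (forall z, nc z <= 2 * s -> has_sum (fun n => b n * z ^+ n) (g theta z)) /\
  (forall n, nc (b n) * (4 * s) ^+ n <= B).

Lemma taylor_unique s B theta b b' : 0 < s -> taylor_at s B theta b -> taylor_at s B theta b' ->
  b = b'.
Proof.
move=> s0 [h1 h2] [h1' h2']; apply/funext => n; apply/eqP; rewrite -subr_eq0; apply/eqP.
apply: (@power_unique R (fun n => b n - b' n) (4 * s) (B + B)) => [|{}n|y /andP[y0 y1]].
- by rewrite mulr_gt0.
- apply: le_trans (ler_wpM2r _ (ncB _ _)) _; first by rewrite exprn_ge0// mulr_ge0// ltW.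
  by rewrite mulrDl lerD.
- have hy : nc y%:C <= 2 * s by rewrite ncR_ge0 ?(ltW y0)//; lra.
  have := has_sumB (h1 _ hy) (h1' _ hy); rewrite subrr; apply: has_sum_eq => {}n.
  by rewrite mulrBl.
Qed.

(** Summing the local power series over the exponents of theta for each exponent n of x
    gives the Taylor coefficient of order n together with its own power series in theta. *)
Lemma local_taylor s M theta : 0 < s -> 0 <= M -> good_series rho r g s M theta ->
  exists p, exists c : 'rV[nat]_d * nat -> C, exists2 sigma : R, s <= sigma &
   [/\ forall j, nc (theta 0 j - p 0 j) <= sigma,
       forall alpha n, nc (c (alpha, n)) * \prod_(j < d) (4 * sigma) ^+ alpha 0 j <= M / (4 * s) ^+ n &
       forall theta', strip rho theta' -> (forall j, nc (theta' 0 j - p 0 j) <= 2 * sigma) ->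
       exists2 b, taylor_at s (M * 2 ^+ d) theta' b &
          forall n, has_sum (fun alpha => c (alpha, n) * mono p theta' alpha) (b n)].
Proof.
move=> s0 M0 [p [c [sg [h1 h1'] [h2 h3 h4]]]].
have sg0 : 0 < sg := lt_le_trans s0 h1.
have g0 : 0 < 4 * sg by rewrite mulr_gt0.
have gs0 : 0 < 4 * s by rewrite mulr_gt0.
have hc alpha n : nc (c (alpha, n)) * \prod_(j < d) (4 * sg) ^+ alpha 0 j <= M / (4 * s) ^+ n.
  rewrite ler_pdivlMr ?exprn_gt0//; apply: le_trans (h3 (alpha, n)) => /=.
  rewrite -[leLHS]mulrA ler_wpM2l ?nc_ge0// ler_wpM2l//.
    by apply: prodr_ge0 => j _; rewrite exprn_ge0// ltW.
  by rewrite lerXn2r ?nnegrE ?(ltW g0) ?(ltW gs0)// ler_wpM2l.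
exists p, c, sg => //; split=> // theta' ht hp.
have half : 0 <= (1 / 2 : R) <= (1 / 2 : R) by lra.
have half0 n : 0 <= (1 / 2 : R) ^+ n by apply: exprn_ge0; lra.
have := @sum_le_rV R nat d (fun _ n => (1 / 2) ^+ n) (fun=> 2) (fun _ n => half0 n) (fun=> sum_le_geo half).
rewrite prodr_const card_ord => hgeo.
have Mn0 n : 0 <= M / (4 * s) ^+ n by rewrite divr_ge0// exprn_ge0// ltW.
have habs n : abs_le (fun alpha => c (alpha, n) * mono p theta' alpha) (M / (4 * s) ^+ n * 2 ^+ d).
  apply: sum_leW (lexx _) (sum_leZ (Mn0 n) hgeo) => alpha /=.
  rewrite ncM; apply: le_trans (ler_wpM2r _ (hc alpha n)); last first.
    by apply: prodr_ge0.
  rewrite -mulrA ler_wpM2l ?nc_ge0// /mono nc_prod -big_split /=.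
  apply: ler_prod => j _; rewrite nc_ge0/= ncX -exprMn lerXn2r ?nnegrE ?nc_ge0//.
    by rewrite mulr_ge0 ?(ltW g0)//; lra.
  by apply: le_trans (hp j) _; lra.
have ex n : exists b, has_sum (fun alpha => c (alpha, n) * mono p theta' alpha) b.
  exact: abs_le_has_sum (habs n).
have [b hb] := choice ex.
exists b => //; split=> [z hz|n].
  have hz' : nc z <= 2 * sg by apply: le_trans hz _; rewrite ler_wpM2l.
  apply: (has_sum_sigma (has_sum_swap (h4 theta' z ht hp hz'))) => n /=.
  rewrite mulrC; apply: has_sum_eq (has_sumZ (z ^+ n) (hb n)) => alpha.
  by rewrite /monomial /= subr0 -/(mono p theta' alpha); ring.
rewrite -ler_pdivlMr ?exprn_gt0// mulrAC.
exact: abs_le_nc (habs n) (hb n).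
Qed.

(** Each Taylor coefficient is periodic, by uniqueness, and has uniform local power series
    with bound M / (4 s)^n, so [torus_fourier] applies to it. *)
Lemma taylor_fourier q : (0 < q)%N -> exists s A, [/\ 0 < s, 4 * s <= r, 0 <= A &
  exists (T : nat -> 'rV[C]_d -> C) (cf : nat -> 'rV[int]_d -> C),
  [/\ forall n k, nc (cf n k) * expR (rho * (norm1 k)%:R) <=
          A / (4 * s) ^+ n * \prod_i invsq R (k 0 i) ^+ q,
      forall n x, has_sum (fun k => cf n k * character k (toC x)) (T n (toC x)) &
      forall x (y : R), `|y| <= 2 * s -> has_sum (fun n => T n (toC x) * y%:C ^+ n) (g (toC x) y%:C)]].
Proof.
move=> q0; have [s [M [s0 M0 hgood]]] := uniform_series r0 hg.
have gs0 : 0 < 4 * s by rewrite mulr_gt0.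
have sr : 4 * s <= r.
  have [p [c [sg [h1 h1'] _]]] := hgood 0 (strip0 rho0).
  by apply: le_trans h1'; rewrite ler_wpM2l.
have ex theta : exists b, strip rho theta -> taylor_at s (M * 2 ^+ d) theta b.
  have [ht|hn] := pselect (strip rho theta); last by exists (fun=> 0).
  have [p [c [sg hsg [h1 h2 h3]]]] := local_taylor s0 M0 (hgood _ ht).
  have [|b hb _] := h3 theta ht.
    move=> j; apply: le_trans (h1 j) _.
    by rewrite mulr2n mulrDl mul1r lerDl (le_trans (ltW s0)).
  by exists b.
have [T hT] := choice ex.
have uniq theta b : strip rho theta -> taylor_at s (M * 2 ^+ d) theta b -> b = T theta.
  by move=> ht hb; exact: taylor_unique s0 hb (hT _ ht).
have Mn0 n : 0 <= M / (4 * s) ^+ n by rewrite divr_ge0// exprn_ge0// ltW.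
have hper n : periodic rho (fun theta => T theta n).
  move=> theta j ht; congr (_ n); apply: uniq => //.
  have ht' : strip rho (theta + (2 * pi)%:C *: basis_vec R j).
    by rewrite basis_toC; exact: strip_shift.
  have [h1 h2] := hT _ ht'; split; last exact: h2.
  move=> z hz; have hz' : disc r z by apply: (le_lt_trans hz); lra.
  by have e := hg.1 theta z j ht hz'; rewrite -e; exact: h1.
have hloc n theta : strip rho theta -> local_series s rho (M / (4 * s) ^+ n) (fun th => T th n) theta.
  move=> ht; have [p [c [sg hsg [h1 h2 h3]]]] := local_taylor s0 M0 (hgood _ ht).
  exists p, (fun alpha => c (alpha, n)), sg => //; split=> // theta' ht' hp.
  have [b hb hs] := h3 theta' ht' hp.
  by rewrite -(uniq _ _ ht' hb).
have exc n := torus_fourier s0 rho0 (Mn0 n) q0 (hper n) (hloc n).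
have exc' n : exists c, (forall k, nc (c k) * expR (rho * (norm1 k)%:R) <= coef_bound s (M / (4 * s) ^+ n) q k) /\
   forall x, has_sum (fun k => c k * character k (toC x)) (T (toC x) n).
  by have [c h1 h2] := exc n; exists c.
have [cf hcf] := choice exc'.
exists s, (M * 2 ^+ d * decay_const s q ^+ d); split=> //.
  by rewrite !mulr_ge0 ?exprn_ge0// decay_const_ge0.
exists (fun n theta => T theta n), cf; split=> [n k|n x|x y hy].
- have [h1 _] := hcf n; apply: le_trans (h1 k) _.
  rewrite /coef_bound big_split /= prodr_const card_ord le_eqVlt; apply/orP; left; apply/eqP; ring.
- by have [_ h2] := hcf n.
- have [h1 _] := hT _ (strip_toC x rho0); apply: h1.
  by rewrite ncR.
Qed.

Theorem analytic_expansion : exists s B, [/\ 0 < s, s <= r, 0 <= B &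
  exists T : nat -> 'rV[R]_d -> R,
   (forall n, inH m rho (T n) (B / s ^+ n)) /\
   (forall x (y : R) N, `|y| <= s / 2 ->
     `|Re (g (toC x) y%:C) - \sum_(n < N) T n x * y ^+ n| <= B * 2 * (1 / 2) ^+ N)].
Proof.
have m0 : (0 < m)%N by exact: leq_ltn_trans hm.
have [s [A [s0 sr A0 [T [cf [h1 h2 h3]]]]]] := taylor_fourier m0.
have gs0 : 0 < 4 * s by rewrite mulr_gt0.
have An0 n : 0 <= A / (4 * s) ^+ n by rewrite divr_ge0// exprn_ge0// ltW.
have L0 : 0 <= decay_norm by rewrite /decay_norm !mulr_ge0 ?exprn_ge0 ?Kc_ge0.
have hn n : normH m rho (cf n) (decay_norm * A / (4 * s) ^+ n).
  by rewrite -mulrA; apply: normH_of_decay.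
exists (4 * s), (decay_norm * A); split=> //; first exact: mulr_ge0.
exists (fun n x => Re (T n (toC x))); split=> [n|x y N hy].
  exact: (inH_Re hm hrho (hn n) (h2 n)).
have hy2 : `|y| <= 2 * s by apply: le_trans hy _; lra.
have hs := h3 x y hy2.
have -> : Re (g (toC x) y%:C) - \sum_(n < N) Re (T n (toC x)) * y ^+ n =
   Re (g (toC x) y%:C - \sum_(n < N) T n (toC x) * y%:C ^+ n).
  rewrite ReB; congr (_ - _).
  rewrite (big_morph Re (id1:=0) (op1:=+%R)) //; last by move=> ? ?; exact: ReD.
  by apply: eq_bigr => n _; rewrite -realCX mulrC -ReMl mulrC.
apply: le_trans (Re_le_nc _) _; apply: geo_tail hs _ => n.
rewrite ncM ncX ncR.
have hTn : nc (T n (toC x)) <= decay_norm * A / (4 * s) ^+ n.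
  exact: abs_le_nc (abs_char x (normH_abs hm hrho (hn n))) (h2 n x).
apply: (@le_trans _ _ (decay_norm * A / (4 * s) ^+ n * (2 * s) ^+ n)).
  by apply: ler_pM; rewrite ?nc_ge0 ?exprn_ge0// lerXn2r ?nnegrE ?mulr_ge0 ?(ltW s0).
have e : (1 / 2 : R) ^+ n = (2 * s) ^+ n / (4 * s) ^+ n.
  by rewrite -expr_div_n; congr (_ ^+ _); field; rewrite gt_eqF.
by rewrite e [leRHS]mulrA [leLHS]mulrAC.
Qed.

End TaylorCoefficients.
End Expansion.

(** * Nonlinear maps of the algebra and the contraction *)
Section Nonlinear.
Variable R : realType.
Variables (d m : nat) (rho : R).
Hypothesis hm : (d < m)%N.
Hypothesis hrho : 0 < rho.
Local Notation C := R[i].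
Local Notation Re := (@complex.Re R).
Local Notation Im := (@complex.Im R).
Local Notation nc := (@Normc.normc R).
Local Notation inH := (@inH R d m rho).
Local Notation Kc := (Kc R d m).
Implicit Types (phi psi U V W : 'rV[R]_d -> R).

Lemma inH0 M : 0 <= M -> inH (fun=> 0) M.
Proof.
by move=> M0; apply: inHW M0 _; have := @inH_cst R d m rho 0; rewrite normr0 mulr0.
Qed.

Lemma inH_sum n (phi : 'I_n -> 'rV[R]_d -> R) (M : 'I_n -> R) :
  (forall i, inH (phi i) (M i)) -> inH (fun x => \sum_(i < n) phi i x) (\sum_(i < n) M i).
Proof.
elim: n phi M => [|n IH] phi M h.
  by rewrite big_ord0; apply: inH_eq (inH0 (lexx 0)) => x; rewrite big_ord0.
rewrite big_ord_recl; apply: inH_eq (inHD hm hrho (h ord0) (IH _ _ (fun i => h (lift ord0 i)))) => x.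
by rewrite big_ord_recl.
Qed.

Lemma inHX phi M n : inH phi M -> inH (fun x => phi x ^+ n.+1) (M ^+ n.+1).
Proof.
move=> h; elim: n => [|n IH]; first by apply: inH_eq h => x; rewrite expr1.
by rewrite exprS; apply: inH_eq (inHM hm hrho h IH) => x; rewrite -exprS.
Qed.

(** The factor Kc is needed for n = 0 only: the constant function 1 has norm Kc. *)
Lemma inHX0 phi M n : inH phi M -> inH (fun x => phi x ^+ n) (Kc * M ^+ n).
Proof.
move=> h; case: n => [|n].
  by have := @inH_cst R d m rho 1; rewrite normr1.
apply: inHW (inHX n h); rewrite ler_peMl ?exprn_ge0 ?Kc_ge1//.
exact: inH_ge0 h.
Qed.

Lemma inH_pow_diff phi psi M D n : inH phi M -> inH psi M -> inH (fun x => phi x - psi x) D ->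
  inH (fun x => phi x ^+ n.+1 - psi x ^+ n.+1) (n.+1%:R * M ^+ n * D).
Proof.
move=> h1 h2 h3; elim: n => [|n IH].
  by rewrite expr0 mulr1 mul1r; apply: inH_eq h3 => x; rewrite !expr1.
have h := inHD hm hrho (inHM hm hrho h1 IH) (inHM hm hrho h3 (inHX n h2)).
have -> : n.+2%:R * M ^+ n.+1 * D = M * (n.+1%:R * M ^+ n * D) + D * M ^+ n.+1.
  by rewrite -[n.+2%:R]natr1 exprS; ring.
by apply: inH_eq h => x; rewrite !(exprS _ n.+1); ring.
Qed.

(** The superposition operator phi |-> g(., phi), on real functions. *)
Definition comp (g : 'rV[C]_d -> C -> C) U (x : 'rV[R]_d) : R := Re (g (toC x) (U x)%:C).

(** The factor n + 1 in the Lipschitz constant of y^(n+1) is absorbed by passing from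
    ratio 1 / 4 to ratio 1 / 2. *)
Lemma succ_half n : n.+1%:R * (1 / 4 : R) ^+ n <= 2 * (1 / 2) ^+ n.+1.
Proof.
have e : (1 / 4 : R) ^+ n = (1 / 2) ^+ n * (1 / 2) ^+ n.
  by rewrite -exprMn; congr (_ ^+ _); field.
have h0 : 0 <= (1 / 2 : R) ^+ n by apply: exprn_ge0; lra.
have h1 : n.+1%:R * (1 / 2 : R) ^+ n <= 1.
  elim: n {e h0} => [|n IH]; first by rewrite expr0 mulr1.
  rewrite exprS -[n.+2%:R]natr1.
  have h0 : 0 <= (1 / 2 : R) ^+ n by apply: exprn_ge0; lra.
  have h2 : (1 / 2 : R) ^+ n <= n.+1%:R * (1 / 2 : R) ^+ n by rewrite ler_peMl// ler1n.
  move: IH h2; set p := _ ^+ n; set k : R := n.+1%:R => IH h2; nra.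
rewrite e mulrA exprS; have -> : 2 * (1 / 2 * (1 / 2) ^+ n) = 1 * (1 / 2 : R) ^+ n by field.
by rewrite ler_wpM2r.
Qed.

(** The operator is the sum of the T_n phi^n, where the T_n are the Taylor coefficients of
    g; the radius of the ball is a quarter of that of the geometric bounds on the T_n.
    Lipschitz estimates come from phi^n - psi^n. *)
Theorem composition r g : 0 < r -> torus_analytic rho r g ->
  exists s L, [/\ 0 < s, s < r, 0 <= L &
   forall U U' Rr D, inH U Rr -> inH U' Rr -> Rr <= s -> inH (fun x => U x - U' x) D ->
     inH (comp g U) L /\ inH (fun x => comp g U x - comp g U' x) (L * D)].
Proof.
move=> r0 hg; have [s [B [s0 sr B0 [T [hT hs]]]]] := analytic_expansion hm hrho r0 hg.
have K0 := Kc_ge0 R d m.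
have Bs0 : 0 <= B / s by rewrite divr_ge0// ltW.
have L1 : 0 <= 2 * (Kc * B) by rewrite !mulr_ge0.
have L2 : 0 <= 2 * (2 * (B / s)) by move: Bs0; lra.
exists (s / 4), (2 * (Kc * B) + 2 * (2 * (B / s))); split.
- by rewrite divr_gt0.
- by lra.
- by rewrite addr_ge0.
move=> U U' Rr D hU hU' hR hD.
have D0 := inH_ge0 hD; have R0 := inH_ge0 hU.
have sup V : inH V Rr -> forall x, `|V x| <= s / 2.
  by move=> hV x; apply: le_trans (inH_sup hm hrho x hV) _; lra.
have q4 n : (Rr / s) ^+ n <= (1 / 4) ^+ n.
  have h1 : Rr / s <= 1 / 4 by rewrite ler_pdivrMr//; lra.
  by rewrite lerXn2r ?nnegrE ?(divr_ge0 R0 (ltW s0))//; lra.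
split.
  apply: (@inHW _ _ _ _ _ (2 * (Kc * B))); first by rewrite lerDl; exact: L2.
  apply: (inH_geo hm hrho (phi := fun n x => T n x * U x ^+ n) (B' := B * 2)) => [n|x N].
    apply: inHW (inHM hm hrho (hT n) (inHX0 n hU)).
    have -> : B / s ^+ n * (Kc * Rr ^+ n) = (Kc * B) * (Rr / s) ^+ n.
      by rewrite expr_div_n; ring.
    rewrite ler_wpM2l ?mulr_ge0//; apply: le_trans (q4 n) _.
    by rewrite lerXn2r ?nnegrE//; lra.
  by apply: hs; exact: sup.
apply: (@inHW _ _ _ _ _ (2 * (2 * (B / s) * D))).
  by rewrite mulrA ler_wpM2r// lerDr.
apply: (inH_geo hm hrho (phi := fun n x => T n x * (U x ^+ n - U' x ^+ n)) (B' := B * 2 + B * 2)) => [n|x N].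
  case: n => [|n].
    apply: inH_eq (inH0 _) => [x|]; first by rewrite !expr0 subrr mulr0.
    by rewrite expr0 mulr1; apply: mulr_ge0 => //; move: L2; lra.
  apply: inHW (inHM hm hrho (hT n.+1) (inH_pow_diff n hU hU' hD)).
  have -> : B / s ^+ n.+1 * (n.+1%:R * Rr ^+ n * D) = (B / s) * (n.+1%:R * (Rr / s) ^+ n) * D.
    rewrite expr_div_n exprS; field.
    by rewrite gt_eqF ?exprn_gt0// gt_eqF.
  have -> : 2 * (B / s) * D * (1 / 2) ^+ n.+1 = (B / s) * (2 * (1 / 2) ^+ n.+1) * D by ring.
  rewrite ler_wpM2r// ler_wpM2l//; apply: le_trans (succ_half n).
  by rewrite ler_wpM2l.
have h1 := hs x (U x) N (sup _ hU x); have h2 := hs x (U' x) N (sup _ hU' x).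
have -> : comp g U x - comp g U' x - \sum_(n < N) T n x * (U x ^+ n - U' x ^+ n) =
   (comp g U x - \sum_(n < N) T n x * U x ^+ n) - (comp g U' x - \sum_(n < N) T n x * U' x ^+ n).
  under eq_bigr do rewrite mulrBr.
  by rewrite sumrB; ring.
by rewrite mulrDl; apply: le_trans (ler_normB _ _) _; apply: lerD.
Qed.

(** The remainder of (a + U)^l after its linear part is a sum of terms of degree at least
    2 in U. When |U| <= |a| / (8 2^l), each carries the factor 1 / (8 2^l), and the
    binomial coefficients sum to at most 2^l, so the Lipschitz constant is at most
    |lam| / 8. *)
Lemma binomial_diff n (a : R) U U' B D : inH U B -> inH U' B -> inH (fun x => U x - U' x) D ->
  B <= `|a| / (8 * 2 ^+ n.+2) ->
  inH (fun x => ((a + U x) ^+ n.+2 - a ^+ n.+2 - n.+2%:R * a ^+ n.+1 * U x) -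
      ((a + U' x) ^+ n.+2 - a ^+ n.+2 - n.+2%:R * a ^+ n.+1 * U' x)) 
    (n.+2%:R * `|a| ^+ n.+1 / 8 * D).
Proof.
move=> hU hU' hD hB; set dl := (8 * 2 ^+ n.+2)^-1 in hB.
have B0 := inH_ge0 hU; have D0 := inH_ge0 hD.
have p0 : 0 < (2 : R) ^+ n.+2 by rewrite exprn_gt0.
have q0 : 0 < 8 * (2 : R) ^+ n.+2 by apply: mulr_gt0.
have dl0 : 0 < dl by rewrite invr_gt0.
have dl1 : dl <= 1.
  rewrite invf_le1//.
  have : 1 <= (2 : R) ^+ n.+2 by rewrite exprn_ege1//; lra.
  by lra.
have hsum := inH_sum (fun i : 'I_n.+1 => inHZ ('C(n.+2, i.+2)%:R * a ^+ (n - i)) (inH_pow_diff i.+1 hU hU' hD)).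
apply: inHW (inH_eq _ hsum) => [|x]; last first.
  have ex (z : R) : (a + z) ^+ n.+2 - a ^+ n.+2 - n.+2%:R * a ^+ n.+1 * z =
     \sum_(i < n.+1) 'C(n.+2, i.+2)%:R * a ^+ (n - i) * z ^+ i.+2.
    rewrite exprDn big_ord_recl big_ord_recl /= bin0 bin1 subn0 expr0 mulr1 mulr1n expr1.
    rewrite /bump /= add1n subn1 /= -[_ *+ n.+2]mulr_natl.
    have -> : \sum_(i < n.+1) a ^+ (n.+2 - bump 0 (bump 0 i)) * z ^+ bump 0 (bump 0 i) *+ 'C(n.+2, bump 0 (bump 0 i)) =
       \sum_(i < n.+1) 'C(n.+2, i.+2)%:R * a ^+ (n - i) * z ^+ i.+2.
      by apply: eq_bigr => i _; rewrite /bump /= !add1n !subSS -mulr_natl mulrA.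
    ring.
  by rewrite !ex -sumrB; apply: eq_bigr => i _; rewrite mulrBr.
have term (i : 'I_n.+1) : `|'C(n.+2, i.+2)%:R * a ^+ (n - i)| * (i.+2%:R * B ^+ i.+1 * D) <=
   'C(n.+2, i.+2)%:R * (n.+2%:R * `|a| ^+ n.+1 * dl * D).
  rewrite normrM normrX normr_nat -[leLHS]mulrA ler_wpM2l//.
  rewrite !mulrA ler_wpM2r//.
  have -> : `|a| ^+ (n - i) * i.+2%:R * B ^+ i.+1 = i.+2%:R * (`|a| ^+ (n - i) * B ^+ i.+1) by ring.
  rewrite -[leRHS]mulrA; apply: ler_pM; rewrite ?mulr_ge0 ?exprn_ge0//.
    by rewrite ler_nat !ltnS -ltnS.
  have hBi : B ^+ i.+1 <= `|a| ^+ i.+1 * dl.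
    apply: (@le_trans _ _ ((`|a| * dl) ^+ i.+1)).
      by rewrite lerXn2r ?nnegrE ?mulr_ge0 ?(ltW dl0).
    by rewrite exprMn ler_wpM2l ?exprn_ge0// exprS ler_piMr ?(ltW dl0)// exprn_ile1 ?(ltW dl0).
  have -> : `|a| ^+ n.+1 * dl = `|a| ^+ (n - i) * (`|a| ^+ i.+1 * dl).
    by rewrite mulrA -exprD addnS subnK// -ltnS.
  by rewrite ler_wpM2l ?exprn_ge0.
apply: le_trans (ler_sum _ (fun i _ => term i)) _.
rewrite -mulr_suml.
have hbin : \sum_(i < n.+1) 'C(n.+2, i.+2)%:R <= (2 : R) ^+ n.+2.
  have := exprDn (1 : R) 1 n.+2.
  rewrite (_ : 1 + 1 = 2)// => ->; rewrite [leRHS]big_ord_recl [X in _ <= _ + X]big_ord_recl /=.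
  rewrite -[leLHS]add0r; apply: lerD; first by rewrite !expr1n mulr1 mulrn_wge0.
  rewrite -[leLHS]add0r; apply: lerD; first by rewrite !expr1n mulr1 mulrn_wge0.
  by apply: ler_sum => i _; rewrite !expr1n mulr1 /bump /= !add1n.
apply: (@le_trans _ _ (2 ^+ n.+2 * (n.+2%:R * `|a| ^+ n.+1 * dl * D))).
  by rewrite ler_wpM2r// !mulr_ge0 ?exprn_ge0 ?(ltW dl0).
rewrite le_eqVlt; apply/orP; left; apply/eqP; rewrite /dl.
by move: (2 ^+ n.+2) p0 => P P0; field; rewrite gt_eqF.
Qed.

Section Contraction.
Variable omega : 'rV[R]_d.
Hypothesis homega : forall k : 'rV[int]_d, k != 0 -> freq omega k != 0.
Variable lam : R.
Hypothesis lam0 : lam != 0.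

(** The equation phi' = lam phi + psi along the orbit of omega. As psi may depend on phi,
    it expresses the full equation as well. *)
Definition flow phi psi := forall t : R, is_derive t 1 (fun t => phi (t *: omega))
      (lam * phi (t *: omega) + psi (t *: omega)).

Lemma flowB phi psi phi' psi' : flow phi psi -> flow phi' psi' ->
  flow (fun x => phi x - phi' x) (fun x => psi x - psi' x).
Proof.
move=> h h' t; have h1 := h t; have h2 := h' t.
have -> : lam * (phi (t *: omega) - phi' (t *: omega)) + (psi (t *: omega) - psi' (t *: omega)) =
  (lam * phi (t *: omega) + psi (t *: omega)) - (lam * phi' (t *: omega) + psi' (t *: omega)) by ring.
exact: (is_deriveB h1 h2).
Qed.

Lemma half_pow_le0 (x c : R) : (forall n, x <= c * (1 / 2) ^+ n) -> x <= 0.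
Proof.
move=> h; apply/ler_addgt0Pr => e e0; rewrite add0r.
have cB : c * (1 / 2) ^+ N @[N --> \oo] --> 0.
  by rewrite -(mulr0 c); apply: cvgMr; apply: cvg_expr; rewrite ger0_norm; lra.
have /cvgrPdist_lt /(_ _ e0) [N0 _ hN0] := cB.
have := hN0 N0 (leqnn _); rewrite /= sub0r normrN => h1.
by apply: le_trans (h N0) _; apply: le_trans (ler_norm _) (ltW h1).
Qed.

(** Iterate the map that sends V to the solution of the linear equation with right-hand side
    N V; consecutive iterates approach each other geometrically. Distances are measured
    through [linear_bound], which also shows that every solution in the ball is the
    limit. *)
Theorem contraction (delta : R) (N : ('rV[R]_d -> R) -> 'rV[R]_d -> R) :
  inH (N (fun=> 0)) (`|lam| * (delta / 2)) ->
  (forall V V' D, inH V delta -> inH V' delta -> inH (fun x => V x - V' x) D ->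
     inH (fun x => N V x - N V' x) (`|lam| * (D / 2))) ->
  exists V, [/\ inH V delta, flow V (N V) &
     forall W, inH W delta -> flow W (N W) -> W = V].
Proof.
move=> hN0 hN.
have l0 : 0 < `|lam| by rewrite normr_gt0.
have d0 : 0 <= delta by have := inH_ge0 hN0; rewrite pmulr_rge0//; lra.
have cancel D : `|lam| * D / `|lam| = D by rewrite mulrC mulKf// gt_eqF.
have z0 : inH (fun=> 0) delta by exact: inH0.
have bound phi psi P D : inH phi P -> flow phi psi -> inH psi (`|lam| * D) -> inH phi D.
  by move=> h1 h2 h3; rewrite -(cancel D); exact: (linear_bound hm hrho homega lam0 h1 h3 h2).
have ex V : exists phi, inH V delta -> inH phi delta /\ flow phi (N V).
  have [hV|] := pselect (inH V delta); last by exists (fun=> 0).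
  have hd : inH (fun x => V x - 0) delta by apply: inH_eq hV => x; rewrite subr0.
  have h1 := inHD hm hrho hN0 (hN _ _ _ hV z0 hd).
  have h2 : inH (N V) (`|lam| * delta).
    have -> : `|lam| * delta = `|lam| * (delta / 2) + `|lam| * (delta / 2) by field.
    by apply: inH_eq h1 => x; rewrite addrC subrK.
  have [phi p1 p2] := linear_solve hm hrho omega lam0 h2.
  exists phi => _; split; last exact: p2.
  by move: p1; rewrite cancel.
have [F hF] := choice ex.
pose v n := iter n F (fun=> 0).
have hv n : inH (v n) delta by elim: n => [//|n /hF []].
have fv n : flow (v n.+1) (N (v n)) by have [] := hF _ (hv n).
have dv n : inH (fun x => v n.+1 x - v n x) (delta / 2 * (1 / 2) ^+ n).
  elim: n => [|n IH].
    rewrite expr0 mulr1; apply: inH_eq (bound _ _ _ _ (hv 1%N) (fv 0%N) hN0) => x.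
    by rewrite subr0.
  apply: (bound _ _ _ _ (inHB hm hrho (hv n.+2) (hv n.+1)) (flowB (fv n.+1) (fv n))).
  have -> : delta / 2 * (1 / 2) ^+ n.+1 = (delta / 2 * (1 / 2) ^+ n) / 2 by rewrite exprS; field.
  exact: hN (hv _) (hv _) IH.
have v0 : v 0%N = fun=> 0 by [].
clearbody v.
have half : 0 <= (1 / 2 : R) <= (1 / 2 : R) by lra.
have exl x : exists s : R, has_sum (fun n => (v n.+1 x - v n x)%:C) s%:C.
  apply: (@has_sum_real _ _ _ (delta / 2 * 2)).
  have dd : 0 <= delta / 2 by rewrite divr_ge0.
  apply: (sum_leW _ (lexx _) (sum_leZ dd (sum_le_geo half))) => n.
  exact: (inH_sup hm hrho x (dv n)).
have [V hV] := choice exl.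
have tele K n x : \sum_(i < n) (v (K + i).+1 x - v (K + i)%N x) = v (K + n)%N x - v K x.
  elim: n => [|n IH]; first by rewrite big_ord0 addn0 subrr.
  by rewrite big_ord_recr /= IH addnS; ring.
have Vtail x n : `|V x - v n x| <= delta / 2 * 2 * (1 / 2) ^+ n.
  have hb i : nc (v i.+1 x - v i x)%:C <= delta / 2 * (1 / 2) ^+ i.
    by rewrite ncR; exact: (inH_sup hm hrho x (dv i)).
  have := geo_tail n (hV x) hb.
  by rewrite -rmorph_sum -(rmorphB (real_complex R)) ncR (tele 0%N) add0n v0 subr0.
have dV K : inH (fun x => V x - v K x) (delta * (1 / 2) ^+ K).
  have -> : delta * (1 / 2) ^+ K = 2 * (delta / 2 * (1 / 2) ^+ K) by field.
  apply: (inH_geo hm hrho (phi := fun n x => v (K + n).+1 x - v (K + n)%N x)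
    (B' := delta / 2 * 2 * (1 / 2) ^+ K)) => [n|x n].
    by rewrite -(mulrA _ (_ ^+ K)) -exprD; exact: dv.
  by rewrite tele opprB addrA subrK -(mulrA _ (_ ^+ K)) -exprD; exact: Vtail.
have hVd : inH V delta.
  by have := dV 0%N; rewrite expr0 mulr1 v0; apply: inH_eq => x; rewrite subr0.
have [Phi [hPhi fPhi]] : exists Phi, inH Phi delta /\ flow Phi (N V).
  by exists (F V); exact: hF.
(* The image Phi of the limit V is itself the limit, so that V is a fixed point. *)
have PV : Phi = V.
  apply/funext => x; apply/eqP; rewrite -subr_eq0 -normr_le0; apply/eqP.
  apply/eqP; apply: (@half_pow_le0 _ (delta + delta)) => n.
  have h1 : inH (fun x => Phi x - v n.+1 x) (delta * (1 / 2) ^+ n / 2).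
    apply: (bound _ _ _ _ (inHB hm hrho hPhi (hv n.+1)) (flowB fPhi (fv n))).
    exact: hN hVd (hv n) (dV n).
  have h2 := inH_sup hm hrho x h1; have h3 := inH_sup hm hrho x (dV n.+1).
  have -> : Phi x - V x = (Phi x - v n.+1 x) - (V x - v n.+1 x) by ring.
  apply: le_trans (ler_normB _ _) _.
  have p0 : 0 <= delta * (1 / 2) ^+ n by rewrite mulr_ge0// exprn_ge0//; lra.
  move: h3; rewrite exprS mulrDl => h3; lra.
exists V; split=> //; first by rewrite -{1}PV.
move=> W hW fW; apply/funext => x; apply/eqP; rewrite -subr_eq0 -normr_le0.
apply: (@half_pow_le0 _ (delta + delta)) => n.
apply: (inH_sup hm hrho x (phi := fun x => W x - V x)).
have fV : flow V (N V) by rewrite -{1}PV.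
elim: n => [|n IH]; first by rewrite expr0 mulr1; exact: inHB.
apply: (bound _ _ _ _ (inHB hm hrho hW hVd) (flowB fW fV)).
have -> : (delta + delta) * (1 / 2) ^+ n.+1 = ((delta + delta) * (1 / 2) ^+ n) / 2.
  by rewrite exprS; field.
exact: hN hW hVd IH.
Qed.

End Contraction.
End Nonlinear.

(** * The norm and the space of the theorem *)
Lemma esum_le_sum_le (R : realType) (I : choiceType) (v : I -> R) (M : R) :
  ((\esum_(i in [set: I]) (v i)%:E <= M%:E)%E <-> sum_le v M).
Proof.
split=> [h F|h].
  rewrite -lee_fin -sumEFin; apply: le_trans h.
  apply: ereal_sup_ubound; exists [set` F]; first by split; first exact: finite_fset.
  by rewrite fsbig_finite ?set_fsetK//; exact: finite_fset.
apply: ge_ereal_sup => _ [A [fA _] <-].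
by rewrite fsbig_finite// sumEFin lee_fin; exact: h.
Qed.

Section Interface.
Variable R : realType.
Variables (d m : nat) (rho : R).
Hypothesis hm : (d < m)%N.
Hypothesis hrho : 0 < rho.
Local Notation C := R[i].
Local Notation Re := (@complex.Re R).
Local Notation Im := (@complex.Im R).
Local Notation nc := (@Normc.normc R).
Local Notation inH := (@inH R d m rho).
Local Notation normH := (@normH R d m rho).
Local Notation Kc := (Kc R d m).
Implicit Types (V W : 'rV[C]_d -> C).

Lemma Hnorm_le V M : 0 <= M -> (Hnorm rho m V <= M%:E)%E <->
  sum_le (fun k => nc (fourier V k) ^+ 2 * wt m rho k) (M ^+ 2).
Proof.
move=> M0.
have e k : nc (fourier V k) ^+ 2 * expR (2 * rho * (norm1 k)%:R) *
    ((norm1 k)%:R ^+ 2 + 1) ^+ m = nc (fourier V k) ^+ 2 * wt m rho k.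
  by rewrite wtE pwE ewE -expRM_natl !mulrA.
rewrite /Hnorm; under eq_esum do rewrite e.
have M20 : (0 <= (M ^+ 2)%:E)%E by rewrite lee_fin sqr_ge0.
have -> : M%:E = sqrte (M ^+ 2)%:E by rewrite /= sqrtr_sqr ger0_norm.
by rewrite lee_sqrt//; exact: esum_le_sum_le.
Qed.

Lemma normH_of_Hnorm V M : 0 <= M -> (Hnorm rho m V <= M%:E)%E ->
  normH (fourier V) (Kc * M).
Proof.
move=> M0 /(Hnorm_le _ M0) h; split; first by rewrite mulr_ge0 ?Kc_ge0.
by rewrite exprMn; apply: sum_leZ h; rewrite sqr_ge0.
Qed.

Lemma in_H_sum V x : in_H rho m V ->
  has_sum (fun k => fourier V k * character k (toC x)) (V (toC x)).
Proof. by move=> [h _]; apply: h; apply: strip_toC; exact: ltW. Qed.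

Lemma inH_of_in_H V M : 0 <= M -> in_H rho m V -> (Hnorm rho m V <= M%:E)%E ->
  inH (fun x => Re (V (toC x))) (Kc * M).
Proof.
move=> M0 hV hM.
by apply: (inH_Re hm hrho (normH_of_Hnorm M0 hM)) => x; exact: in_H_sum.
Qed.

(** The Fourier coefficients, hence the values on the whole strip, depend only on the values
    at real points. *)
Lemma in_H_ext V W : in_H rho m V -> in_H rho m W ->
  (forall x, V (toC x) = W (toC x)) -> forall theta, strip rho theta -> V theta = W theta.
Proof.
move=> [hV _] [hW _] e theta ht; apply: has_sum_unique (hV _ ht) _.
apply: has_sum_eq (hW _ ht) => k; congr (_ * _).
by rewrite /fourier; congr (meanC _); apply/funext => x; rewrite e.
Qed.

(** The values on the strip are defined by the Fourier series itself, which converges there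
    by [normH_emb]; by [fourier_coef] its coefficients are the Fourier coefficients. *)
Lemma in_H_of_inH phi M : inH phi (Kc * M) -> exists V,
  [/\ in_H rho m V, torus_real V, forall x, V (toC x) = (phi x)%:C &
      (Hnorm rho m V <= M%:E)%E].
Proof.
move=> [u hu hs]; have K0 := Kc_gt0 R d m.
have M0 : 0 <= M by case: hu; rewrite pmulr_rge0.
have emb := normH_emb hm hrho hu.
have ex theta : exists s, strip rho theta -> has_sum (fun k => u k * character k theta) s.
  have [ht|] := pselect (strip rho theta); last by exists 0.
  have [s hs'] : exists s, has_sum (fun k => u k * character k theta) s.
    apply: (@abs_le_has_sum _ _ _ (Kc * M)); apply: sum_leW emb => // k.
    by rewrite ncM ler_wpM2l ?nc_ge0// ewE nc_character_strip.
  by exists s.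
have [V hV] := choice ex.
have Vphi x : V (toC x) = (phi x)%:C.
  by apply: has_sum_unique (hV _ (strip_toC _ (ltW hrho))) (hs x).
have [B B0 hB] := ew_norm1 d hrho.
have fV k : fourier V k = u k.
  apply: (@fourier_coef _ _ _ (Kc * M + B * (Kc * M))) => [|x]; last by rewrite Vphi.
  apply: sum_leW (sum_leD (normH_abs hm hrho hu) (sum_leZ B0 emb)) => // j.
  by rewrite mulrDr mulr1 lerD2l [leRHS]mulrCA ler_wpM2l ?nc_ge0.
have hn : (Hnorm rho m V <= M%:E)%E.
  apply/(Hnorm_le _ M0) => F; rewrite -(ler_pM2l (exprn_gt0 2 K0)) mulr_sumr -exprMn.
  by under eq_bigr do rewrite fV; exact: hu.2.
exists V; split=> // [|x].
  split; last by apply: le_lt_trans hn (ltry _).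
  by move=> theta /hV; apply: has_sum_eq => k; rewrite fV.
by rewrite Vphi complex_real.
Qed.

Lemma Hnorm_le0 V : in_H rho m V -> (Hnorm rho m V <= 0)%E ->
  forall theta, strip rho theta -> V theta = 0.
Proof.
move=> [hV _] /(normH_of_Hnorm (lexx 0)); rewrite mulr0 => h theta /hV.
move/(has_sum_unique); apply.
have := @has_sum_supp R _ (fun k => fourier V k * character k theta) fset0.
rewrite big_seq_fset0; apply => k _; rewrite (nc_eq0 (z := fourier V k)) ?mul0r//.
exact: (normH_pt hm hrho k h).
Qed.

Lemma in_H_cst0 : in_H rho m (fun _ : 'rV[C]_d => 0 : C) /\
  (Hnorm rho m (fun _ : 'rV[C]_d => 0%R : C) <= 0)%E.
Proof.
have K0 := Kc_ge0 R d m.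
have [V [hV _ V0 hn]] := in_H_of_inH (@inH0 R d m rho _ (mulr_ge0 K0 (lexx 0))).
have e : fourier V = fourier (fun _ : 'rV[C]_d => 0).
  apply/funext => k; rewrite /fourier; congr (meanC _); apply/funext => x.
  by rewrite V0.
have e2 : Hnorm rho m V = Hnorm rho m (fun _ : 'rV[C]_d => 0) by rewrite /Hnorm e.
have h0 := Hnorm_le0 hV hn.
split; last by rewrite -e2.
split; last by rewrite -e2; case: hV.
by move=> theta ht; case: hV => /(_ _ ht); rewrite h0// e.
Qed.

End Interface.

(** * The bifurcating solution *)
Section Estimates.
Variable R : realType.
Variables (d m n : nat) (rho : R).
Hypothesis hm : (d < m)%N.
Hypothesis hrho : 0 < rho.
Local Notation C := R[i].
Local Notation Re := (@complex.Re R).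
Local Notation Im := (@complex.Im R).
Local Notation nc := (@Normc.normc R).
Local Notation inH := (@inH R d m rho).
Local Notation K := (Kc R d m).
Local Notation l := n.+2.
Variables (f H : 'rV[C]_d -> C -> C) (f0 : R).
Hypothesis f00 : f0 != 0.
Implicit Types (phi psi U V W : 'rV[R]_d -> R).

(** The radius of the ball of responses, relative to |a|; see [binomial_diff]. *)
Definition ratio : R := (8 * 2 ^+ l)^-1.

Lemma ratio_gt0 : 0 < ratio.
Proof. by rewrite /ratio invr_gt0; apply: mulr_gt0; rewrite // exprn_gt0. Qed.

Lemma ratio_le1 : ratio <= 1.
Proof.
have p0 : 1 <= (2 : R) ^+ l by rewrite exprn_ege1//; lra.
have q0 : 0 < 8 * (2 : R) ^+ l by lra.
by rewrite /ratio invf_le1//; lra.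
Qed.

(** What remains of the equation for phi after its linear part, when a^l + eps f0 = 0. *)
Definition nonlin a eps phi x : R :=
  ((a + phi x) ^+ l - a ^+ l - l%:R * a ^+ n.+1 * phi x) +
  (a + phi x) ^+ l.+1 * comp H (fun x => a + phi x) x +
  eps * (comp f (fun x => a + phi x) x - f0).

(** Relative to |lam| = l |a|^(l-1), the three parts of N have Lipschitz constants 1 / 8,
    O(|a|) and O(|a|), and N 0 is the sum of the forcing, of norm at most a quarter of
    l ratio |a|^l by the assumption on f(., 0) - f0, and of terms of order |a|^(l+1). *)
Lemma nonlin_contracts r : 0 < r -> torus_analytic rho r f -> torus_analytic rho r H ->
  inH (fun x => comp f (fun=> 0) x - f0) (l%:R * ratio / 4 * `|f0|) ->
  exists2 alpha : R, 0 < alpha & forall a eps, a != 0 -> `|a| <= alpha ->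
    `|eps| * `|f0| = `|a| ^+ l ->
    let lam := l%:R * a ^+ n.+1 in
    [/\ `|a| + ratio * `|a| < r,
        inH (nonlin a eps (fun=> 0)) (`|lam| * (ratio * `|a| / 2)) &
        forall V V' D, inH V (ratio * `|a|) -> inH V' (ratio * `|a|) ->
          inH (fun x => V x - V' x) D ->
          inH (fun x => nonlin a eps V x - nonlin a eps V' x) (`|lam| * (D / 2))].
Proof.
move=> r0 hf hH hg.
have [sf [Lf [sf0 sfr Lf0 cf]]] := composition hm hrho r0 hf.
have [sH [LH [sH0 sHr LH0 cH]]] := composition hm hrho r0 hH.
have K1 := Kc_ge1 R d m; have K0 : 0 <= K by lra.
have E0 : 0 < `|f0| by rewrite normr_gt0.
have q0 := ratio_gt0; have q1 := ratio_le1.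
have l1 : 1 <= l%:R :> R by rewrite ler1n.
set K' := K + 1; have K'0 : 0 <= K' by rewrite addr_ge0.
pose C1 := (l.+1%:R * K' ^+ l + K' ^+ l.+1) * LH.
have C10 : 0 <= C1.
  apply: mulr_ge0 => //; apply: addr_ge0; last by rewrite exprn_ge0.
  by apply: mulr_ge0; rewrite ?exprn_ge0.
pose C2 := Lf * K / `|f0|.
have C20 : 0 <= C2 by apply: divr_ge0 => //; apply: mulr_ge0.
(* All smallness conditions on alpha = |a| have the form alpha c_i <= b_i; the sum of the
   c_i and the minimum of the b_i reduce them to one. *)
pose c := K' + C1 + C2 + LH.
have c0 : 0 < c by rewrite /c /K'; lra.
pose b := Num.min (Num.min sf sH) (Num.min 1 (l%:R * ratio / 8)).
have lq0 : 0 < l%:R * ratio by apply: mulr_gt0; rewrite // ltr0n.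
have b0 : 0 < b by rewrite /b !lt_min sf0 sH0 ltr01/= divr_gt0.
exists (b / c) => [|a eps a0 ha he lam]; first by rewrite divr_gt0.
set al := `|a| in ha he *.
have al0 : 0 < al by rewrite normr_gt0.
have alc : al * c <= b by rewrite -ler_pdivlMr.
have [bf bH b1 bq] : [/\ b <= sf, b <= sH, b <= 1 & b <= l%:R * ratio / 8].
  by rewrite /b !ge_min !lexx !orbT.
have part x : x <= c -> al * x <= b.
  by move=> h; apply: le_trans alc; rewrite ler_wpM2l// ltW.
have pK : al * K' <= b by apply: part; rewrite /c; lra.
have p1 : al * C1 <= b by apply: part; rewrite /c; lra.
have p2 : al * C2 <= b by apply: part; rewrite /c; lra.
have p3 : al * LH <= b by apply: part; rewrite /c; lra.
have al1 : al <= 1.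
  apply: le_trans (le_trans pK b1); rewrite ler_peMr ?(ltW al0)//.
  by rewrite /K' lerDr.
have lamE : `|lam| = l%:R * al ^+ n.+1 by rewrite normrM normrX normr_nat.
have dq : ratio * al <= al by rewrite ler_piMl// ltW.
have epsE : `|eps| = al ^+ l / `|f0| by rewrite -he mulfK// gt_eqF.
have pa0 : 0 <= al ^+ n.+1 by rewrite exprn_ge0// ltW.
have hU V : inH V (ratio * al) -> inH (fun x => a + V x) (al * K').
  move=> hV; apply: inHW (inHD hm hrho (inH_cst d m rho a) hV).
  by rewrite -/al /K' mulrDr mulr1 mulrC lerD2l.
have hz : inH (fun=> 0) (ratio * al) by apply: inH0; rewrite mulr_ge0 ?ltW.
have lin (x y : R) : al * x <= y -> al ^+ l * x <= y * al ^+ n.+1.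
  by move=> h; rewrite exprS mulrAC ler_wpM2r.
split.
- apply: le_lt_trans sfr; apply: le_trans bf; apply: le_trans pK.
  by rewrite /K' mulrDr mulr1 lerD// ler_peMr// ltW.
- have ha0 : inH (fun=> a) (al * K').
    by apply: inH_eq (hU _ hz) => x; rewrite addr0.
  have h0 : inH (fun=> 0) (al * K') by apply: inH0; rewrite mulr_ge0// ltW.
  have hd : inH (fun=> a - 0) (K * al).
    by rewrite subr0; exact: inH_cst.
  have [hc1 _] := cH _ _ _ _ ha0 ha0 (le_trans pK bH) (inHB hm hrho ha0 ha0).
  have [_ hc2] := cf _ _ _ _ ha0 h0 (le_trans pK bf) hd.
  have h1 := inHD hm hrho (inHZ (a ^+ l.+1) hc1) (inHZ eps (inHD hm hrho hc2 hg)).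
  apply: (inHW _ (inH_eq _ h1)) => [|x]; last first.
    by rewrite /nonlin /comp !addr0; ring.
  rewrite normrX -/al epsE lamE.
  set P := al * al ^+ n.+1.
  have P0 : 0 <= P by rewrite mulr_ge0 ?(ltW al0).
  have e1 : al ^+ l.+1 * LH <= l%:R * ratio / 8 * P.
    have -> : al ^+ l.+1 * LH = (al * LH) * P by rewrite /P !exprS; ring.
    by rewrite ler_wpM2r// (le_trans p3).
  have e2 : al ^+ l / `|f0| * (Lf * (K * al)) <= l%:R * ratio / 8 * P.
    have -> : al ^+ l / `|f0| * (Lf * (K * al)) = (al * C2) * P.
      by rewrite /P /C2 !exprS; ring.
    by rewrite ler_wpM2r// (le_trans p2).
  have e3 : al ^+ l / `|f0| * (l%:R * ratio / 4 * `|f0|) = l%:R * ratio / 4 * P.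
    by rewrite /P !exprS; field; rewrite gt_eqF.
  have -> : l%:R * al ^+ n.+1 * (ratio * al / 2) = l%:R * ratio / 2 * P.
    by rewrite /P; field.
  rewrite mulrDr e3; move: e1 e2; generalize (al ^+ l.+1 * LH); clear; move=> x; lra.
- move=> V V' D hV hV' hD; have D0 := inH_ge0 hD.
  have hUd : inH (fun x => (a + V x) - (a + V' x)) D.
    by apply: inH_eq hD => x; ring.
  have hB : ratio * al <= `|a| / (8 * 2 ^+ l) by rewrite mulrC.
  have hQ := binomial_diff hm hrho hV hV' hD hB.
  have [hc1 hc2] := cH _ _ _ _ (hU _ hV) (hU _ hV') (le_trans pK bH) hUd.
  have [_ hc3] := cf _ _ _ _ (hU _ hV) (hU _ hV') (le_trans pK bf) hUd.
  have hp := inHM hm hrho (inH_pow_diff hm hrho l (hU _ hV) (hU _ hV') hUd) hc1.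
  have hq := inHM hm hrho (inHX hm hrho l (hU _ hV')) hc2.
  have h1 := inHD hm hrho hQ (inHD hm hrho (inHD hm hrho hp hq) (inHZ eps hc3)).
  apply: (inHW _ (inH_eq _ h1)) => [|x]; last by rewrite /nonlin; ring.
  rewrite lamE epsE -/al.
  set P := al ^+ n.+1 * D.
  have P0 : 0 <= P by rewrite mulr_ge0.
  have e1 : l.+1%:R * (al * K') ^+ l * D * LH + (al * K') ^+ l.+1 * (LH * D) <= l%:R * ratio / 8 * P.
    apply: (@le_trans _ _ ((al * C1) * P)); last by rewrite ler_wpM2r// (le_trans p1).
    have -> : (al * K') ^+ l.+1 = al * ((al * K') ^+ l * K') by rewrite exprS; ring.
    have le1 : al * ((al * K') ^+ l * K') <= (al * K') ^+ l * K'.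
      by rewrite ler_piMl// mulr_ge0// exprn_ge0// mulr_ge0// ltW.
    apply: (@le_trans _ _ (l.+1%:R * (al * K') ^+ l * D * LH + (al * K') ^+ l * K' * (LH * D))).
      by rewrite lerD2l ler_wpM2r// mulr_ge0.
    rewrite le_eqVlt; apply/orP; left; apply/eqP.
    by rewrite /P /C1 exprMn !exprS; ring.
  have e2 : al ^+ l / `|f0| * (Lf * D) <= l%:R * ratio / 8 * P.
    have -> : al ^+ l / `|f0| * (Lf * D) = (al * (Lf / `|f0|)) * P by rewrite /P exprS; ring.
    rewrite ler_wpM2r// (le_trans _ (le_trans p2 bq))// ler_wpM2l ?(ltW al0)//.
    by rewrite /C2 mulrAC ler_peMr// divr_ge0// ltW.
  have e3 : l%:R * ratio / 8 * P <= l%:R / 8 * P.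
    by rewrite ler_wpM2r// ler_wpM2r// ler_piMr.
  have -> : l%:R * al ^+ n.+1 / 8 * D = l%:R / 8 * P by rewrite /P; ring.
  have -> : l%:R * al ^+ n.+1 * (D / 2) = l%:R / 2 * P by rewrite /P; ring.
  have e4 : 0 <= l%:R * P by rewrite mulr_ge0.
  move: e1 e2 e3 e4; set x := _ + _ * (LH * D); set y := _ * (Lf * D).
  by move: x y (l%:R * ratio / 8 * P) => x y z; lra.
Qed.

End Estimates.

Section Bifurcation.
Variable R : realType.
Variables (d n : nat) (rho r : R) (omega : 'rV[R]_d).
Hypothesis hrho : 0 < rho.
Local Notation C := R[i].
Local Notation Re := (@complex.Re R).
Local Notation nc := (@Normc.normc R).
Local Notation l := n.+2.
Variables (f h H : 'rV[C]_d -> C -> C) (f0 : R).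
Hypothesis hH : forall (theta : 'rV[C]_d) (x : C), strip rho theta -> disc r x ->
  h theta x = x ^+ l.+1 * H theta x.

(** Subtracting a from a response turns the equation into that of [flow], by the choice of
    a and the factorization of h. *)
Lemma solves_flow a eps (V : 'rV[C]_d -> C) (phi := fun x => Re (V (toC x))) :
  (forall x, `|a + phi x| < r) -> a ^+ l + eps * f0 = 0 ->
  solves l r omega f h eps (response omega a V) <->
  flow omega (l%:R * a ^+ n.+1) phi (nonlin n f H f0 a eps phi).
Proof.
move=> hr ha.
have ha' : eps * f0 = - a ^+ l by apply/eqP; rewrite -addr_eq0 addrC ha.
have e t : response omega a V t ^+ l + Re (h (toC (t *: omega)) (response omega a V t)%:C)
     + eps * Re (f (toC (t *: omega)) (response omega a V t)%:C) =
   l%:R * a ^+ n.+1 * phi (t *: omega) + nonlin n f H f0 a eps phi (t *: omega).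
  rewrite hH; first last.
  - by have := hr (t *: omega); rewrite -ncR.
  - by apply: strip_toC; exact: ltW.
  rewrite -realCX ReMl /nonlin /comp /response -/(phi _).
  have -> : eps * (Re (f (toC (t *: omega)) (a + phi (t *: omega))%:C) - f0) =
    eps * Re (f (toC (t *: omega)) (a + phi (t *: omega))%:C) + a ^+ l.
    by rewrite mulrBr ha' opprK.
  by ring.
split=> [hs t|hs t].
  have [_ hd] := hs t; rewrite e in hd.
  have := is_deriveB hd (is_derive_cst a t (1 : R)).
  rewrite subr0; congr is_derive; apply/funext => s.
  change (a + phi (s *: omega) - a = phi (s *: omega)).
  by rewrite addrAC subrr add0r.
split; first exact: hr.
rewrite e; have := is_deriveD (is_derive_cst a t (1 : R)) (hs t).
by rewrite add0r; congr is_derive.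
Qed.

End Bifurcation.

(** The sign of eps f0 is negative on the allowed interval for even l, and arbitrary for odd
    l, so that - eps f0 has a real root of order l. *)
Lemma amplitude (R : realType) (n : nat) (f0 e0 eps : R) : f0 != 0 ->
  eps_range n.+2 f0 e0 eps -> eps != 0 ->
  exists a : R, a ^+ n.+2 + eps * f0 = 0 /\ `|a| = (`|eps| * `|f0|) `^ (n.+2%:R^-1).
Proof.
move=> f00 he e0'; set al := _ `^ _.
have al0 : 0 <= al by exact: powR_ge0.
have alX : al ^+ n.+2 = `|eps * f0|.
  by rewrite -powR_mulrn// -powRrM mulVf ?pnatr_eq0// powRr1 ?normrM// mulr_ge0.
have [s|s] := ltP (eps * f0) 0.
  by exists al; rewrite alX ltr0_norm// addNr ger0_norm.
have hodd : odd n.+2.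
  move: he; rewrite /eps_range; case: (odd n.+2) => //.
  have [f1|f1] := ltP 0 f0; rewrite /= in_itv /= => /andP[h1 h2].
    by move: s; rewrite leNgt pmulr_llt0// h2.
  have f2 : f0 < 0 by rewrite lt_neqAle f00.
  by move: s; rewrite leNgt nmulr_llt0// h1.
exists (- al); split; last by rewrite normrN ger0_norm.
by rewrite exprNn -signr_odd hodd expr1 mulN1r alX ger0_norm// addNr.
Qed.

Lemma eps_range_lt (R : realType) l (f0 e0 eps : R) : eps_range l f0 e0 eps -> `|eps| < e0.
Proof.
rewrite /eps_range; case: odd; last case: ltP => _; rewrite /= in_itv /= ltr_norml => /andP[h1 h2].
- by rewrite h1.
- by rewrite h1 /=; lra.
- by rewrite h2 andbT; lra.
Qed.

Theorem theorem8 (R : realType) (l d m : nat) (rho : R)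
    (hl : (2 <= l)%N) (hd : (1 <= d)%N) (hm : (d < m)%N) (hrho : 0 < rho) :
  exists2 kappa : R, 0 < kappa &
  forall (omega : 'rV[R]_d)
    (homega : forall k : 'rV[int]_d, k != 0 ->
       \sum_(j < d) (k 0 j)%:~R * omega 0 j != 0)
    (r : R) (hr : 0 < r)
    (f h : 'rV[R[i]]_d -> R[i] -> R[i])
    (hfa : torus_analytic rho r f) (hha : torus_analytic rho r h)
    (hfr : real_on_reals r f) (hhr : real_on_reals r h)
    (hh : vanishes_to_order l.+1 rho r h)
    (hfH : in_H rho m (fun theta : 'rV[R[i]]_d => oscillating f theta 0))
    (hf0 : average0 f != 0)
    (hkappa : (Hnorm rho m (fun theta : 'rV[R[i]]_d => oscillating f theta 0%R)
                 <= (kappa * `|average0 f|)%R%:E)%E),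
  exists2 eps0 : R, 0 < eps0 &
  exists2 A : R, 0 < A &
  forall eps : R, eps_range l (average0 f) eps0 eps ->
  exists (a : R) (V : 'rV[R[i]]_d -> R[i]),
    [/\ a ^+ l + eps * average0 f = 0,
        in_H rho m V /\ torus_real V,
        solves l r omega f h eps (response omega a V),
        (Hnorm rho m V <= (A * `|eps| `^ (l%:R^-1))%R%:E)%E &
        forall W : 'rV[R[i]]_d -> R[i],
          in_H rho m W -> torus_real W ->
          (Hnorm rho m W <= (A * `|eps| `^ (l%:R^-1))%R%:E)%E ->
          solves l r omega f h eps (response omega a W) ->
          forall theta : 'rV[R[i]]_d, strip rho theta -> W theta = V theta].
Proof.
case: l hl => [|[|n]]// _.
pose K := Kc R d m; have K0 : 0 < K := Kc_gt0 R d m.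
pose q := ratio R n; have q0 : 0 < q := ratio_gt0 R n.
exists (n.+2%:R * q / (4 * K)).
  by apply: divr_gt0; apply: mulr_gt0; rewrite ?ltr0n.
move=> omega homega r hr f h hfa hha hfr hhr [H hHa hH] hfH hf0.
set f0 := average0 f in hf0 *; move=> hkappa.
have E0 : 0 < `|f0| by rewrite normr_gt0.
have hg : inH m rho (fun x => comp f (fun=> 0) x - f0) (n.+2%:R * q / 4 * `|f0|).
  have k0 : 0 <= n.+2%:R * q / (4 * K) * `|f0|.
    by apply: mulr_ge0 => //; apply: divr_ge0; apply: mulr_ge0; rewrite // ltW.
  have := inH_of_in_H hm hrho k0 hfH hkappa.
  have -> : K * (n.+2%:R * q / (4 * K) * `|f0|) = n.+2%:R * q / 4 * `|f0|.
    by field; rewrite gt_eqF.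
  by apply: inH_eq => x; rewrite /oscillating ReB /comp rmorph0.
have [alpha al0 core] := nonlin_contracts hm hrho hf0 hr hfa hHa hg.
exists (alpha ^+ n.+2 / `|f0|); first by rewrite divr_gt0// exprn_gt0.
exists (q * `|f0| `^ (n.+2%:R^-1) / K).
  by rewrite divr_gt0// mulr_gt0// powR_gt0.
set A := q * _ / K.
have A0 : 0 < A by rewrite /A divr_gt0// mulr_gt0// powR_gt0.
move=> eps heps.
have li0 : (n.+2%:R^-1 : R) != 0 by rewrite invr_eq0 pnatr_eq0.
(* The linear part degenerates at a = 0; there the ball is reduced to the zero function. *)
have [e0|e0] := eqVneq eps 0.
  have [z1 z2] := in_H_cst0 hm hrho; exists 0, (fun=> 0).
  rewrite e0 normr0 powR0// mulr0 mul0r exprS mul0r addr0; split=> //.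
  - split=> // x; exact: rpred0.
  - have -> : response omega 0 (fun=> 0) = cst 0 by apply/funext => s; rewrite /response addr0.
    move=> t; split; first by rewrite normr0.
    rewrite hH; first last.
    + have : Normc.normc (0 : R)%:C < r by rewrite ncR normr0.
      by [].
    + by apply: strip_toC; exact: ltW.
    rewrite -realCX ReMl !exprS !mul0r !addr0.
    exact: is_derive_cst.
  - by move=> W hW _ hn _ theta; exact: (Hnorm_le0 hm hrho hW hn).
have [a [ha hal]] := amplitude hf0 heps e0.
have epsX : `|eps| * `|f0| = `|a| ^+ n.+2.
  by rewrite hal -powR_mulrn ?powR_ge0// -powRrM mulVf ?pnatr_eq0// powRr1// mulr_ge0.
have a0 : a != 0.
  by rewrite -normr_gt0 hal powR_gt0// mulr_gt0// normr_gt0.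
have ala : `|a| <= alpha.
  rewrite -(ler_pXn2r (ltn0Sn n.+1)) ?nnegrE ?(ltW al0)// -epsX -ler_pdivlMr//.
  exact: ltW (eps_range_lt heps).
have [sr N0 NL] := core _ _ a0 ala epsX.
(* A is chosen so that the ball of radius A |eps|^(1/l) is exactly that of the contraction. *)
have AE : K * (A * `|eps| `^ (n.+2%:R^-1)) = q * `|a|.
  by rewrite /A hal powRM//; field; rewrite gt_eqF.
have B0 : 0 <= A * `|eps| `^ (n.+2%:R^-1) by rewrite mulr_ge0 ?powR_ge0// ltW.
have lam0 : n.+2%:R * a ^+ n.+1 != 0 by rewrite mulf_neq0 ?pnatr_eq0// expf_neq0.
have [phi [hphi fphi uphi]] := contraction hm hrho homega lam0 N0 NL.
have small (psi : 'rV[R]_d -> R) : inH m rho psi (q * `|a|) -> forall x, `|a + psi x| < r.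
  move=> hpsi x; apply: le_lt_trans sr; apply: le_trans (ler_normD _ _) _.
  by rewrite lerD2l; exact: (inH_sup hm hrho x hpsi).
rewrite -AE in hphi; have [V [hV rV Vphi nV]] := in_H_of_inH hm hrho hphi.
have ReV : (fun x => complex.Re (V (toC x))) = phi by apply/funext => x; rewrite Vphi.
exists a, V; split=> //.
- have sV x : `|a + complex.Re (V (toC x))| < r by rewrite Vphi; apply: small; rewrite -AE.
  by apply: (solves_flow omega hrho f hH sV ha).2; rewrite ReV.
move=> W hW rW nW sW.
have hw : inH m rho (fun x => complex.Re (W (toC x))) (q * `|a|).
  by rewrite -AE; exact: (inH_of_in_H hm hrho B0 hW nW).
have fW := (solves_flow omega hrho f hH (small _ hw) ha).1 sW.
have Wphi := uphi _ hw fW.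
apply: (in_H_ext hW hV) => x.
by rewrite Vphi -Wphi (real_CP (rW x)).
Qed.
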